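(* Let $X$ be a minimal subshift. Then $X$ has nonsuperlinear-growth complexity, i.e. $\liminf_{n\to+\infty} p_X(n)/n < +\infty$, if and only if there exist $d \geq 1$ and an $\mathcal{S}$-adic sequence $\boldsymbol{\sigma} = (\sigma_n\colon \mathcal{A}_{n+1}\to\mathcal{A}_n^+)_{n\geq 0}$ generating $X$ such that for every $n\geq 0$: (P1) $\#\big(\mathrm{root}\,\sigma_{[0,n)}(\mathcal{A}_n)\big) \leq d$; (P2) $|\sigma_{[0,n)}(a)| \leq d\cdot|\sigma_{[0,n)}(b)|$ for all $a,b\in\mathcal{A}_n$. Moreover, if $X$ is infinite and has nonsuperlinear-growth complexity, then there exist $d \geq 1$ and an $\mathcal{S}$-adic sequence $\boldsymbol{\sigma} = (\sigma_n\colon \mathcal{A}_{n+1}\to\mathcal{A}_n^+)_{n\geq 0}$ generating $X$ and satisfying (P1) and (P2) for every $n\geq 0$ such that, in addition, $\boldsymbol{\sigma}$ is recognizable and $\#\mathcal{A}_n \leq d\cdot \mathrm{powcom}(X)^4$ for all $n\geq0$.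
   Context: An alphabet is a finite nonempty set $\mathcal{A}$; $\mathcal{A}^+$ is the set of nonempty finite words over $\mathcal{A}$, and $|w|$ is the length of a word $w$. The shift $S$ on $\mathcal{A}^{\mathbb{Z}}$ (product of discrete topologies) is $S((x_n)_n)=(x_{n+1})_n$. A subshift is a closed set $X\subseteq\mathcal{A}^{\mathbb{Z}}$ with $S(X)=X$; it is minimal if it is nonempty and contains no closed, $S$-invariant subset other than $\emptyset$ and $X$. $\mathcal{L}(X)$ is the set of nonempty words occurring in at least one $x\in X$, and $p_X(n)$ is the number of words of length $n$ in $\mathcal{L}(X)$. A map $\tau\colon\mathcal{A}\to\mathcal{B}^+$ is extended by concatenation to $\mathcal{A}^+\to\mathcal{B}^+$ and to $\mathcal{A}^{\mathbb{Z}}\to\mathcal{B}^{\mathbb{Z}}$ (with $\tau(x_0)$ starting at coordinate $0$). An $\mathcal{S}$-adic sequence is a sequence $\boldsymbol{\sigma}=(\sigma_n\colon\mathcal{A}_{n+1}\to\mathcal{A}_n^+)_{n\ge0}$ of such maps, where the $\mathcal{A}_n$ are alphabets. For $0\le n<m$, $\sigma_{[n,m)}=\sigma_n\circ\sigma_{n+1}\circ\cdots\circ\sigma_{m-1}\colon\mathcal{A}_m\to\mathcal{A}_n^+$; $\sigma_{[0,0)}$ is the identity. For $n\ge0$, $X^{(n)}_{\boldsymbol{\sigma}}$ is the set of $x\in\mathcal{A}_n^{\mathbb{Z}}$ such that for every $\ell\ge0$ the word $x_{-\ell}\cdots x_{\ell}$ occurs in $\sigma_{[n,m)}(a)$ for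 some $m>n$ and $a\in\mathcal{A}_m$. $\boldsymbol{\sigma}$ generates $X$ if $X^{(0)}_{\boldsymbol{\sigma}}=X$. Recognizability: for a subshift $Y\subseteq\mathcal{B}^{\mathbb{Z}}$ and $\tau\colon\mathcal{B}\to\mathcal{A}^+$, a $\tau$-factorization of $x\in\mathcal{A}^{\mathbb{Z}}$ in $Y$ is a pair $(k,y)\in\mathbb{Z}\times Y$ with $x=S^k\tau(y)$ and $0\le k<|\tau(y_0)|$; the pair $(Y,\tau)$ is recognizable if every $x\in\mathcal{A}^{\mathbb{Z}}$ has at most one $\tau$-factorization in $Y$. The sequence $\boldsymbol{\sigma}$ is recognizable if $(X^{(n)}_{\boldsymbol{\sigma}},\sigma_{[0,n)})$ is recognizable for every $n\ge1$. For a nonempty word $u$, $\mathrm{root}\,u$ is the shortest prefix $v$ of $u$ such that $u=v^k$ for some $k\ge1$; for a set of words $\mathcal{W}$, $\mathrm{root}\,\mathcal{W}=\{\mathrm{root}\,w: w\in\mathcal{W}\}$. $\#$ denotes cardinality. Power complexity: for $X\subseteq\mathcal{A}^{\mathbb{Z}}$ and $v\in\mathcal{A}^+$, let $\mathrm{Pow}_X(v)$ be the set of words $v^k$, $k\ge1$, for which there exist $u,w\in\mathcal{A}^+\setminus\{v\}$ of length $|v|$ with $uv^kw\in\mathcal{L}(X)$. Then $\mathrm{powcom}(X)=\sup_{v\in\mathcal{A}^+}\#\mathrm{Pow}_X(v)\in[0,+\infty]$ (if it is $+\infty$, the bound on $\#\mathcal{A}_n$ is vacuous). *)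

(* Defs.v *)
(* MathComp / MathComp-Analysis. *)
From HB Require Import structures.
From mathcomp Require Import all_boot all_order all_algebra.
From mathcomp Require Import all_classical all_reals all_analysis.

Set Implicit Arguments.
Unset Strict Implicit.
Unset Printing Implicit Defensive.

Import Order.TTheory GRing.Theory Num.Theory.
Local Open Scope classical_set_scope.
Local Open Scope card_scope.
Local Open Scope ring_scope.

(** ** Subshifts *)

Definition biseq (A : finType) : topologicalType :=
  prod_topology (fun _ : int => discrete_topology A : topologicalType).

(* [bishift k] is the k-th power S^k of the shift S = [bishift 1]. *)
Definition bishift (A : finType) (k : int) (x : biseq A) : biseq A :=
  fun i => x (i + k).

Definition shift_invariant (A : finType) (X : set (biseq A)) : Prop :=
  bishift 1 @` X = X.

Definition subshift (A : finType) (X : set (biseq A)) : Prop :=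
  closed X /\ shift_invariant X.

Definition minimal_subshift (A : finType) (X : set (biseq A)) : Prop :=
  [/\ subshift X, X !=set0 &
      forall Y : set (biseq A), closed Y -> shift_invariant Y -> Y `<=` X ->
        Y = set0 \/ Y = X].

(* The word x_i x_{i+1} ... x_{i+n-1}. *)
Definition window (A : finType) (x : biseq A) (i : int) (n : nat) : seq A :=
  [seq (x (i + j%:Z) : A) | j <- iota 0 n].

Definition language (A : finType) (X : set (biseq A)) : set (seq A) :=
  [set w | w != [::] /\
           exists x : biseq A, X x /\ exists i : int, w = window x i (size w)].

Definition complexity (A : finType) (X : set (biseq A)) (n : nat) : nat :=
  #|[pred w : n.-tuple A | `[< language X (w : seq A) >]]|.

(* The term n = 0 is 0 / 0 = 0, which is irrelevant for the inferior limit. *)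
Definition nonsuperlinear (R : realType) (A : finType) (X : set (biseq A)) :
    Prop :=
  (limn_einf (fun n : nat => ((complexity X n)%:R / n%:R : R)%:E) < +oo)%E.

(** ** Words: powers, roots, power complexity *)

Definition wpow (A : Type) (v : seq A) (k : nat) : seq A := flatten (nseq k v).

Definition is_proot (A : finType) (u v : seq A) : Prop :=
  prefix v u /\ exists2 k : nat, (1 <= k)%N & u = wpow v k.

(* v = root u *)
Definition is_root (A : finType) (u v : seq A) : Prop :=
  is_proot u v /\ forall v' : seq A, is_proot u v' -> (size v <= size v')%N.

Definition root_set (A : finType) (W : set (seq A)) : set (seq A) :=
  [set v | exists2 w, W w & is_root w v].

Definition Pow (A : finType) (X : set (biseq A)) (v : seq A) : set (seq A) :=
  [set z | exists2 k : nat, (1 <= k)%N & z = wpow v k /\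
     exists u w : seq A, [/\ u != v, w != v, size u = size v, size w = size v &
       language X (u ++ wpow v k ++ w)]].

(* [counting] is the cardinality, equal to +oo on infinite sets. *)
Definition powcom (R : realType) (A : finType) (X : set (biseq A)) : \bar R :=
  ereal_sup [set counting (Pow X v) | v in [set v : seq A | v != [::]]].

(** ** Substitutions and recognizability *)

Definition subst_word (A B : Type) (t : A -> seq B) (w : seq A) : seq B :=
  flatten (map t w).

(* t(y), with t(y_0) starting at coordinate 0. Coordinate j >= 0 is read from
   the left in t(y_0 ... y_j), and coordinate -(j+1) from the right in
   t(y_{-(j+1)} ... y_{-1}). When t takes only nonempty values, as it always
   does in an S-adic sequence, these words are long enough and the default
   letter b0 is never used. *)
Definition subst_biseq (A B : finType) (b0 : B) (t : A -> seq B) (y : biseq A) :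
    biseq B :=
  fun i => match i with
           | Posz j => nth b0 (subst_word t (window y 0 j.+1)) j
           | Negz j => nth b0 (rev (subst_word t (window y (Negz j) j.+1))) j
           end.

(* The default letter x_0 only serves to inhabit the alphabet. *)
Definition factorization (B A : finType) (Y : set (biseq B)) (t : B -> seq A)
    (x : biseq A) (k : int) (y : biseq B) : Prop :=
  [/\ Y y, x = bishift k (subst_biseq (x 0 : A) t y) &
      0 <= k < (size (t (y 0)))%:Z].

Definition recognizable_pair (B A : finType) (Y : set (biseq B))
    (t : B -> seq A) : Prop :=
  forall (x : biseq A) (k k' : int) (y y' : biseq B),
    factorization Y t x k y -> factorization Y t x k' y' -> k = k' /\ y = y'.

(** ** S-adic sequences *)

(* The sequence of alphabets A, L_0, L_1, ... *)
Definition level (A : finType) (L : nat -> finType) (n : nat) : finType :=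
  if n is k.+1 then L k else A.

(* S-adic sequences whose alphabet of index 0 is A, so that X^(0) is by typing a
   subset of A^Z, comparable with a subshift over A. *)
Record sadic (A : finType) := SAdic {
  upper : nat -> finType;
  morph : forall n : nat, level A upper n.+1 -> seq (level A upper n);
  alphabet_nonempty : forall n : nat, (0 < #|level A upper n|)%N;
  morph_nonempty : forall (n : nat) (a : level A upper n.+1), morph a != [::]
}.

Definition alphabet (A : finType) (s : sadic A) (n : nat) : finType :=
  level A (upper s) n.

(* s_n o s_{n+1} o ... o s_{m-1} for n <= m (and the junk value [::] when m < n).
   The recursion drops the first n substitutions, so that no transport between
   alphabets with equal indices is needed. *)
Fixpoint comp_subst (B : nat -> finType) (s : forall k, B k.+1 -> seq (B k))
    (n m : nat) {struct m} : B m -> seq (B n) :=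
  match n, m return B m -> seq (B n) with
  | 0, 0 => fun a => [:: a]
  | 0, m'.+1 => fun a => subst_word (@comp_subst B s 0 m') (s m' a)
  | n'.+1, m'.+1 =>
      @comp_subst (fun k => B k.+1) (fun k => s k.+1) n' m'
  | _.+1, 0 => fun=> [::]
  end.

Definition sigma (A : finType) (s : sadic A) (n m : nat) :
    alphabet s m -> seq (alphabet s n) :=
  @comp_subst (alphabet s) (@morph A s) n m.

Arguments sigma {A} s n m _.

(* X^(n) *)
Definition sadic_level (A : finType) (s : sadic A) (n : nat) :
    set (biseq (alphabet s n)) :=
  [set x | forall l : nat, exists m : nat, (n < m)%N /\
     exists a : alphabet s m,
       infix (window x (- l%:Z) (l.*2.+1)) (sigma s n m a)].

Arguments sadic_level {A} s n _.

Definition generates (A : finType) (s : sadic A) (X : set (biseq A)) : Prop :=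
  sadic_level s 0 = X.

Definition recognizable (A : finType) (s : sadic A) : Prop :=
  forall n : nat, (1 <= n)%N ->
    recognizable_pair (sadic_level s n) (sigma s 0 n).

(* (P1): # root s_[0,n)(A_n) <= d *)
Definition bounded_roots (A : finType) (s : sadic A) (d n : nat) : Prop :=
  root_set (range (sigma s 0 n)) #<= `I_d.

(* (P2) *)
Definition balanced_lengths (A : finType) (s : sadic A) (d n : nat) : Prop :=
  forall a b : alphabet s n, (size (sigma s 0 n a) <= d * size (sigma s 0 n b))%N.

(* Main.v *)
Require Import Defs.
From mathcomp Require Import all_boot all_order all_algebra.
From mathcomp Require Import all_classical all_reals all_analysis.
From mathcomp Require Import zify.

(** The easy implication counts words. Let [m] be the least length of a word
    sigma_[0,n)(a). A word of [X] of length [m] meets at most two consecutive words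
    of this kind, which are powers of at most [d] roots and have length at most
    [d m]; so there are O(m) such words ([sadic_complexity]). A finite minimal
    subshift is the orbit of a periodic point and is generated by squarings
    ([finite_sadic]).

    Now let [X] be infinite. There are arbitrarily large lengths [n] such that
    p(n) <= C n and such that there are at most [C] right special words of length [n]
    ([good_scales]). Between right special windows the future of a point is forced.
    Hence right special windows recur within p(n) steps ([right_special_gap]), and a
    stretch of a point that meets boundedly many of them is one of boundedly many
    words ([choices_path]). They are good places to cut points into blocks of length
    comparable to [n], except that they can accumulate. But if one word of length [n]
    occurs twice at a short distance, then both occurrences lie in a zone, a long
    maximal run of a short period ([close_zone]). Outside of zones, points are cut
    at the first right special window of each cluster ([mark_cut]); inside a zone,
    they are cut after each fixed number of periods, and the last piece takes the
    remainder ([zone_cut]). The blocks outside of zones are then boundedly many. Those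
    inside are powers of boundedly many words; the exponent of the last piece is the
    only unbounded one. It is governed by the exponent of a maximal power, of which
    the power complexity bounds the number ([typed_count]). Aperiodicity bounds the
    length of the zones at a given scale, so that the cuts are found by a local rule
    ([cut_local]). All this is summarized in [cut_rules].

    The scales are chosen one after the other, each so large that the range of the
    previous rule is negligible. A new cut is moved to the next cut of the previous
    level, and a new letter is a block together with some context on both sides,
    which determines the letters of the previous level that make up the block. The
    two ends of a block inside a zone have the same context and move by the same
    amount, so that the block remains a power of a word determined by its type; the
    number of roots therefore stays bounded ([new_roots]). Iteration yields the
    sequence ([infinite_sadic]). It generates [X] by uniform recurrence, and it is
    recognizable because blocks and letters are read off by local rules
    ([codings_generate], [codings_recognizable]). The bound on the alphabets obtained
    in this way is linear in the power complexity ([powcom_bound]), which is stronger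
    than the fourth power as the power complexity is at least 1. *)

Set Implicit Arguments.
Unset Strict Implicit.
Unset Printing Implicit Defensive.

Import Order.TTheory GRing.Theory Num.Theory.
Local Open Scope classical_set_scope.
Local Open Scope card_scope.
Local Open Scope ring_scope.

(** * Windows of biinfinite sequences *)

Section Words.
Variable (A : finType).
Implicit Types (x y z : biseq A) (w : seq A).

Lemma bishiftE x k i : bishift k x i = x (i + k). Proof. by []. Qed.

Lemma bishiftD x k l : bishift k (bishift l x) = bishift (k + l) x.
Proof. by apply: funext => i; rewrite !bishiftE addrA. Qed.

Lemma bishift0 x : bishift 0 x = x.
Proof. by apply: funext => i; rewrite bishiftE addr0. Qed.

Lemma size_window x i n : size (window x i n) = n.
Proof. by rewrite size_map size_iota. Qed.

Lemma nth_window a0 x i n k :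
  (k < n)%N -> nth a0 (window x i n) k = x (i + k%:Z).
Proof. by move=> kn; rewrite (nth_map 0%N) ?size_iota// nth_iota. Qed.

Lemma windowP x y i j n :
  window x i n = window y j n <->
  (forall k : int, 0 <= k < n%:Z -> x (i + k) = y (j + k)).
Proof.
split=> [e [k|//] /andP[_ kn]|e].
  have kn' : (k < n)%N by lia.
  by move: (nth_window (x i) x i kn'); rewrite e nth_window.
apply/eq_in_map => k; rewrite mem_iota => /andP[_ kn].
by apply: e; lia.
Qed.

Lemma window_cat x i m n :
  window x i (m + n)%N = window x i m ++ window x (i + m%:Z) n.
Proof.
rewrite /window iotaD map_cat add0n -{2}[m]addn0 iotaDl -map_comp.
by congr (_ ++ _); apply: eq_map => k /=; rewrite PoszD addrA.
Qed.

Lemma window_bishift x k i n : window (bishift k x) i n = window x (i + k) n.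
Proof. by apply/windowP => l _; rewrite bishiftE addrAC. Qed.

Lemma window_drop x i m n :
  (m <= n)%N -> drop m (window x i n) = window x (i + m%:Z) (n - m).
Proof.
by move=> mn; rewrite -{1}(subnKC mn) window_cat drop_size_cat ?size_window.
Qed.

Lemma windowS x i n : window x i n.+1 = (x i : A) :: window x (i + 1) n.
Proof. by rewrite -add1n window_cat /window /= addr0. Qed.

Lemma window_rcons x i n : window x i n.+1 = rcons (window x i n) (x (i + n%:Z)).
Proof. by rewrite -addn1 window_cat -cats1; congr (_ ++ _); rewrite /window/= addr0. Qed.

Lemma window_cat_inv x i u v :
  window x i (size (u ++ v)) = u ++ v ->
  window x i (size u) = u /\ window x (i + (size u)%:Z) (size v) = v.
Proof.
rewrite size_cat window_cat => /eqP.
by rewrite eqseq_cat ?size_window// => /andP[/eqP ? /eqP ?].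
Qed.

Lemma infix_window x i n w : infix w (window x i n) ->
  exists k : nat, (k + size w <= n)%N /\ window x (i + k%:Z) (size w) = w.
Proof.
case/infixP => u [v e]; exists (size u).
have := congr1 size e; rewrite size_window !size_cat => en.
split; first by rewrite en addnA leq_addr.
have : window x i (size (u ++ w ++ v)) = u ++ w ++ v.
  by rewrite -e size_window.
by move=> /window_cat_inv[_ /window_cat_inv[]].
Qed.

Lemma window_infix x (i j : int) (m n : nat) :
  i <= j -> j + m%:Z <= i + n%:Z -> infix (window x j m) (window x i n).
Proof.
move=> ij mn.
have -> : n = (absz (j - i) + (m + (n - m - absz (j - i))))%N by lia.
rewrite !window_cat (_ : i + _ = j); last by lia.
by apply/infixP; do 2 eexists.
Qed.

End Words.

(** * Compactness *)

Section Topology.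
Variable (A : finType).
Implicit Types (x y z : biseq A) (X Y : set (biseq A)).

Definition agree x y (i j : int) (l : nat) : Prop :=
  forall k : int, `|k| <= l%:Z -> x (i + k) = y (j + k).

Lemma nbhs_coord z (i : int) : nbhs z [set y : biseq A | y i = z i].
Proof.
have /(_ z) h := @proj_continuous int (fun=> discrete_topology A) i.
by apply: (h [set z i]); exact: discrete_set1.
Qed.

Lemma nbhs_cylinder z (l : nat) : nbhs z [set y | agree y z 0 0 l].
Proof.
elim: l => [|l IH].
  apply: filterS (nbhs_coord z 0) => y /= yz k k0.
  by rewrite (_ : k = 0) ?addr0//; lia.
apply: filterS (filterI IH (filterI (nbhs_coord z l.+1%:Z)
  (nbhs_coord z (- l.+1%:Z)))) => y [/= h1 [h2 h3]] k kl.
have [kl'|kl'] := leP `|k| l%:Z; first exact: h1.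
have [->|->] : k = l.+1%:Z \/ k = - l.+1%:Z by lia.
  by rewrite !add0r.
by rewrite !add0r.
Qed.

Lemma closed_approx Y :
  (forall z, (forall l, exists2 y, Y y & agree y z 0 0 l) -> Y z) -> closed Y.
Proof.
move=> h z cz; apply: h => l.
by have [y [? ?]] := cz _ (nbhs_cylinder z l); exists y.
Qed.

Lemma compact_biseq (X : set (biseq A)) : closed X -> compact X.
Proof.
move=> cX; apply: (subclosed_compact cX) (@subsetT _ X).
have := @tychonoff int (fun=> discrete_topology A) (fun=> setT)
  (fun=> @finite_compact (discrete_topology A) setT (@finite_finset A setT)).
by congr compact; apply/seteqP; split.
Qed.

(** A cluster point of the sequence agrees with infinitely many of its terms on
    each central window, because central windows define neighbourhoods. *)
Lemma limit_point X (u : nat -> biseq A) : closed X -> (forall n, X (u n)) ->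
  exists2 z, X z & forall l N : nat, exists2 n, (N <= n)%N & agree (u n) z 0 0 l.
Proof.
move=> /compact_biseq cX Xu.
have [z [Xz cz]] : X `&` cluster (u @ \oo) !=set0.
  by apply: cX; exists 0%N => // n _; exact: Xu.
exists z => // l N.
have [|_ [[n Nn <-] h]] := cz (u @` [set n | (N <= n)%N]) _ _ (nbhs_cylinder z l).
  by exists N => // n Nn; exists n.
by exists n.
Qed.

End Topology.

(** * Minimality, recurrence and aperiodicity *)

Lemma choice_exists2 (I T : Type) (P : T -> Prop) (Q : I -> T -> Prop) :
  (forall i, exists2 y, P y & Q i y) ->
  exists2 u : I -> T, forall i, P (u i) & forall i, Q i (u i).
Proof.
move=> h; have /choice[u hu] : forall i, exists y, P y /\ Q i y.
  by move=> i; have [y] := h i; exists y.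
by exists u => i; have [] := hu i.
Qed.

Section Minimality.
Variable (A : finType) (X : set (biseq A)).
Implicit Types (x y z : biseq A) (Y : set (biseq A)) (w : seq A).

Lemma shift_invariantP Y :
  shift_invariant Y <-> (forall y, Y y <-> Y (bishift 1 y)).
Proof.
split=> [e y|h].
  split=> [Yy|]; first by rewrite -e; exists y.
  rewrite -{1}e => -[z Yz /(congr1 (bishift (-1)))].
  by rewrite !bishiftD addNr !bishift0 => <-.
apply/seteqP; split=> [_ [y Yy <-]|y Yy /=]; first exact: (proj1 (h y)).
exists (bishift (-1) y); last by rewrite bishiftD subrr bishift0.
by apply/h; rewrite bishiftD subrr bishift0.
Qed.

Lemma shift_mem Y y k : shift_invariant Y -> Y y -> Y (bishift k y).
Proof.
move=> /shift_invariantP h; case: k => n; elim: n y => [|n IH] y Yy.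
- by rewrite bishift0.
- by rewrite intS addrC -bishiftD; apply: IH; exact: (proj1 (h _)).
- by apply: (proj2 (h _)); rewrite bishiftD (_ : _ + _ = 0) ?bishift0.
- rewrite (_ : Negz n.+1 = Negz n + -1); last by lia.
  rewrite -bishiftD; apply: IH; apply: (proj2 (h _)).
  by rewrite bishiftD (_ : _ + _ = 0) ?bishift0.
Qed.

Lemma closed_mem Y z :
  closed Y -> (forall l, exists2 y, Y y & agree y z 0 0 l) -> Y z.
Proof.
move=> cY /choice_exists2[u Yu uz].
have [z' Yz' h] := limit_point cY Yu.
suff -> : z = z' by [].
apply: funext => i; have [n ln /(_ i)] := h (absz i) (absz i).
rewrite !add0r => <-; last by lia.
by have := uz n i; rewrite !add0r => ->; last by lia.
Qed.

(** After a shift, the given points approach [z]. *)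
Lemma subshift_mem Y z : subshift Y ->
  (forall l : nat, exists y i, Y y /\
     window y i l.*2.+1 = window z (- l%:Z) l.*2.+1) -> Y z.
Proof.
move=> [cY iY] h; apply: (closed_mem cY) => l.
have [y [i [Yy /windowP e]]] := h l.
exists (bishift (i + l%:Z) y); first exact: shift_mem.
move=> k kl; rewrite bishiftE.
rewrite (_ : 0 + k + _ = i + (k + l%:Z)); last by lia.
by rewrite e; [congr (z _); lia | lia].
Qed.

Lemma language_window x i n : X x -> (0 < n)%N -> language X (window x i n).
Proof.
move=> Xx n0; split; first by rewrite -size_eq0 size_window -lt0n.
by exists x; split => //; exists i; rewrite size_window.
Qed.

Lemma languageE w : language X w ->
  exists x i, X x /\ window x i (size w) = w.
Proof. by case=> _ [x [Xx [i e]]]; exists x, i. Qed.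

Hypothesis mX : minimal_subshift X.

Lemma minimal_sub : subshift X. Proof. by case: mX. Qed.

Lemma minimal_full Y z : closed Y -> shift_invariant Y -> Y `<=` X -> Y z -> Y = X.
Proof. by case: mX => _ _ h cY iY YX Yz; case: (h Y) => // Y0; move: Yz; rewrite Y0. Qed.

(** If [w] were missing from longer and longer windows, then a limit of points
    centred at such windows would not contain [w] at all, and the points of [X]
    without [w] would be a proper subshift. *)
Lemma uniform_recurrence w : language X w ->
  exists N : nat, forall x (i : int), X x ->
    exists2 j : int, i <= j <= i + N%:Z & window x j (size w) = w.
Proof.
move=> Lw; apply: contrapT => /forallNP hN.
have [cX iX] := minimal_sub.
have {}hN : forall N : nat, exists2 x, X x &
    forall j : int, `|j| <= N%:Z -> window x j (size w) <> w.
  move=> N; have := hN N.*2; move=> /existsNP[x /existsNP[i /not_implyP[Xx h]]].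
  exists (bishift (i + N%:Z) x); first exact: shift_mem.
  move=> j jN; rewrite window_bishift => e; apply: h.
  by exists (j + (i + N%:Z)) => //; lia.
have [u Xu hu] := choice_exists2 hN.
have [z Xz hz] := limit_point cX Xu.
pose Y := [set y | X y /\ forall j, window y j (size w) <> w].
have Yz : Y z.
  split=> // j; have [n jn zn] := hz (absz j + size w)%N (absz j).
  suff -> : window z j (size w) = window (u n) j (size w) by apply: hu; lia.
  apply/windowP => k kw; have := zn (j + k); rewrite !add0r => -> //; lia.
have [x [i [Xx xw]]] := languageE Lw.
have : Y = X.
  apply: (minimal_full (z := z)) => // [||y []//].
  - apply: closed_approx => y h; split.
      by apply: (closed_mem cX) => l; have [y' [? ?] ?] := h l; exists y'.
    move=> j e; have [y' [_ /(_ j) n] yy'] := h (absz j + size w)%N.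
    apply: n; rewrite -[RHS]e; apply/windowP => k kw.
    by have := yy' (j + k); rewrite !add0r => -> //; lia.
  - apply/shift_invariantP => y; split=> -[Xy h]; split.
    + exact: shift_mem.
    + by move=> j; rewrite window_bishift.
    + by have := shift_mem (-1) iX Xy; rewrite bishiftD addNr bishift0.
    + by move=> j e; apply: (h (j - 1)); rewrite window_bishift subrK.
by move=> YX; move: Xx; rewrite -YX => -[_ /(_ i)]; rewrite xw.
Qed.

(** The points of [X] of period [p] form a closed invariant set, which is [X] by
    minimality, and each of them is determined by [p] letters. *)
Lemma periodic_point_finite z (p : nat) : (0 < p)%N -> X z ->
  (forall i : int, z i = z (i + p%:Z)) -> finite_set X.
Proof.
move=> p0 Xz zp; have [cX iX] := minimal_sub.
pose Y := [set y | X y /\ forall i : int, y i = y (i + p%:Z)].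
have YX : Y = X.
  apply: (minimal_full (z := z)) => // [||y []//].
  - apply: closed_approx => y h; split.
      by apply: (closed_mem cX) => l; have [y' [? ?] ?] := h l; exists y'.
    move=> i; have [y' [_ y'p] yy'] := h (absz i + p)%N.
    have := yy' i; have := yy' (i + p%:Z); rewrite !add0r => <-; last by lia.
    by move=> <-; last by lia.
  - apply/shift_invariantP => y; split=> -[Xy h]; split.
    + exact: shift_mem.
    + by move=> i; rewrite !bishiftE h; congr (y _); lia.
    + by have := shift_mem (-1) iX Xy; rewrite bishiftD addNr bishift0.
    + by move=> i; have := h (i - 1); rewrite !bishiftE subrK => ->; congr (y _); lia.
pose f (w : p.-tuple A) : biseq A := fun i => nth (z 0) w (absz (i %% p%:Z)%Z).
apply: (@sub_finite_set _ _ (f @` setT)); last exact: finite_image.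
move=> y; rewrite -{1}YX => -[Xy yp] /=.
exists (tcast (size_window y 0 p) (in_tuple (window y 0 p))) => //.
apply: funext => i; rewrite /f val_tcast /=.
have i0 : 0 <= (i %% p%:Z)%Z < p%:Z by rewrite modz_ge0 ?ltz_pmod//; lia.
rewrite nth_window; last by lia.
have yq : forall k : nat, forall j, y j = y (j + k%:Z * p%:Z).
  elim=> [|k IH] j; first by rewrite mul0r addr0.
  by rewrite IH yp; congr (y _); lia.
rewrite add0r; move: i0; have := divz_eq i p%:Z.
move: (i %/ p%:Z)%Z (i %% p%:Z)%Z => d r -> r0.
rewrite (_ : (absz r)%:Z = r); last by lia.
case: d => d; first by rewrite (yq d) addrC.
by rewrite [RHS](yq d.+1); congr (y _); lia.
Qed.

Hypothesis iX : infinite_set X.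

(** Arbitrarily long runs of period [p] would have a periodic point as a limit. *)
Lemma aperiodicity (p : nat) : (0 < p)%N ->
  exists B : nat, forall x (i : int), X x ->
    exists2 j : int, i <= j < i + B%:Z & x j <> x (j + p%:Z).
Proof.
move=> p0; apply: contrapT => /forallNP hN.
have [cX sX] := minimal_sub.
have {}hN : forall N : nat, exists2 x, X x &
    forall j : int, `|j| <= N%:Z -> x j = x (j + p%:Z).
  move=> N; have := hN N.*2.+1; move=> /existsNP[x /existsNP[i /not_implyP[Xx h]]].
  exists (bishift (i + N%:Z) x); first exact: shift_mem.
  move=> j jN; rewrite !bishiftE; apply: contrapT => e; apply: h.
  by exists (j + (i + N%:Z)); [lia | rewrite addrAC].
have [u Xu hu] := choice_exists2 hN.
have [z Xz hz] := limit_point cX Xu.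
apply: iX; apply: (periodic_point_finite p0 Xz) => i.
have [n Nn zn] := hz (absz i + p)%N (absz i).
have := zn i; have := zn (i + p%:Z); rewrite !add0r => <-; last by lia.
by move=> <-; [apply: hu; lia | lia].
Qed.

Lemma aperiodicity_le (q : nat) :
  exists B : nat, forall (p : nat) x (i : int), X x -> (0 < p <= q)%N ->
    exists2 j : int, i <= j < i + B%:Z & x j <> x (j + p%:Z).
Proof.
elim: q => [|q [B hB]]; first by exists 0%N; lia.
have [B' hB'] := aperiodicity (ltn0Sn q).
exists (B + B')%N => p x i Xx pq.
have [{}pq|] : (0 < p <= q)%N \/ p = q.+1 by lia.
  by have [j ? ?] := hB p x i Xx pq; exists j => //; lia.
by move=> ->; have [j ? ?] := hB' x i Xx; exists j => //; lia.
Qed.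

End Minimality.

(** * Complexity and right special words *)

(** The inferior limit is the supremum of the infima of the tails. *)
Lemma nonsuperlinearP (R : realType) (A : finType) (X : set (biseq A)) :
  nonsuperlinear R X <->
  exists K : nat, forall B : nat, exists2 n : nat, (B <= n)%N &
    (complexity X n <= K * n)%N.
Proof.
rewrite /nonsuperlinear limn_einf_lim; set u := fun n => _.
have cu : cvgn (einfs u) by exact: is_cvg_einfs.
split=> [|[K hK]].
  have -> : limn (einfs u) = ereal_sup (range (einfs u)).
    by apply/cvg_lim => //; apply: ereal_nondecreasing_cvgn; exact: nondecreasing_einfs.
  move=> lt.
  have [K sK] : exists K : nat, (ereal_sup (range (einfs u)) < (K%:R : R)%:E)%E.
    move: lt; case: (ereal_sup _) => [r| |] // _.
      exists (Num.truncn `|r|).+1; rewrite lte_fin.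
      by apply: le_lt_trans (ler_norm r) _; exact: truncnS_gt.
    by exists 0%N; exact: ltNyr.
  exists K => B.
  have : (einfs u B < (K%:R : R)%:E)%E.
    by apply: le_lt_trans sK; apply: ereal_sup_ubound; exists B.
  move=> /ereal_inf_lt[_ [n /= Bn <-]]; rewrite lte_fin => un.
  exists n => //; case: n Bn un => [|n] Bn un.
    rewrite muln0 leqn0; apply/eqP/eq_card0 => t.
    by rewrite inE; apply/asboolP => -[]; rewrite tuple0.
  move: un; rewrite ltr_pdivrMr ?ltr0n// -natrM ltr_nat => /ltnW//.
apply: (@le_lt_trans _ _ ((K%:R : R)%:E)); last exact: ltry.
apply: lime_le => //; apply: nearW => B.
have [n Bn pn] := hK B.
apply: (@le_trans _ _ (u n)); first by apply: ereal_inf_lbound; exists n.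
rewrite lee_fin; case: n Bn pn => [|n] _ pn; first by rewrite invr0 mulr0.
by rewrite ler_pdivrMr ?ltr0n// -natrM ler_nat.
Qed.

Section RightSpecial.
Variable (A : finType) (X : set (biseq A)).
Implicit Types (x y z : biseq A) (w : seq A).
Hypothesis X0 : X !=set0.

Definition words (n : nat) : seq (seq A) :=
  [seq tval t | t <- enum [pred t : n.-tuple A | `[< language X (t : seq A) >]]].

Lemma size_words n : size (words n) = complexity X n.
Proof. by rewrite size_map -cardE. Qed.

Lemma words_uniq n : uniq (words n).
Proof. by rewrite map_inj_uniq ?enum_uniq//; exact: val_inj. Qed.

Lemma mem_words n w : (w \in words n) <-> size w = n /\ language X w.
Proof.
split=> [/mapP[t]|[wn Lw]].
  by rewrite mem_enum => /asboolP ? ->; rewrite size_tuple.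
apply/mapP; exists (tcast wn (in_tuple w)); last by rewrite val_tcast.
by rewrite mem_enum; apply/asboolP; rewrite val_tcast.
Qed.

Definition right_special w : Prop :=
  exists a b : A, [/\ a <> b, language X (rcons w a) & language X (rcons w b)].

Lemma language_rcons w : language X w -> exists a, language X (rcons w a).
Proof.
move=> /languageE[x [i [Xx xw]]]; exists (x (i + (size w)%:Z)).
by rewrite -{1}xw -window_rcons; exact: language_window.
Qed.

Lemma language_prefix w a : language X (rcons w a) -> w != [::] -> language X w.
Proof.
move=> [_ [x [Xx [i]]]]; rewrite size_rcons window_rcons => /eqP.
rewrite eqseq_rcons => /andP[/eqP e _] w0; split=> //.
by exists x; split=> //; exists i.
Qed.

Lemma not_right_special x y i j n : X x -> X y ->
  window x (i - n%:Z) n = window y (j - n%:Z) n ->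
  ~ right_special (window x (i - n%:Z) n) -> x i = y j.
Proof.
move=> Xx Xy e nrs; apply: contrapT => xy; apply: nrs.
exists (x i), (y j); split=> //.
  have -> : rcons (window x (i - n%:Z) n) (x i) = window x (i - n%:Z) n.+1.
    by rewrite window_rcons subrK.
  exact: language_window.
have -> : rcons (window x (i - n%:Z) n) (y j) = window y (j - n%:Z) n.+1.
  by rewrite window_rcons subrK e.
exact: language_window.
Qed.

(** Each word of length [n] has an extension by one letter to the right, and a
    right special one has a second extension. *)
Lemma right_special_count n : (0 < n)%N -> exists rs : seq (seq A),
  (size rs + complexity X n <= complexity X n.+1)%N /\
  forall w, size w = n -> right_special w -> w \in rs.
Proof.
move=> n0; pose rs := [seq w <- words n | `[< right_special w >]].
have rsP w : size w = n -> right_special w -> w \in rs.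
  move=> wn rw; rewrite mem_filter; apply/andP; split; first exact/asboolP.
  apply/mem_words; split=> //; have [a [_ [_ La _]]] := rw.
  by apply: language_prefix La _; rewrite -size_eq0 wn -lt0n.
exists rs; split=> //.
have [x0 Xx0] := X0.
have /choice[a1 La1] : forall w, exists a, language X w -> language X (rcons w a).
  move=> w.
  have [/language_rcons[a La]|nw] := pselect (language X w); first by exists a.
  by exists (x0 0).
have /choice[a2 La2] : forall w, exists a, right_special w ->
    a <> a1 w /\ language X (rcons w a).
  move=> w.
  have [[a [b [ab La Lb]]]|nw] := pselect (right_special w); last by exists (x0 0).
  have [e|ne] := eqVneq a (a1 w); last by exists a => _; split=> //; exact/eqP.
  by exists b => _; split=> //; rewrite -e => /esym.
pose ext (f : seq A -> A) w := rcons w (f w).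
have ext_inj f : injective (ext f) by move=> v w /rcons_inj[].
rewrite addnC -!size_words -(size_map (ext a1)) -(size_map (ext a2) rs) -size_cat.
apply: uniq_leq_size => [|w].
  rewrite cat_uniq !(map_inj_uniq (@ext_inj _)) words_uniq filter_uniq ?words_uniq// andbT.
  apply/hasPn => _ /mapP[w wrs ->]; apply/negP => /mapP[v _] /rcons_inj[<-].
  by move: wrs; rewrite mem_filter => /andP[/asboolP/La2[]].
rewrite mem_cat => /orP[] /mapP[v vw ->]; apply/mem_words; rewrite size_rcons.
  by have /mem_words[-> /La1] := vw.
by move: vw; rewrite mem_filter => /andP[/asboolP/La2[_ ?] /mem_words[-> _]].
Qed.

Lemma complexity_mono m n : (0 < m <= n)%N ->
  (complexity X m <= complexity X n)%N.
Proof.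
move=> /andP[m0]; elim: n => [|n IH]; first by rewrite leqn0 => /eqP ->.
rewrite leq_eqVlt => /orP[/eqP -> //|mn]; apply: leq_trans (IH mn) _.
have [rs [h _]] := right_special_count (leq_trans m0 mn).
exact: leq_trans (leq_addl _ _) h.
Qed.

(** If all the differences of the complexity between [n/2] and [n] exceeded [2K],
    then the complexity at [n] would exceed [K n]. The constant [3 K] appears
    because the good length may be as small as [n/2]. *)
Lemma good_scales K :
  (forall B, exists2 n : nat, (B <= n)%N & (complexity X n <= K * n)%N) ->
  exists C : nat, forall B, exists n : nat, exists rs : seq (seq A),
    [/\ (B <= n)%N, (complexity X n <= C * n)%N, (size rs <= C)%N &
     forall w, size w = n -> right_special w -> w \in rs].
Proof.
move=> hK; exists (3 * K)%N => B.
have [n Bn pn] := hK (B.*2 + 4)%N.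
have [i [in2 pi]] : exists i, (n./2 <= i < n)%N /\
    (complexity X i.+1 <= complexity X i + 2 * K)%N.
  apply: contrapT => /forallNP h.
  have {}h k : (n./2 + k <= n)%N ->
      (k * (2 * K).+1 <= complexity X (n./2 + k))%N.
    elim: k => [|k IH] kn //.
    have := h (n./2 + k)%N; rewrite addnS => /not_andP[]; first by lia.
    by have := IH (ltac:(lia)); lia.
  by have := h (n - n./2)%N (ltac:(lia)); rewrite subnKC; nia.
have [rs [c1 c2]] := right_special_count (n := i) (ltac:(lia)).
exists i, rs; split=> //; [lia| |lia].
by have := complexity_mono (m := i) (n := n) (ltac:(lia)); nia.
Qed.

(** Among one more windows than there are words, one is repeated; without right
    special windows in between, the letters that follow the two occurrences agree
    forever, which makes the point periodic from there on. *)
Lemma right_special_gap n x (i : int) : minimal_subshift X -> infinite_set X ->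
  (0 < n)%N -> X x -> exists2 j : int, i <= j <= i + (complexity X n)%:Z &
    right_special (window x (j - n%:Z) n).
Proof.
move=> mX iX n0 Xx; apply: contrapT => h.
have {}h j : i <= j <= i + (complexity X n)%:Z ->
  ~ right_special (window x (j - n%:Z) n) by move=> ? ?; apply: h; exists j.
pose W (k : nat) := window x (i + k%:Z - n%:Z) n.
have [k [k' [kk' k'n Wk]]] : exists k k', [/\ (k < k')%N,
    (k' <= complexity X n)%N & W k = W k'].
  pose s := [seq W k | k <- iota 0 (complexity X n).+1].
  have /(uniqPn [::]) : ~~ uniq s.
    apply/negP => us.
    suff : (size s <= size (words n))%N.
      by rewrite size_words size_map size_iota ltnn.
    apply: uniq_leq_size => // _ /mapP[k _ ->]; apply/mem_words.
    by rewrite size_window; split=> //; exact: language_window.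
  move=> [k [k' []]]; rewrite size_map size_iota => kk' k'n.
  rewrite !(nth_map 0%N) ?size_iota//; last exact: ltn_trans kk' k'n.
  by rewrite !nth_iota// ?(ltn_trans kk' k'n)// => e; exists k, k'.
(* windows that follow the first occurrence repeat those between the two *)
have key t : W (k + t)%N = W (k' + t)%N /\ ~ right_special (W (k + t)%N).
  elim/ltn_ind: t => t IH.
  have e : W (k + t)%N = W (k' + t)%N.
    case: t IH => [|t] IH; first by rewrite !addn0.
    have [e nr] := IH t (ltnSn t).
    have xx := not_right_special Xx Xx e nr.
    rewrite /W; apply/windowP => l ln; have [l0|ll] := eqVneq l (n%:Z - 1).
      by rewrite l0 (_ : _ + _ = i + (k + t)%:Z); [rewrite xx; congr (x _)|]; lia.
    move: e => /windowP/(_ (l + 1)).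
    rewrite (_ : _ + (l + 1) = i + (k + t.+1)%:Z - n%:Z + l); last by lia.
    rewrite (_ : i + (k' + t)%:Z - _ + (l + 1) = i + (k' + t.+1)%:Z - n%:Z + l); last by lia.
    by apply; lia.
  split=> //; have [tk|tk] := ltnP t (k' - k)%N; first by apply: h; lia.
  have [e' nr] := IH (t - (k' - k))%N (ltac:(lia)).
  by move: e' nr; rewrite (_ : (k' + _ = k + t)%N); [move=> -> | lia].
have [B hB] := aperiodicity mX iX (p := (k' - k)%N) (ltac:(lia)).
have [j jB] := hB x (i + k%:Z) Xx; apply.
have [e nr] := key (absz (j - (i + k%:Z))%R).
have := not_right_special Xx Xx e nr.
rewrite (_ : i + _ = j); last by lia.
by move=> ->; congr (x _); lia.
Qed.

End RightSpecial.

(** * Periods and zones *)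

Lemma dvdz_leq (d p : int) : 0 < p -> (d %| p)%Z -> d <= p.
Proof. by rewrite /dvdz => p0 /dvdn_leq; lia. Qed.

Lemma divz_bounds (a p : int) : 0 < p -> (a %/ p)%Z * p <= a < (a %/ p)%Z * p + p.
Proof.
move=> p0; have := divz_eq a p; have := modz_ge0 a (lt0r_neq0 p0).
have := ltz_pmod a p0; lia.
Qed.

Section Periods.
Variable (A : finType).
Implicit Types (x y z : biseq A) (i j s t p g : int).

Definition per x s t p : Prop :=
  forall i, s <= i -> i + p < t -> x i = x (i + p).

Lemma per_sub x s t s' t' p : s <= s' -> t' <= t -> per x s t p -> per x s' t' p.
Proof. by move=> ss tt h i si it; apply: h; lia. Qed.

Lemma per_mul x s t p (k : nat) : 0 < p -> per x s t p -> per x s t (k%:Z * p).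
Proof.
move=> p0 h; elim: k => [|k IH] i si it; first by rewrite mul0r addr0.
rewrite IH//; last by nia.
by rewrite h; [congr (x _); nia | nia | nia].
Qed.

(** Fine and Wilf's theorem, by subtracting the smaller period from the larger. *)
Lemma per_gcd x s t p g : 0 < p -> 0 < g -> p + g <= t - s ->
  per x s t p -> per x s t g ->
  exists d, [/\ 0 < d, per x s t d, (d %| p)%Z & (d %| g)%Z].
Proof.
have [k] := ubnP (absz (p + g)%R); elim: k p g => // k IH p g pk p0 g0 L hp hg.
wlog pg : p g pk p0 g0 L hp hg / p <= g.
  move=> H; have [|/ltW gp] := leP p g; first exact: H.
  have [|||||||d [? ? ? ?]] := H g p; try lia; try by [].
  by exists d.
have [<-|ne] := eqVneq p g; first by exists p; rewrite dvdzz.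
have hgp : per x s t (g - p).
  move=> i si it; have [ig|ig] := ltP (i + g) t.
    by rewrite (hg i)// [RHS]hp; [congr (x _); lia | lia | lia].
  by rewrite -(subrK p i) -hp; [rewrite hg; [congr (x _)|..]| |]; lia.
have [||||||d [d0 hd dp dg]] := IH p (g - p); try lia; try by [].
by exists d; split=> //; rewrite -(subrK p g) rpredD.
Qed.

(** A coordinate can be moved by multiples of [p] into the shorter interval without
    changing the letters at it and at distance [g] from it. *)
Lemma per_extend x s t s' t' p g : s <= s' -> t' <= t -> 0 < g -> 0 < p ->
  (g %| p)%Z -> p + g <= t' - s' -> per x s t p -> per x s' t' g -> per x s t g.
Proof.
move=> ss tt g0 p0 gp L hp hg i si it.
have up (k : nat) j : s <= j -> j + k%:Z * p < t -> x j = x (j + k%:Z * p).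
  by move=> ? ?; apply: (per_mul p0 hp).
pose k := absz ((s' - i) %/ p)%Z; pose r := ((s' - i) %% p)%Z.
have r0 : 0 <= r < p by rewrite modz_ge0 ?ltz_pmod//; lia.
have e : s' - i = ((s' - i) %/ p)%Z * p + r by exact: divz_eq.
have [is'|is'] := leP s' i; last first.
  have k0 : ((s' - i) %/ p)%Z = k%:Z by rewrite /k; nia.
  rewrite k0 in e.
  have [r00|rn0] := eqVneq r 0.
    rewrite (up k i) ?(up k (i + g))//; try lia.
    by rewrite hg; [congr (x _)| |]; lia.
  rewrite (up k.+1 i) ?(up k.+1 (i + g))//; try nia.
  by rewrite hg; [congr (x _)| |]; nia.
have [it'|it'] := ltP (i + g) t'; first exact: hg.
have k0 : ((s' - i) %/ p)%Z = - k%:Z by rewrite /k; nia.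
rewrite k0 in e.
have -> : i = (s' - r) + k%:Z * p by lia.
have [r00|rn0] := eqVneq r 0.
  rewrite (_ : _ + _ + g = s' - r + g + k%:Z * p); last by lia.
  by rewrite -(up k (s' - r)) -?(up k (s' - r + g)); [apply: hg|..]; lia.
case: k e k0 => [|k] e k0; first by lia.
have -> : s' - r + k.+1%:Z * p = (s' - r + p) + k%:Z * p by lia.
rewrite (_ : _ + _ + g = s' - r + p + g + k%:Z * p); last by lia.
by rewrite -(up k (s' - r + p)) -?(up k (s' - r + p + g)); [apply: hg|..]; lia.
Qed.

Lemma per_window x i j (n : nat) : i <= j ->
  window x (i - n%:Z) n = window x (j - n%:Z) n -> per x (i - n%:Z) j (j - i).
Proof.
move=> ij /windowP h k ki kj; have := h (k - (i - n%:Z)).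
rewrite (_ : i - n%:Z + (k - (i - n%:Z)) = k); last by lia.
by move=> ->; [congr (x _)|]; lia.
Qed.

Lemma window_per x i j s t p (n k : nat) : per x s t p -> 0 < p ->
  s <= i -> j + n%:Z <= t -> j = i + k%:Z * p -> window x i n = window x j n.
Proof.
move=> hp p0 si + e; rewrite e => jt; apply/windowP => l ln.
by rewrite (per_mul (k := k) p0 hp); [congr (x _)| |]; lia.
Qed.

End Periods.

Section Zones.
Variables (A : finType) (n q : nat).
Implicit Types (x y z : biseq A) (i j s t p g : int).
Hypothesis nq : (q.*2 <= n)%N.

(** A maximal run of a short period, [p] being its least period. The length
    [n + p] is the least one for which some window of length [n] occurs twice. *)
Definition zone x s t p : Prop :=
  [/\ [/\ 0 < p, p <= q%:Z & n%:Z + p <= t - s], per x s t p,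
      forall g, 0 < g < p -> ~ per x s t g,
      x (s - 1) <> x (s - 1 + p) & x (t - p) <> x t].

(** By Fine and Wilf's theorem the gcd of the two periods is a period of the
    overlap, and it extends to both zones. As both periods are minimal they are
    equal, and then both runs extend to their union. *)
Lemma zone_unique x s t p s' t' p' (a b : int) : zone x s t p -> zone x s' t' p' ->
  s <= a -> s' <= a -> b <= t -> b <= t' -> (q.*2)%:Z <= b - a ->
  [/\ s = s', t = t' & p = p'].
Proof.
move=> [[p0 pq L] hp mp ls lt] [[p0' pq' L'] hp' mp' ls' lt'] sa sa' bt bt' ab.
have [|||d [d0 hd dp dp']] := @per_gcd _ x a b p p' p0 p0'; try lia.
- exact: per_sub hp.
- exact: per_sub hp'.
have {}dp : d = p.
  apply/eqP; rewrite eq_le dvdz_leq//= leNgt; apply/negP => dlp.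
  by apply: (mp d); [lia|apply: (per_extend (s' := a) (t' := b) (p := p)) => //; lia].
have {}dp' : d = p'.
  apply/eqP; rewrite eq_le dvdz_leq//= leNgt; apply/negP => dlp.
  by apply: (mp' d); [lia|apply: (per_extend (s' := a) (t' := b) (p := p')) => //; lia].
subst p' d; split=> //.
- apply/eqP; rewrite eq_le; apply/andP; split; rewrite leNgt; apply/negP => lt1.
    by apply: ls; apply: hp'; lia.
  by apply: ls'; apply: hp; lia.
- apply/eqP; rewrite eq_le; apply/andP; split; rewrite leNgt; apply/negP => lt1.
    by apply: lt'; rewrite hp ?subrK//; lia.
  by apply: lt; rewrite hp' ?subrK//; lia.
Qed.

Lemma zone_exists x (B : nat) (a b g : int) :
  (forall (p : nat) i, (0 < p <= q)%N ->
     exists2 j, i <= j < i + B%:Z & x j <> x (j + p%:Z)) ->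
  0 < g -> g <= q%:Z -> n%:Z + g <= b - a -> per x a b g ->
  exists s t p, [/\ zone x s t p, s <= a, b <= t & p <= g].
Proof.
move=> hB g0 gq L hg.
have [p [p0 hp mp]] : exists p : nat, [/\ (0 < p)%N, per x a b p%:Z &
    forall k : nat, (0 < k)%N -> per x a b k%:Z -> (p <= k)%N].
  pose P (p : nat) := `[< (0 < p)%N /\ per x a b p%:Z >].
  have exP : exists p : nat, P p.
    exists (absz g); apply/asboolP; split; first by lia.
    by rewrite (_ : (absz g)%:Z = g) //; lia.
  case: (ex_minnP exP) => p /asboolP[p0 hp] mp; exists p; split=> // k k0 hk.
  by apply: mp; exact/asboolP.
have pg : p%:Z <= g.
  have := mp (absz g); rewrite (_ : (absz g)%:Z = g); last by lia.
  by move=> /(_ (ltac:(lia)) hg); lia.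
have bound (c d : int) : per x c d p%:Z -> d - c <= (B + p)%N%:Z.
  move=> h; rewrite leNgt; apply/negP => Bc.
  have [|j jB xj] := hB p c; first by lia.
  by apply: xj; apply: h; lia.
have [e [he me]] : exists e : nat, per x (a - e%:Z) b p%:Z /\
    ~ per x (a - e.+1%:Z) b p%:Z.
  pose P (e : nat) := `[< per x (a - e%:Z) b p%:Z >].
  have exP : exists e : nat, P e by exists 0%N; apply/asboolP; rewrite subr0.
  have ub e : P e -> (e <= B + p)%N by move=> /asboolP/bound; lia.
  case: (ex_maxnP exP ub) => e /asboolP he me; exists e; split=> // he'.
  by have := me e.+1; rewrite ltnn => h; suff : false by []; apply: h; exact/asboolP.
have [f [hf mf]] : exists f : nat, per x (a - e%:Z) (b + f%:Z) p%:Z /\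
    ~ per x (a - e%:Z) (b + f.+1%:Z) p%:Z.
  pose P (f : nat) := `[< per x (a - e%:Z) (b + f%:Z) p%:Z >].
  have exP : exists f : nat, P f by exists 0%N; apply/asboolP; rewrite addr0.
  have ub f : P f -> (f <= B + p)%N by move=> /asboolP/bound; lia.
  case: (ex_maxnP exP ub) => f /asboolP hf mf; exists f; split=> // hf'.
  by have := mf f.+1; rewrite ltnn => h; suff : false by []; apply: h; exact/asboolP.
exists (a - e%:Z), (b + f%:Z), p%:Z; split; try lia; split; try lia.
- by split; lia.
- exact: hf.
- move=> k kp hk; have := mp (absz k); rewrite (_ : (absz k)%:Z = k); last by lia.
  have hk' : per x a b k by apply: per_sub hk; lia.
  by move=> /(_ (ltac:(lia)) hk'); lia.
- move=> e1; apply: me => i ai ib; have [->|ne] := eqVneq i (a - e%:Z - 1) => //.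
  by apply: he; lia.
- move=> e1; apply: mf => i ai ib; have [ie|ne] := eqVneq i (b + f%:Z - p%:Z).
    by rewrite ie e1; congr (x _); lia.
  by apply: hf; lia.
Qed.

(** A window that recurs after fewer than [p] steps would yield a period of the
    zone smaller than [p]. *)
Lemma zone_windows_distinct x s t p i j : zone x s t p ->
  s + n%:Z <= i -> i < j -> j <= t -> j - i < p ->
  window x (i - n%:Z) n <> window x (j - n%:Z) n.
Proof.
move=> [[p0 pq L] hp mp _ _] si ij jt jip /(per_window (ltW ij)) h.
have [||||d [d0 hd dp dg]] := @per_gcd _ x (i - n%:Z) j p (j - i) p0; try lia.
- by apply: per_sub hp; lia.
- exact: h.
have dlp : d <= j - i by rewrite dvdz_leq//; lia.
apply: (mp d); first by lia.
by apply: (per_extend (s' := i - n%:Z) (t' := j) (p := p)) => //; lia.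
Qed.

(** The last window of a zone is followed by a letter that breaks the period, and
    its occurrence one period earlier by the letter that continues it. *)
Lemma zone_end_special (X : set (biseq A)) x s t p : X x -> zone x s t p ->
  right_special X (window x (t - n%:Z) n).
Proof.
move=> Xx [[p0 pq L] hp _ _ lt]; apply: contrapT => nr.
apply: lt; apply: esym.
have e : window x (t - p - n%:Z) n = window x (t - n%:Z) n.
  by apply: (window_per (k := 1) hp) => //; lia.
exact: (not_right_special Xx Xx (esym e) nr).
Qed.

End Zones.

(** * Powers in a language *)

Section Powers.
Variable (A : finType).
Implicit Types (x y z : biseq A) (i j s t : int).

Lemma wpowS (T : Type) (v : seq T) k : wpow v k.+1 = v ++ wpow v k.
Proof. by []. Qed.

Lemma size_wpow (T : Type) (v : seq T) k : size (wpow v k) = (k * size v)%N.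
Proof. by elim: k => // k IH; rewrite wpowS size_cat IH mulSn. Qed.

Lemma wpow_window x s t (p k : nat) : (0 < p)%N -> per x s t p%:Z ->
  s <= t - (k * p)%N%:Z ->
  wpow (window x (t - p%:Z) p) k = window x (t - (k * p)%N%:Z) (k * p).
Proof.
move=> p0 hp; elim: k => [|k IH] sk; first by [].
rewrite wpowS IH; last by lia.
rewrite [in RHS]mulSn window_cat; congr (_ ++ window x _ _); last by lia.
by apply: esym; apply: (window_per (s := s) (t := t) (p := p%:Z) (k := k)) => //; lia.
Qed.

(** Full periods are counted from the right end of the run. The words of length [p]
    on both sides of them differ from the repeated one, since each of them contains
    a coordinate at which the period breaks. *)
Lemma maximal_period_Pow (X : set (biseq A)) x s t (p : nat) : X x ->
  (0 < p)%N -> p%:Z <= t - s -> per x s t p%:Z ->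
  x (s - 1) <> x (s - 1 + p%:Z) -> x (t - p%:Z) <> x t ->
  exists k : nat, k%:Z = ((t - s) %/ p%:Z)%Z /\
    Pow X (window x (t - p%:Z) p) (wpow (window x (t - p%:Z) p) k).
Proof.
move=> Xx p0 pst hp ls lt.
have := @divz_bounds (t - s) p%:Z (ltac:(lia)).
set d := (_ %/ _)%Z => /andP[d1 d2].
have d0 : 0 < d by rewrite -(pmulr_lgt0 _ (x := p%:Z)); lia.
exists (absz d); split; first by lia.
have : (absz d)%:Z = d by lia.
move: (absz d) => k kd; rewrite -kd in d0 d1 d2.
exists k; first by lia.
split=> //; exists (window x (t - (k * p)%N%:Z - p%:Z) p), (window x t p).
rewrite !size_window; split=> //.
- apply/eqP => /windowP/(_ (s - 1 - (t - (k * p)%N%:Z - p%:Z))) e; apply: ls.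
  move: e; rewrite subrKC => ->; last by lia.
  case: k kd d0 d1 d2 => [|k] kd d0 d1 d2; first by lia.
  rewrite (_ : t - p%:Z + _ = s - 1 + p%:Z + k%:Z * p%:Z); last by lia.
  rewrite -(per_mul (s := s) (t := t) (k := k)) //; lia.
- apply/eqP => /windowP/(_ 0) e; apply: lt; rewrite -[RHS](congr1 x (addr0 t)) e; last by lia.
  by rewrite addr0.
rewrite (wpow_window (s := s)) //; last by lia.
rewrite (_ : _ ++ _ = window x (t - (k * p)%N%:Z - p%:Z) (p + (k * p + p))).
  by apply: language_window => //; lia.
by rewrite !window_cat; congr (_ ++ (window x _ _ ++ window x _ _)); lia.
Qed.

(** The bound [N] on the power complexity, in terms that avoid infinite values. *)
Definition few_powers (X : set (biseq A)) (N : nat) : Prop := forall v, v != [::] ->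
  exists2 l : seq (seq A), (size l <= N)%N & forall u, Pow X v u -> u \in l.

End Powers.

(** * Cutting points at one scale *)

Section Blocks.
Variable A : finType.
Implicit Types (cut : biseq A -> int -> Prop) (x : biseq A) (c i : int).

Definition consecutive cut x c c' : Prop :=
  [/\ cut x c, cut x c', c < c' & forall i, c < i < c' -> ~ cut x i].

Definition context (R : nat) x c c' : seq A :=
  window x (c - R%:Z) (absz (c' - c)%R + R.*2).

End Blocks.

(** In this section [n] is a good length and [rs] lists the right special words of
    length [n], at most [C] of them. A period is short if it is at most [q], and [h]
    is a margin: [n] is at least four times [h], which is at least four times
    [q]. Right special windows recur within [G] steps, no run of a short period is
    longer than about [B], and [R] is the length of the contexts. The distance [delta]
    is kept between marks, and [K] bounds the number of choices along a block. *)
Section Scale.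
Variables (A : finType) (X : set (biseq A)) (n q h delta C B G R K : nat).
Variable rs : seq (seq A).
Implicit Types (x y z : biseq A) (i j s t p g c : int).
Hypotheses (q0 : (0 < q)%N).
Hypotheses (hq : (4 * q <= h)%N) (nh : (4 * h <= n)%N) (dq : (C.+1 * delta <= q)%N).
Hypothesis rs_size : (size rs <= C)%N.
Hypothesis rsP : forall w, size w = n -> right_special X w -> w \in rs.
Hypothesis gapP : forall x i, X x -> exists2 j : int, i <= j <= i + G%:Z &
  right_special X (window x (j - n%:Z) n).
Hypothesis apP : forall (p : nat) x i, X x -> (0 < p <= q)%N ->
  exists2 j : int, i <= j < i + B%:Z & x j <> x (j + p%:Z).
Hypothesis Rh : (R <= h)%N.
Hypothesis KP : ((C * ((G + 4 * n) %/ q).+1).+1 <= K)%N.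

Let nq : (q.*2 <= n)%N. Proof. lia. Qed.

Definition special x j : Prop := right_special X (window x (j - n%:Z) n).

(** A block inside a zone of period [p] consists of this number of periods, which
    gives it a length between [h] and [n - 2 h]. *)
Definition block_periods p : int := ((n%:Z - h%:Z - h%:Z) %/ p)%Z.

(** The number of periods by which a zone is longer than one window. *)
Definition slack_periods s t p : int := ((t - s - n%:Z) %/ p)%Z.

(** The first cut in a zone. It lies a whole number of periods before the last cut
    [t - h], and at a distance that depends on [p] only before the first window of
    the zone that is equal to the last one, see [zone_first_window]. *)
Definition zone_start s t p : int := t - h%:Z - (slack_periods s t p + block_periods p) * p.

(** In a zone one right special word may occur many times within a short distance;
    of all the windows deep inside a zone only the last one is marked. *)
Definition marked x j : Prop :=
  special x j /\ forall s t p, zone n q x s t p -> ~ (s + h%:Z <= j < t).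

(** Marks may still cluster, and only the first one of a cluster is kept. Clusters
    are short because equal marked windows are more than [q] apart. *)
Definition mark_cut x j : Prop :=
  marked x j /\ forall i, j - delta%:Z <= i < j -> ~ marked x i.

Definition zone_cut s t p c : Prop :=
  exists2 i : int, 0 <= i & c = zone_start s t p + i * (block_periods p * p) /\
     c + block_periods p * p <= t - h%:Z.

(** A mark at [j] is cut at [j - h], so that a context of length [R <= h] on both
    sides of a block stays within the windows that determine the block. *)
Definition cut x c : Prop :=
  mark_cut x (c + h%:Z) \/ exists s t p, zone n q x s t p /\ zone_cut s t p c.

Lemma block_periodsP p : 0 < p -> p <= q%:Z ->
  [/\ 1 <= block_periods p, h%:Z <= block_periods p * p, block_periods p * p <= n%:Z - h%:Z - h%:Z &
      n%:Z - h%:Z - h%:Z < block_periods p * p + p].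
Proof.
move=> p0 pq; have := divz_bounds (n%:Z - h%:Z - h%:Z) p0; rewrite -/(block_periods p).
move=> /andP[h1 h2]; have m0 : 0 < block_periods p by rewrite -(pmulr_lgt0 _ p0); lia.
by split; lia.
Qed.

Lemma zone_lengths x s t p : zone n q x s t p ->
  [/\ 0 < p, p <= q%:Z, n%:Z + p <= t - s & per x s t p].
Proof. by move=> [[]]. Qed.

Lemma slack_periodsP x s t p : zone n q x s t p ->
  [/\ 1 <= slack_periods s t p, slack_periods s t p * p <= t - s - n%:Z &
      t - s - n%:Z < slack_periods s t p * p + p].
Proof.
move=> /zone_lengths[p0 pq L _].
have := divz_bounds (t - s - n%:Z) p0; rewrite -/(slack_periods s t p).
move=> /andP[h1 h2]; have k0 : 0 < slack_periods s t p by rewrite -(pmulr_lgt0 _ p0); lia.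
by split; lia.
Qed.

Lemma zone_startP x s t p : zone n q x s t p ->
  [/\ s + h%:Z <= zone_start s t p, zone_start s t p < s + h%:Z + p + p &
      zone_start s t p + block_periods p * p <= t - h%:Z].
Proof.
move=> Z; have [p0 pq L _] := zone_lengths Z; have [k1 k2 k3] := slack_periodsP Z.
have [m1 m2 m3 m4] := block_periodsP p0 pq; rewrite /zone_start mulrDl.
have kp : p <= slack_periods s t p * p by rewrite ler_peMl; lia.
by split; lia.
Qed.

Lemma zone_cut_bounds x s t p c : zone n q x s t p -> zone_cut s t p c ->
  s + h%:Z <= c /\ c + block_periods p * p <= t - h%:Z.
Proof.
move=> Z [i i0 [-> ?]]; split=> //; have [? _ _] := zone_startP Z.
have [p0 pq _ _] := zone_lengths Z; have [_ m2 _ _] := block_periodsP p0 pq.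
have : 0 <= i * (block_periods p * p) by rewrite mulr_ge0; lia.
by lia.
Qed.

Lemma zone_start_cut x s t p : zone n q x s t p -> zone_cut s t p (zone_start s t p).
Proof.
by move=> Z; exists 0 => //; rewrite mul0r addr0; have [] := zone_startP Z.
Qed.

Section Point.
Variable x : biseq A.
Hypothesis Xx : X x.

Let special_rs j : special x j -> window x (j - n%:Z) n \in rs.
Proof. by apply: rsP; rewrite size_window. Qed.

(** A repetition at distance [j - i] is a run of period [j - i]. *)
Lemma close_zone i j : i < j -> j - i <= q%:Z ->
  window x (i - n%:Z) n = window x (j - n%:Z) n ->
  exists s t p, [/\ zone n q x s t p, s <= i - n%:Z & j <= t].
Proof.
move=> ij jiq /(per_window (ltW ij)) hp.
have [|||||s [t [p [? ? ? _]]]] := @zone_exists A n q nq x B (i - n%:Z) j (j - i); try lia.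
- by move=> p i' pq; exact: apP.
- exact: hp.
by exists s, t, p.
Qed.

Lemma marked_distinct i j : marked x i -> i < j -> j - i <= q%:Z ->
  window x (i - n%:Z) n <> window x (j - n%:Z) n.
Proof.
move=> [_ mi] ij jiq /(close_zone ij jiq)[s [t [p [Z si jt]]]].
by apply: (mi s t p Z); lia.
Qed.

(** Otherwise there would be a chain of [C + 1] marks with gaps at most [delta]. It
    spans at most [q], so that the windows of its members are distinct right
    special words, and there are only [C] of these. *)
Lemma mark_cut_before j : marked x j -> exists2 j0, j - q%:Z <= j0 <= j & mark_cut x j0.
Proof.
move=> mj; apply: contrapT => noc.
(* [e] is the leftmost member of the chain found so far and [l] lists the others *)
have chain (k : nat) : (k <= C)%N -> exists e (l : seq int),
    [/\ size l = k, marked x e, j - (k * delta)%N%:Z <= e <= j &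
     (forall i, i \in l -> e < i <= j /\ marked x i) /\
     uniq [seq window x (i - n%:Z) n | i <- e :: l]].
  elim: k => [|k IH] kC.
    exists j, [::]; split=> //; lia.
  have [e [l [sl me ej [hl ul]]]] := IH (ltnW kC).
  have [i [ie mi]] : exists i, e - delta%:Z <= i < e /\ marked x i.
    apply: contrapT => /forallNP ni; apply: noc; exists e.
      have : (k * delta <= C * delta)%N by rewrite leq_mul2r ltnW ?orbT. lia.
    by split=> // i ie mi; apply: (ni i).
  exists i, (e :: l); split; [by rewrite /= sl|by []|lia|split].
    by move=> i'; rewrite in_cons => /orP[/eqP ->|/hl[? ?]]; split=> //; lia.
  rewrite map_cons cons_uniq ul andbT; apply/negP => /mapP[i' i'l].
  apply: marked_distinct => //.
    by move: i'l; rewrite in_cons => /orP[/eqP ->|/hl[? ?]]; lia.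
  have : (k.+1 * delta <= C.+1 * delta)%N by rewrite leq_mul2r ltnW ?orbT.
  by move: i'l; rewrite in_cons => /orP[/eqP ->|/hl[? ?]]; lia.
have [e [l [sl me ej [hl ul]]]] := chain C (leqnn C).
suff : (C < size rs)%N by lia.
rewrite -sl -(size_map (fun i => window x (i - n%:Z) n) l).
rewrite -[X in (X <= _)%N]/(size [seq window x (i - n%:Z) n | i <- e :: l]).
apply: uniq_leq_size => // _ /mapP[i il ->]; apply: special_rs.
by move: il; rewrite in_cons => /orP[/eqP ->|/hl[_ []]//]; case: me.
Qed.

Lemma zone_end_mark_cut s t p : zone n q x s t p -> mark_cut x t.
Proof.
move=> Z; have [p0 pq L hp] := zone_lengths Z; split.
  split; first exact: zone_end_special Xx Z.
  move=> s' t' p' Z' st'.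
  have [_ ? _] := zone_unique nq Z Z' (a := Num.max s s') (b := t)
    (ltac:(lia)) (ltac:(lia)) (ltac:(lia)) (ltac:(lia)) (ltac:(lia)).
  by lia.
by move=> j jt [_ /(_ _ _ _ Z)]; apply; lia.
Qed.

Lemma zone_end_cut s t p : zone n q x s t p -> cut x (t - h%:Z).
Proof. by move=> Z; left; rewrite subrK; exact: zone_end_mark_cut Z. Qed.

(** A mark that is cut there would lie in the range excluded by this zone, and
    another zone with a cut there would overlap it too much. *)
Lemma cut_in_zone s t p c : zone n q x s t p -> s <= c -> c < t - h%:Z ->
  s + h%:Z + h%:Z <= c + h%:Z + h%:Z -> cut x c -> zone_cut s t p c.
Proof.
move=> Z sc ct sc' [[[_ /(_ _ _ _ Z)]]|[s' [t' [p' [Z' zc]]]]].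
  by move=> F _; case: F; lia.
have [p0 pq L _] := zone_lengths Z; have [p0' pq' L' _] := zone_lengths Z'.
have [sc2 ct2] := zone_cut_bounds Z' zc; have [_ m2 _ _] := block_periodsP p0' pq'.
have [-> -> ->] := zone_unique nq Z Z' (a := Num.max s (c - h%:Z))
  (b := c + h%:Z) (ltac:(lia)) (ltac:(lia)) (ltac:(lia)) (ltac:(lia)) (ltac:(lia)).
by [].
Qed.

Lemma cut_separated c c' : cut x c -> cut x c' -> c < c' -> delta%:Z < c' - c.
Proof.
have dh : (delta <= q)%N by lia.
have AZ c1 s t p c2 : mark_cut x (c1 + h%:Z) -> zone n q x s t p ->
    zone_cut s t p c2 -> c1 < s \/ c2 + h%:Z <= c1.
  move=> [[_ mk] _] Z zc; have [sc ct] := zone_cut_bounds Z zc.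
  have [p0 pq L _] := zone_lengths Z; have [_ m2 _ _] := block_periodsP p0 pq.
  have [|h1] := ltP c1 s; first by left.
  by right; rewrite leNgt; apply/negP => h2; apply: (mk _ _ _ Z); lia.
move=> [a|[s [t [p [Z zc]]]]] [a'|[s' [t' [p' [Z' zc']]]]] lt.
- rewrite ltNge; apply/negP => h1; case: a' => [_ /(_ (c + h%:Z))]; apply; first by lia.
  by case: a.
- have [h1 _] := zone_cut_bounds Z' zc'.
  by have [] := AZ _ _ _ _ _ a Z' zc'; lia.
- have [h1 _] := zone_cut_bounds Z zc.
  by have [] := AZ _ _ _ _ _ a' Z zc; lia.
have [sc ct] := zone_cut_bounds Z zc; have [sc' ct'] := zone_cut_bounds Z' zc'.
have [p0 pq L _] := zone_lengths Z; have [p0' pq' L' _] := zone_lengths Z'.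
have [_ m2 _ _] := block_periodsP p0 pq; have [_ m2' _ _] := block_periodsP p0' pq'.
rewrite ltNge; apply/negP => h1.
have [es et ep] := zone_unique nq Z Z' (a := c' - h%:Z) (b := c + h%:Z)
  (ltac:(lia)) (ltac:(lia)) (ltac:(lia)) (ltac:(lia)) (ltac:(lia)).
subst s' t' p'; move: zc zc' => [i i0 [e _]] [i' i0' [e' _]].
have : i < i' by move: lt; rewrite e e'; nia.
move=> ii; have : block_periods p * p <= (i' - i) * (block_periods p * p) by nia.
by rewrite mulrBl; lia.
Qed.

Lemma zone_next_cut s t p i : zone n q x s t p -> i < t - h%:Z ->
  exists2 c, i < c <= Num.max (zone_start s t p) (i + n%:Z + n%:Z) & cut x c.
Proof.
move=> Z it; have [ic|ci] := ltP i (zone_start s t p).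
  by exists (zone_start s t p); [lia|right; exists s, t, p; split; [|exact: zone_start_cut Z]].
have [p0 pq L _] := zone_lengths Z; have [m1 m2 m3 _] := block_periodsP p0 pq.
pose M := block_periods p * p; have M0 : 0 < M by rewrite /M; lia.
have := divz_bounds (i - zone_start s t p) M0; set l := (_ %/ _)%Z => /andP[l1 l2].
have l0 : 0 <= l by nia.
have lM : (l + 1) * M = l * M + M by rewrite mulrDl mul1r.
have [h1|h1] := leP (zone_start s t p + (l + 1) * M + M) (t - h%:Z).
  exists (zone_start s t p + (l + 1) * M); first by rewrite /M in lM l1 l2 *; lia.
  by right; exists s, t, p; split=> //; exists (l + 1); [lia|split].
by exists (t - h%:Z); [rewrite /M in lM l1 l2 h1 *; lia|exact: zone_end_cut Z].
Qed.

(** A right special window that is not marked belongs to a zone, and a zone is cut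
    regularly from its first cut to its end. *)
Lemma cut_dense i : exists2 c, i < c <= i + (G + 3 * n)%N%:Z & cut x c.
Proof.
have [j jG sj] := gapP (i + h%:Z + q%:Z + 1) Xx.
have [mj|nmj] := pselect (marked x j).
  have [j0 j0j aj] := mark_cut_before mj; exists (j0 - h%:Z); first by lia.
  by left; rewrite subrK.
have [s [t [p [Z st]]]] : exists s t p, zone n q x s t p /\ s + h%:Z <= j < t.
  apply: contrapT => no; apply: nmj; split=> // s t p Z st; apply: no.
  by exists s, t, p.
have [c c1 cc] := zone_next_cut (i := i) Z (ltac:(lia)); exists c => //.
have [_ c2 _] := zone_startP Z; have [p0 pq _ _] := zone_lengths Z.
by lia.
Qed.

End Point.

Lemma zone_short x s t p : X x -> zone n q x s t p -> t - s <= B%:Z + p.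
Proof.
move=> Xx Z; have [p0 pq L hp] := zone_lengths Z; rewrite leNgt; apply/negP => lt.
have [|j jB ne] := apP (p := absz p) s Xx; first by lia.
by apply: ne; rewrite (_ : (absz p)%:Z = p); [apply: hp|]; lia.
Qed.

Lemma zone_translate x y s t p e : zone n q x s t p ->
  (forall i, s - 1 <= i <= t -> x i = y (i + e)) -> zone n q y (s + e) (t + e) p.
Proof.
move=> [[p0 pq L] hp mp ls lt] xy; split.
- by split=> //; lia.
- move=> i si it; have := hp (i - e); rewrite !xy; try lia.
  rewrite subrK (_ : i - e + p + e = i + p); last by lia.
  by apply; lia.
- move=> g gp hg; apply: (mp g gp) => i si it; rewrite !xy; try lia.
  by rewrite hg; [congr (y _)| |]; lia.
- move: ls; rewrite !xy; try lia.
  by rewrite addrAC (_ : s - 1 + p + e = s + e - 1 + p); last by lia.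
- move: lt; rewrite !xy; try lia.
  by rewrite addrAC.
Qed.

Lemma special_translate x y j e : (forall i, j - n%:Z <= i < j -> x i = y (i + e)) ->
  special x j -> special y (j + e).
Proof.
move=> xy; rewrite /special (_ : window x _ n = window y (j + e - n%:Z) n) //.
apply/windowP => k kn; rewrite xy; last by lia.
by congr (y _); lia.
Qed.

Lemma marked_translate x y j e : X x -> X y ->
  (forall i, `|i - j| <= (B + n + q)%N%:Z -> x i = y (i + e)) ->
  marked x j -> marked y (j + e).
Proof.
move=> Xx Xy xy [sj mj]; split.
  by apply: special_translate sj => i ij; apply: xy; lia.
move=> s t p Z st; have [p0 pq _ _] := zone_lengths Z; have ts := zone_short Xy Z.
apply: (mj (s - e) (t - e) p); last by lia.
apply: (zone_translate Z) => i it; have := xy (i - e).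
by rewrite subrK => -> //; lia.
Qed.

Definition cut_radius : nat := B + n + n + h + q.

(** The zones that matter for a cut contain it, and aperiodicity bounds their
    length. *)
Lemma cut_local x y i j : X x -> X y -> agree x y i j cut_radius ->
  cut x i -> cut y j.
Proof.
move=> Xx Xy xy; rewrite /cut_radius in xy.
have {}xy k : `|k - i| <= (B + n + n + h + q)%N%:Z -> x k = y (k + (j - i)).
  by move=> ki; have := xy (k - i) ki; rewrite subrKC => ->; congr (y _); lia.
have -> : j = i + (j - i) by lia.
move: (j - i) xy => e xy [[ma na]|[s [t [p [Z zc]]]]].
  left; rewrite addrAC; split.
    by apply: (marked_translate Xx Xy) ma => k ki; apply: xy; lia.
  move=> k ki mk; apply: (na (k - e)); first by lia.
  apply: (marked_translate Xy Xx) mk => l lk; have := xy (l - e).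
  by rewrite subrK => -> //; lia.
right; exists (s + e), (t + e), p; split.
  apply: (zone_translate Z) => k kt; apply: xy.
  have [p0 pq _ _] := zone_lengths Z; have ts := zone_short Xx Z.
  have [sc ct] := zone_cut_bounds Z zc; have [_ m2 _ _] := block_periodsP p0 pq.
  by lia.
case: zc => l l0 [-> ll]; exists l => //.
rewrite /zone_start /slack_periods (_ : t + e - (s + e) = t - s); last by lia.
by split; [lia|rewrite /zone_start /slack_periods in ll; lia].
Qed.

(** * Comparison of zones and of paths between them *)

Section Zones.
Variables (x y : biseq A).
Hypothesis Xx : X x.

Lemma zone_point s t p u : zone n q x s t p -> s <= u -> u < t ->
  x u = x (t - p + ((u - t) %% p)%Z).
Proof.
move=> Z su ut; have [p0 pq L hp] := zone_lengths Z.
have := divz_eq (u - t) p; have := modz_ge0 (u - t) (lt0r_neq0 p0).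
have := ltz_pmod (u - t) p0.
move: (_ %/ _)%Z (_ %% _)%Z => d r rp r0 e.
have d0 : d < 0 by rewrite -(pmulr_llt0 _ p0); lia.
have e' : t - p + r = u + (absz (d + 1)%R)%:Z * p.
  by rewrite (_ : (absz _)%:Z = - (d + 1)); lia.
by rewrite e' -(per_mul (s := s) (t := t)) //; lia.
Qed.

(** Both periods are periods of the common window, where Fine and Wilf's theorem
    applies; the gcd then extends to the whole first zone. *)
Lemma zone_period_le s t p s' t' p' : zone n q x s t p -> zone n q y s' t' p' ->
  window x (t - n%:Z) n = window y (t' - n%:Z) n -> p <= p'.
Proof.
move=> Z Z' /windowP e; have [p0 pq L hp] := zone_lengths Z.
have [p0' pq' L' hp'] := zone_lengths Z'.
have h' : per x (t - n%:Z) t p'.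
  move=> i ti it; have := e (i - (t - n%:Z)) (ltac:(lia)).
  have := e (i + p' - (t - n%:Z)) (ltac:(lia)).
  rewrite (_ : t - _ + (i - _) = i); last by lia.
  rewrite (_ : t - _ + (i + p' - _) = i + p'); last by lia.
  by move=> -> ->; rewrite hp'; [congr (y _)| |]; lia.
have [|||d [d0 hd dp dp']] := @per_gcd _ x (t - n%:Z) t p p' p0 p0'.
- by lia.
- by apply: per_sub hp; lia.
- exact: h'.
have dlp : d <= p := dvdz_leq p0 dp.
have dlp' : d <= p' := dvdz_leq p0' dp'.
rewrite (le_trans _ dlp')// leNgt; apply/negP => dp1.
have [_ _ mp _ _] := Z; apply: (mp d); first by lia.
by apply: (per_extend (s' := t - n%:Z) (t' := t) (p := p)) => //; lia.
Qed.

End Zones.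

Lemma zone_period_eq x y s t p s' t' p' : zone n q x s t p -> zone n q y s' t' p' ->
  window x (t - n%:Z) n = window y (t' - n%:Z) n -> p = p'.
Proof.
move=> Z Z' e; apply/eqP; rewrite eq_le (zone_period_le Z Z' e).
exact: zone_period_le Z' Z (esym e).
Qed.

Lemma zone_point_eq x y s t p s' t' u u' : zone n q x s t p -> zone n q y s' t' p ->
  window x (t - n%:Z) n = window y (t' - n%:Z) n ->
  s <= u -> u < t -> s' <= u' -> u' < t' -> (p %| (u - t) - (u' - t'))%Z ->
  x u = y u'.
Proof.
move=> Z Z' /windowP e su ut su' ut' /dvdzP[d ud].
rewrite (zone_point Z su ut) (zone_point Z' su' ut').
have -> : ((u - t) %% p = (u' - t') %% p)%Z.
  by rewrite (_ : u - t = d * p + (u' - t')) ?modzMDl//; lia.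
have [p0 pq L hp] := zone_lengths Z.
have := modz_ge0 (u' - t') (lt0r_neq0 p0); have := ltz_pmod (u' - t') p0.
move: (_ %% _)%Z => r rp r0; have := e (n%:Z - p + r) (ltac:(lia)).
rewrite (_ : t - n%:Z + (n%:Z - p + r) = t - p + r); last by lia.
by rewrite (_ : t' - n%:Z + (n%:Z - p + r) = t' - p + r); last by lia.
Qed.

(** A letter recorded here comes right after a window that leaves it undetermined. *)
Definition choices x j (M : nat) : seq A :=
  [seq (x (j + k%:Z) : A) | k <- iota 0 M & `[< special x (j + k%:Z) >]].

Lemma choices_split x j (m M : nat) : (m < M)%N -> special x (j + m%:Z) ->
  exists l, choices x j M = choices x j m ++ (x (j + m%:Z) : A) :: l.
Proof.
move=> mM sm; rewrite /choices -(subnKC mM) -addn1 -addnA iotaD filter_cat map_cat.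
by rewrite add0n iotaD filter_cat map_cat /= ; case: asboolP => //= _; eexists.
Qed.

Lemma choices_eq x y j j' M : window x (j - n%:Z) (n + M) = window y (j' - n%:Z) (n + M) ->
  choices x j M = choices y j' M.
Proof.
move=> /windowP e; rewrite /choices.
have sw (i : nat) : (i < M)%N ->
    window x (j + i%:Z - n%:Z) n = window y (j' + i%:Z - n%:Z) n.
  move=> iM; apply/windowP => k kn; have := e (i%:Z + k) (ltac:(lia)).
  rewrite (_ : j - n%:Z + (i%:Z + k) = j + i%:Z - n%:Z + k); last by lia.
  by rewrite (_ : j' - n%:Z + (i%:Z + k) = j' + i%:Z - n%:Z + k); last by lia.
rewrite (@eq_in_filter _ _ (fun i : nat => `[< special y (j' + i%:Z) >])); last first.
  move=> i; rewrite mem_iota => /andP[_ iM]; rewrite /special.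
  by rewrite sw//; lia.
apply/eq_in_map => i; rewrite mem_filter mem_iota => /andP[_ iM].
have := e (n%:Z + i%:Z) (ltac:(lia)).
rewrite (_ : j - n%:Z + (n%:Z + i%:Z) = j + i%:Z); last by lia.
by rewrite (_ : j' - n%:Z + (n%:Z + i%:Z) = j' + i%:Z); last by lia.
Qed.

(** Between right special windows a point has no choice, so that a stretch of it is
    determined by its first window and by its choices. The lengths agree as well:
    the longer stretch would make one more choice, at the end of the shorter one. *)
Lemma choices_path x y j j' (M M' : nat) : X x -> X y ->
  window x (j - n%:Z) n = window y (j' - n%:Z) n ->
  choices x j M = choices y j' M' ->
  special x (j + M%:Z) -> special y (j' + M'%:Z) ->
  M = M' /\ window x (j - n%:Z) (n + M) = window y (j' - n%:Z) (n + M').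
Proof.
wlog MM : x y j j' M M' / (M <= M')%N.
  move=> H Xx Xy e ce sx sy; have [|/ltnW] := leqP M M'; first by move=> ?; apply: H.
  by move=> MM; have [] := H y x j' j M' M MM Xy Xx (esym e) (esym ce) sy sx.
move=> Xx Xy e ce sx sy.
have sub u v (w : nat) : window x u (n + w) = window y v (n + w) ->
    window x (u + w%:Z) n = window y (v + w%:Z) n.
  move=> /windowP ew; apply/windowP => k kn; rewrite -!addrA; apply: ew; lia.
have key m : (m <= M)%N -> window x (j - n%:Z) (n + m) = window y (j' - n%:Z) (n + m).
  elim: m => [|m IH] mM; first by rewrite addn0.
  have {}IH := IH (ltnW mM); rewrite addnS !window_rcons IH; congr rcons.
  rewrite (_ : j - n%:Z + (n + m)%N%:Z = j + m%:Z); last by lia.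
  rewrite (_ : j' - n%:Z + (n + m)%N%:Z = j' + m%:Z); last by lia.
  have ew : window x (j + m%:Z - n%:Z) n = window y (j' + m%:Z - n%:Z) n.
    by rewrite addrAC [in RHS]addrAC; exact: sub IH.
  have [sm|nsm] := pselect (special x (j + m%:Z)); last first.
    exact: (not_right_special Xx Xy ew nsm).
  have [l el] := choices_split mM sm.
  have sm' : special y (j' + m%:Z) by rewrite /special -ew.
  have [l' el'] := choices_split (leq_trans mM MM) sm'.
  move: ce; rewrite el el' (choices_eq IH) => /eqP.
  by rewrite eqseq_cat// => /andP[_ /eqP[]].
have {}key := key M (leqnn M).
suff MM' : M = M' by rewrite -MM'.
apply/eqP; rewrite eqn_leq MM leqNgt; apply/negP => lt.
have sM : special y (j' + M%:Z).
  by rewrite /special addrAC -(sub _ _ _ key) addrAC.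
have [l el] := choices_split lt sM.
move: ce; rewrite el (choices_eq key) => /(congr1 size).
by rewrite size_cat /=; lia.
Qed.

(** By the hypothesis, any [q] consecutive windows among these contain at most [C]
    right special ones. *)
Lemma count_special x j (b L : nat) : X x ->
  (forall i i' : nat, (b <= i < i')%N -> (i' < b + L)%N -> (i' - i <= q)%N ->
     special x (j + i%:Z) -> special x (j + i'%:Z) ->
     window x (j + i%:Z - n%:Z) n <> window x (j + i'%:Z - n%:Z) n) ->
  (size [seq k <- iota b L | `[< special x (j + k%:Z) >]] <= C * (L %/ q).+1)%N.
Proof.
move=> Xx; elim/ltn_ind: L b => L IH b D.
have small L' : (L' <= q)%N -> (L' <= L)%N ->
    (size [seq k <- iota b L' | `[< special x (j + k%:Z) >]] <= C)%N.
  move=> Lq LL; set s := seq.filter _ _.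
  rewrite -(size_map (fun i : nat => window x (j + i%:Z - n%:Z) n) s).
  apply: leq_trans rs_size; apply: uniq_leq_size; last first.
    move=> w /mapP[i]; rewrite mem_filter => /andP[/asboolP si _] ->.
    by apply: rsP => //; rewrite size_window.
  rewrite map_inj_in_uniq; first by rewrite filter_uniq ?iota_uniq.
  move=> i i'; rewrite !mem_filter !mem_iota.
  move=> /andP[/asboolP si ib] /andP[/asboolP si' ib'] ew.
  by have [lt|lt|//] := ltngtP i i'; [have := D i i' | have := D i' i]; case; try lia; rewrite ?ew.
have [Lq|Lq] := leqP L q.
  by apply: leq_trans (small L Lq (leqnn _)) _; rewrite mulnS leq_addr.
rewrite -{1}(subnKC (ltnW Lq)) iotaD filter_cat size_cat.
apply: (leq_trans (leq_add (small q (leqnn _) (ltnW Lq)) (IH (L - q)%N _ _ _))).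
- by lia.
- by move=> i i' bi ib; apply: D; lia.
rewrite -mulnS leq_mul2l; apply/orP; right.
by rewrite -{2}(subnK (ltnW Lq)) divnDr ?dvdnn// divnn q0 addn1.
Qed.

(** * Blocks inside and outside of zones *)

Local Notation consec := (consecutive cut).

Definition interior x c c' : Prop := exists s t p,
  [/\ zone n q x s t p, zone_start s t p <= c & c' <= t - h%:Z].

Section Point.
Variable x : biseq A.
Hypothesis Xx : X x.

Lemma consecutive_next c c' e : consec x c c' -> cut x e -> c < e -> c' <= e.
Proof.
by move=> [_ _ _ h1] ce lt; rewrite leNgt; apply/negP => lt'; apply: (h1 e) => //; lia.
Qed.

Lemma consecutive_prev c c' e : consec x c c' -> cut x e -> e < c' -> e <= c.
Proof.
by move=> [_ _ _ h1] ce lt; rewrite leNgt; apply/negP => lt'; apply: (h1 e) => //; lia.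
Qed.

Lemma consecutive_gap c c' : consec x c c' -> c' - c <= (G + 3 * n)%N%:Z.
Proof.
move=> cc; have [e ce xe] := cut_dense Xx c.
by have := consecutive_next cc xe (ltac:(lia)); lia.
Qed.

(** The blocks of a zone consist of [block_periods] periods each, except for the
    last one, which also takes the remainder of the division. *)
Lemma interior_step s t p c c' : zone n q x s t p -> consec x c c' ->
  zone_start s t p <= c -> c' <= t - h%:Z ->
  exists r a : nat, [/\ (0 < r)%N, c' - c = r%:Z * p, c = t - h%:Z - a%:Z * p &
    r%:Z = block_periods p \/ r%:Z = block_periods p + (slack_periods s t p %% block_periods p)%Z].
Proof.
move=> Z cc sc ct; have [p0 pq L hp] := zone_lengths Z.
have [m1 m2 m3 m4] := block_periodsP p0 pq; have [k1 k2 k3] := slack_periodsP Z.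
have [cs1 cs2 cs3] := zone_startP Z; have [xc xc' lt _] := cc.
have zin e : zone_start s t p <= e -> e < t - h%:Z -> cut x e -> zone_cut s t p e.
  by move=> ? ? xe; apply: (cut_in_zone Z _ _ _ xe); lia.
have zcut e : zone_cut s t p e -> cut x e by move=> ?; right; exists s, t, p.
have mp0 : 0 < block_periods p * p by lia.
have next e e' : zone_cut s t p e -> zone_cut s t p e' -> e < e' ->
    e + block_periods p * p <= e'.
  move=> [l l0 [-> _]] [l' l0' [-> _]]; rewrite ltrD2l ltr_pM2r// => ll.
  rewrite -addrA lerD2l -{2}[block_periods p * p]mul1r -mulrDl ler_pM2r//; lia.
have [l l0 [cl cl']] := zin c sc (ltac:(lia)) xc.
have [two|two] := leP (c + block_periods p * p + block_periods p * p) (t - h%:Z).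
  have ze : zone_cut s t p (c + block_periods p * p).
    by exists (l + 1); [lia|split; [rewrite cl mulrDl mul1r addrA|]].
  have c'e := consecutive_next cc (zcut _ ze) (ltac:(lia)).
  have ec' : c' = c + block_periods p * p.
    apply/eqP; rewrite eq_le c'e next//; first by exists l.
    by apply: zin => //; lia.
  exists (absz (block_periods p)),
    (absz (slack_periods s t p + block_periods p - l * block_periods p)%R).
  have l1 : l * block_periods p <= slack_periods s t p + block_periods p.
    by rewrite -(ler_pM2r p0); move: cl cl'; rewrite /zone_start; lia.
  split; [lia|by rewrite ec'; lia|move: cl; rewrite /zone_start; lia|left; lia].
have ec' : c' = t - h%:Z.
  apply/eqP; rewrite eq_le ct /= leNgt; apply/negP => lt'.
  have zc' := zin c' (ltac:(lia)) lt' xc'.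
  have := next c c' (ex_intro2 _ _ l l0 (conj cl cl')) zc' lt.
  by case: zc' => ? _ [_ ?]; lia.
have cE : t - h%:Z - c = (slack_periods s t p + block_periods p - l * block_periods p) * p.
  by rewrite cl /zone_start; lia.
have l1 : l * block_periods p <= slack_periods s t p.
  by rewrite -(ler_pM2r p0); move: cl'; rewrite cl /zone_start; lia.
have l2 : slack_periods s t p < (l + 1) * block_periods p.
  by rewrite -(ltr_pM2r p0); move: two; rewrite cl /zone_start; lia.
have em : (slack_periods s t p %% block_periods p)%Z = slack_periods s t p - l * block_periods p.
  have -> : slack_periods s t p =
      l * block_periods p + (slack_periods s t p - l * block_periods p) by lia.
  by rewrite modzMDl modz_small; lia.
exists (absz (slack_periods s t p + block_periods p - l * block_periods p)%R),
  (absz (slack_periods s t p + block_periods p - l * block_periods p)%R).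
split; [lia|lia|lia|right; rewrite em; lia].
Qed.

(** If [c] were a cut in a zone, or [c'] one other than the first, then the block
    would lie between two cuts of that zone. *)
Lemma exterior_ends c c' : consec x c c' -> ~ interior x c c' ->
  mark_cut x (c + h%:Z) /\
  (mark_cut x (c' + h%:Z) \/ exists s t p, zone n q x s t p /\ c' = zone_start s t p).
Proof.
move=> cc nint; have [xc xc' lt _] := cc; split.
  case: xc => // -[s [t [p [Z zc]]]]; case: nint; exists s, t, p.
  have [p0 pq L hp] := zone_lengths Z; have [m1 m2 _ _] := block_periodsP p0 pq.
  case: zc => l l0 [cl cl']; split=> //.
    by rewrite cl lerDl mulr_ge0//; lia.
  apply: (consecutive_next cc (zone_end_cut Xx Z)); lia.
case: xc' => [|[s [t [p [Z zc]]]]]; [by left|right; exists s, t, p; split=> //].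
have [p0 pq L hp] := zone_lengths Z; have [m1 m2 _ _] := block_periodsP p0 pq.
case: zc => l l0 [cl cl']; have [l00|ln0] := eqVneq l 0; last first.
  case: nint; exists s, t, p; split=> //; last by lia.
  have mp0 : 0 < block_periods p * p by lia.
  have e1 : l * (block_periods p * p) = (l - 1) * (block_periods p * p) + block_periods p * p.
    by rewrite mulrBl mul1r subrK.
  have le1 : zone_start s t p <= zone_start s t p + (l - 1) * (block_periods p * p).
    by rewrite lerDl mulr_ge0//; lia.
  apply: le_trans le1 _; apply: (consecutive_prev cc); last by lia.
  by right; exists s, t, p; split=> //; exists (l - 1); [lia|split; [|lia]].
by rewrite cl l00 mul0r addr0.
Qed.

(** This is the last window of the zone, moved back by as many periods as possible. *)
Lemma zone_first_window s t p : zone n q x s t p ->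
  let J := zone_start s t p + h%:Z + block_periods p * p in
  [/\ s + n%:Z <= J, J < s + n%:Z + p, J <= t &
      window x (J - n%:Z) n = window x (t - n%:Z) n].
Proof.
move=> Z J; have [p0 pq L hp] := zone_lengths Z.
have [k1 k2 k3] := slack_periodsP Z.
have eJ : J = t - slack_periods s t p * p by rewrite /J /zone_start; lia.
have kp0 : 0 <= slack_periods s t p * p by rewrite mulr_ge0//; lia.
split; try lia.
apply: (window_per (s := s) (t := t) (p := p) (k := absz (slack_periods s t p))) => //; try lia.
Qed.

(** Two close equal windows lie in a zone, the last cut of which comes after [c],
    hence not before [c']. Its first cut does not come before [c'] either, as the
    block would be interior. So the windows end before the zone has room for
    them, unless it is the zone that begins at [c']; but there they are less than
    a period apart. *)
Lemma exterior_distinct c c' J : consec x c c' -> ~ interior x c c' ->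
  J = c' + h%:Z \/ (exists s t p,
    [/\ zone n q x s t p, c' = zone_start s t p & J = c' + h%:Z + block_periods p * p]) ->
  forall i i', c + h%:Z < i -> i < i' -> i' < J -> i' - i <= q%:Z ->
  window x (i - n%:Z) n <> window x (i' - n%:Z) n.
Proof.
move=> cc nint eJ i i' ci ii iJ iq ew.
have [s2 [t2 [p2 [Z2 si it]]]] := close_zone Xx ii iq ew.
have [p20 p2q L2 _] := zone_lengths Z2; have [cs1 cs2 cs3] := zone_startP Z2.
have t2c := consecutive_next cc (zone_end_cut Xx Z2) (ltac:(lia)).
have csc : c' <= zone_start s2 t2 p2.
  rewrite leNgt; apply/negP => lt; apply: nint; exists s2, t2, p2; split=> //.
  apply: (consecutive_prev cc) => //; right; exists s2, t2, p2; split=> //.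
  exact: zone_start_cut Z2.
case: eJ => [eJ|[s [t [p [Z ec' eJ]]]]]; first by lia.
have [p0 pq L _] := zone_lengths Z; have [cs1' cs2' cs3'] := zone_startP Z.
have [J1 J2 J3 _] := zone_first_window Z; rewrite -ec' -eJ in J1 J2 J3.
have [es et ep] := zone_unique nq Z Z2 (a := Num.max s s2) (b := Num.min t t2)
  (ltac:(lia)) (ltac:(lia)) (ltac:(lia)) (ltac:(lia)) (ltac:(lia)).
subst s2 t2 p2.
by apply: (zone_windows_distinct nq Z _ ii _ _ ew); lia.
Qed.

(** An exterior block meets boundedly many right special windows, since it is at
    most a multiple of [q] long and equal ones in it are more than [q] apart. *)
Lemma choices_short c c' J (M : nat) : consec x c c' -> ~ interior x c c' ->
  J = c' + h%:Z \/ (exists s t p,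
    [/\ zone n q x s t p, c' = zone_start s t p & J = c' + h%:Z + block_periods p * p]) ->
  J = c + h%:Z + M%:Z -> (size (choices x (c + h%:Z) M) <= K)%N.
Proof.
move=> cc nint HJ eJ; have gap := consecutive_gap cc.
have Jn : J <= c' + n%:Z.
  case: HJ => [->|[s [t [p [Z _ ->]]]]]; first by lia.
  have [p0 pq L _] := zone_lengths Z; have [_ _ m3 _] := block_periodsP p0 pq; lia.
have ML : (M <= G + 4 * n)%N by lia.
rewrite /choices size_map; apply: leq_trans KP; case: M eJ ML => [//|M] eJ ML.
rewrite -[M.+1]add1n iotaD filter_cat size_cat -[X in (_ <= X)%N]add1n; apply: leq_add.
  by rewrite /=; case: ifP.
apply: (leq_trans (count_special (b := 1) (L := M) (j := c + h%:Z) Xx _)).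
  move=> i i' bi ib iq _ _.
  by apply: (exterior_distinct cc nint HJ); lia.
by rewrite leq_mul2l ltnS leq_div2r ?orbT//; lia.
Qed.

End Point.

(** * Types of blocks *)

Definition block_type : finType := (bool * 'I_C * K.-bseq A + 'I_C)%type.

(** An exterior block is described by the first window [w], by the choices made up
    to the right special window that fixes the end of the block, and by a flag
    that tells whether this window is a mark or the window of [zone_first_window]
    in the zone whose first cut ends the block. An interior block is described by
    the last window [w] of its zone and by the number [r] of its periods. *)
Definition typed (tau : block_type) (r : nat) x c c' : Prop :=
  consec x c c' /\
  match tau with
  | inl (b, w, l) =>
    [/\ r = 0%N, window x (c + h%:Z - n%:Z) n = nth [::] rs w &
      exists M : nat, [/\ choices x (c + h%:Z) M = l,
        special x (c + h%:Z + M%:Z) &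
        if b then c' = c + M%:Z else exists s t p,
          [/\ zone n q x s t p,
            window x (t - n%:Z) n = window x (c + h%:Z + M%:Z - n%:Z) n,
            block_periods p * p <= M%:Z & c' = c + M%:Z - block_periods p * p]]]
  | inr w => exists s t p (a : nat),
    [/\ zone n q x s t p, window x (t - n%:Z) n = nth [::] rs w,
      s + h%:Z <= c, c' <= t - h%:Z &
      [/\ c' - c = r%:Z * p, c = t - h%:Z - a%:Z * p, (0 < r)%N &
        r%:Z = block_periods p \/
        r%:Z = block_periods p + (slack_periods s t p %% block_periods p)%Z]]
  end.

Lemma rs_index w : w \in rs -> exists k : 'I_C, w = nth [::] rs k.
Proof.
move=> wrs; have kC : (index w rs < C)%N by apply: leq_trans rs_size; rewrite index_mem.
by exists (Ordinal kC); rewrite /= nth_index.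
Qed.

Lemma typed_total x c c' : X x -> consec x c c' -> exists tau r, typed tau r x c c'.
Proof.
move=> Xx cc; have [xc xc' lt _] := cc.
have rsw j : special x j -> window x (j - n%:Z) n \in rs.
  by apply: rsP; rewrite size_window.
have [[s [t [p [Z sc ct]]]]|nint] := pselect (interior x c c').
  have [w ew] := rs_index (rsw _ (zone_end_special nq Xx Z)).
  have [r [a [? ? ? ?]]] := interior_step Z cc sc ct.
  exists (inr w), r; split=> //; exists s, t, p, a; split=> //.
  by have [cs1 _ _] := zone_startP Z; lia.
have [ac ac'] := exterior_ends Xx cc nint.
have sc : special x (c + h%:Z) by case: ac => -[].
have [w ew] := rs_index (rsw _ sc).
case: ac' => [ac'|[s [t [p [Z ec']]]]].
  pose M := absz (c' - c)%R; have eM : c' = c + M%:Z by rewrite /M; lia.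
  have sK := choices_short Xx cc nint (or_introl erefl) (M := M) (ltac:(lia)).
  exists (inl (true, w, Bseq sK)), 0%N; split=> //; split=> //; exists M; split=> //.
  by rewrite addrAC -eM; case: ac' => -[].
have [p0 pq L _] := zone_lengths Z; have [m1 m2 _ _] := block_periodsP p0 pq.
have [J1 J2 J3 J4] := zone_first_window Z; rewrite -ec' in J1 J2 J3 J4.
pose M := absz (c' + block_periods p * p - c)%R.
have eM : c' + block_periods p * p = c + M%:Z by rewrite /M; lia.
have sK := choices_short Xx cc nint (J := c' + h%:Z + block_periods p * p)
  (or_intror (ex_intro _ s (ex_intro _ t (ex_intro _ p (And3 Z ec' erefl)))))
  (M := M) (ltac:(lia)).
exists (inl (false, w, Bseq sK)), 0%N; split=> //; split=> //; exists M.
have eJ' : c + h%:Z + M%:Z = c' + h%:Z + block_periods p * p by lia.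
split=> //.
  by rewrite eJ' /special J4; exact: zone_end_special Xx Z.
by exists s, t, p; split=> //; [rewrite eJ' J4|lia|lia].
Qed.

(** For exterior blocks this is [choices_path]; for interior ones, the last window of
    the zone determines the period and the phase. *)
Lemma typed_context tau r x y c c' d d' : X x -> X y ->
  typed tau r x c c' -> typed tau r y d d' ->
  c' - c = d' - d /\ context R x c c' = context R y d d'.
Proof.
move=> Xx Xy [[_ _ cc _] tx] [[_ _ dd _] ty]; case: tau tx ty => [[[b w] l]|w].
  move=> [_ ew [M [el sM bM]]] [_ ew' [M' [el' sM' bM']]].
  have [MM we] := choices_path Xx Xy (etrans ew (esym ew')) (etrans el (esym el')) sM sM'; subst M'.
  have le : c' - c = d' - d /\ c' - c <= M%:Z.
    case: b bM bM' => [-> ->|[s [t [p [Z e1 e2 ->]]]]]; first by lia.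
    move=> [s' [t' [p' [Z' e1' e2' ->]]]].
    have [p0 pq L _] := zone_lengths Z; have [m1 m2 _ _] := block_periodsP p0 pq.
    suff <- : p = p' by lia.
    apply: (zone_period_eq Z Z'); rewrite e1 e1'.
    move/windowP: we => we; apply/windowP => k kn; have := we (M%:Z + k) (ltac:(lia)).
    rewrite (_ : c + h%:Z - n%:Z + (M%:Z + k) = c + h%:Z + M%:Z - n%:Z + k); last by lia.
    by rewrite (_ : d + h%:Z - n%:Z + (M%:Z + k) = d + h%:Z + M%:Z - n%:Z + k); last by lia.
  case: le => le1 le2; split=> //; rewrite /context -le1; apply/windowP => k kR.
  move/windowP: we => /(_ (n%:Z - h%:Z - R%:Z + k) (ltac:(lia))).
  rewrite (_ : c + h%:Z - n%:Z + _ = c - R%:Z + k); last by lia.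
  by rewrite (_ : d + h%:Z - n%:Z + _ = d - R%:Z + k); last by lia.
move=> [s [t [p [a [Z ew sc ct [e1 e2 r0 _]]]]]].
move=> [s' [t' [p' [a' [Z' ew' sc' ct' [e1' e2' _ _]]]]]].
have ww := etrans ew (esym ew').
have pp := zone_period_eq Z Z' ww; subst p'.
split; first by rewrite e1 e1'.
rewrite /context e1' -e1; apply/windowP => k kR.
apply: (zone_point_eq Z Z' ww); try lia.
by apply/dvdzP; exists (a'%:Z - a%:Z); lia.
Qed.

(** Exterior types have a single block. The blocks of an interior type are powers of
    one word, seen with the same context at both ends. *)
Lemma typed_root tau :
  (forall r r' x y c c' d d', typed tau r x c c' -> typed tau r' y d d' -> r = r') \/
  (exists2 p : nat, (0 < p)%N & forall r x c c', typed tau r x c c' ->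
    [/\ c' - c = r%:Z * p%:Z, (0 < r)%N, per x (c - R%:Z) (c' + R%:Z) p%:Z &
     forall r' y d d', typed tau r' y d d' ->
       window x (c - R%:Z) (R.*2 + p) = window y (d - R%:Z) (R.*2 + p)]).
Proof.
case: tau => [[[b w] l]|w].
  by left=> r r' x y c c' d d' [_ [-> _ _]] [_ [-> _ _]].
have [[r0 [x0 [c0 [c0' [_ t0]]]]]|no] :=
    pselect (exists r x c c', typed (inr w) r x c c'); last first.
  by left=> r r' x y c c' d d' tx; case: no; exists r, x, c, c'.
move: t0 => [s [t [p [a [Z ew sc ct _]]]]].
have [p0 pq L _] := zone_lengths Z.
right; exists (absz p); first by lia.
rewrite (_ : (absz p)%:Z = p); last by lia.
move=> r x c c' [_ [s1 [t1 [p1 [a1 [Z1 ew1 sc1 ct1 [e1 f1 r1 _]]]]]]].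
have pp := zone_period_eq Z Z1 (etrans ew (esym ew1)); subst p1.
have [_ _ _ hp1] := zone_lengths Z1.
have rp : p <= r%:Z * p by rewrite ler_peMl; lia.
split=> //; first by apply: per_sub hp1; lia.
move=> r' y d d' [_ [s2 [t2 [p2 [a2 [Z2 ew2 sc2 ct2 [e2 f2 r2 _]]]]]]].
have ww := etrans ew1 (esym ew2); have pp := zone_period_eq Z1 Z2 ww; subst p2.
have rp' : p <= r'%:Z * p by rewrite ler_peMl; lia.
apply/windowP => k kR; apply: (zone_point_eq Z1 Z2 ww); try lia.
by apply/dvdzP; exists (a2%:Z - a1%:Z); lia.
Qed.

(** The number of periods of a last block depends on [slack_periods], which is
    determined, up to two values, by the number of full periods of the zone; this
    number is the exponent of an element of [Pow X v]. *)
Lemma typed_count (tau : block_type) (N : nat) :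
  few_powers X N ->
  exists2 l : seq nat, (size l <= N.*2.+1)%N &
    forall r x c c', X x -> typed tau r x c c' -> r \in l.
Proof.
move=> hN; case: tau => [[[b w] l]|w].
  by exists [:: 0%N] => // r x c c' _ [_ [-> _ _]].
have [[r0 [x0 [c0 [c0' [_ t0]]]]]|no] :=
    pselect (exists r x c c', typed (inr w) r x c c'); last first.
  by exists [::] => // r x c c' _ tx; case: no; exists r, x, c, c'.
move: t0 => [s [t [p [a [Z ew sc ct _]]]]].
have [p0 pq L _] := zone_lengths Z.
pose P := absz p; have eP : p = P%:Z by rewrite /P; lia.
pose v := drop (n - P) (nth [::] rs w).
have sv : size v = P by rewrite size_drop -ew size_window; lia.
have [|l sl hl] := hN v; first by rewrite -size_eq0 sv; lia.
(* up to an error of one period, [slack_periods] is the number of full periods minus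
   the number [e] of full periods in a window *)
pose e : int := (n%:Z %/ p)%Z.
pose f (u : seq A) (b : bool) : nat :=
  absz (block_periods p + (((size u %/ P)%N%:Z - e - (b : nat)%:Z) %% block_periods p)%Z)%R.
exists (absz (block_periods p) :: [seq f u b | u <- l, b <- [:: false; true]]).
  change (size [seq f u b | u <- l, b <- [:: false; true]] < N.*2.+1)%N.
  by rewrite size_allpairs muln2 ltnS leq_double.
move=> r x c c' Xx [_ [s1 [t1 [p1 [a1 [Z1 ew1 sc1 ct1 [e1 f1 r1 rm]]]]]]].
have pp := zone_period_eq Z Z1 (etrans ew (esym ew1)); subst p1.
rewrite in_cons; case: rm => [rm|rm]; first by rewrite -rm eqxx.
apply/orP; right.
have [_ _ L1 hp1] := zone_lengths Z1; have [_ _ _ ls lt] := Z1.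
have [k [ek Pk]] : exists k : nat, k%:Z = ((t1 - s1) %/ p)%Z /\ Pow X v (wpow v k).
  have -> : v = window x (t1 - P%:Z) P.
    by rewrite /v -ew1 window_drop; [congr window; lia|lia].
  by rewrite eP in L1 hp1 ls lt *; apply: maximal_period_Pow hp1 ls lt => //; lia.
have szk : (size (wpow v k) %/ P)%N = k by rewrite size_wpow sv mulnK; lia.
have /andP[b1 b2] := divz_bounds n%:Z p0; rewrite -/e in b1 b2.
have /andP[b3 b4] := divz_bounds (t1 - s1) p0; rewrite -ek in b3 b4.
have [_ k2 k3] := slack_periodsP Z1.
have u1 : -1 < k%:Z - e - slack_periods s1 t1 p by rewrite -(ltr_pM2r p0); lia.
have u2 : k%:Z - e - slack_periods s1 t1 p < 2 by rewrite -(ltr_pM2r p0); lia.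
have fk (b : bool) : slack_periods s1 t1 p = k%:Z - e - (b : nat)%:Z -> r = f (wpow v k) b.
  by move=> kb; rewrite /f szk -kb -rm.
have [k0|k0] : slack_periods s1 t1 p = k%:Z - e - (false : nat)%:Z \/
  slack_periods s1 t1 p = k%:Z - e - (true : nat)%:Z by rewrite /=; lia.
- by rewrite (fk _ k0); apply: allpairs_f; [exact: hl|rewrite !inE].
- by rewrite (fk _ k0); apply: allpairs_f; [exact: hl|rewrite !inE].
Qed.

End Scale.

(** * Cut rules at arbitrarily large scales *)

Section CutRules.
Variable (A : finType) (X : set (biseq A)).
Implicit Types (x y z : biseq A) (c d i j : int).

(** What a scale provides: a local rule that cuts points into blocks of length
    between [L] and [D], and finitely many block types, each with a parameter [r],
    which determine a block together with [R] letters on both sides. Either a type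
    has one block, or [r] counts the periods in a block that is a power of a
    fixed word; few powers then leave few values of [r]. *)
Record cut_rule (R L D radius : nat) (T : finType) (cut : biseq A -> int -> Prop)
    (typed : T -> nat -> biseq A -> int -> int -> Prop) : Prop := CutRule {
  rule_local : forall x y i j, X x -> X y -> agree x y i j radius ->
    cut x i -> cut y j;
  rule_separated : forall x c c', cut x c -> cut x c' -> c < c' -> L%:Z < c' - c;
  rule_dense : forall x i, X x -> exists2 c, i < c <= i + D%:Z & cut x c;
  rule_consecutive : forall tau r x c c', typed tau r x c c' -> consecutive cut x c c';
  rule_total : forall x c c', X x -> consecutive cut x c c' ->
    exists tau r, typed tau r x c c';
  rule_context : forall tau r x y c c' d d', X x -> X y ->
    typed tau r x c c' -> typed tau r y d d' ->
    c' - c = d' - d /\ context R x c c' = context R y d d';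
  rule_root : forall tau,
    (forall r r' x y c c' d d',
      typed tau r x c c' -> typed tau r' y d d' -> r = r') \/
    (exists2 p : nat, (0 < p)%N & forall r x c c', typed tau r x c c' ->
      [/\ c' - c = r%:Z * p%:Z, (0 < r)%N, per x (c - R%:Z) (c' + R%:Z) p%:Z &
       forall r' y d d', typed tau r' y d d' ->
         window x (c - R%:Z) (R.*2 + p) = window y (d - R%:Z) (R.*2 + p)]);
  rule_count : forall tau (N : nat),
    few_powers X N ->
    exists2 l : seq nat, (size l <= N.*2.+1)%N &
      forall r x c c', X x -> typed tau r x c c' -> r \in l }.

Lemma cut_rules : minimal_subshift X -> infinite_set X ->
  (exists K : nat, forall B : nat, exists2 n : nat, (B <= n)%N &
     (complexity X n <= K * n)%N) ->
  exists d : nat, forall R N : nat,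
  exists (L D radius : nat) (T : finType) cut typed,
  [/\ (N <= L)%N, (D <= d * L)%N, (#|T| <= d)%N &
      cut_rule R L D radius cut (typed : T -> nat -> biseq A -> int -> int -> Prop)].
Proof.
move=> mX iX [K0 hK0]; have X0 : X !=set0 by case: mX.
have [C hC] := good_scales X0 hK0.
pose K := (C * ((C + 4) * 32).+1).+1.
exists (#|block_type A C K| + (C + 3) * 64 * C.+1)%N => R N.
have [n [rs [Bn Gn rsC rsP]]] := hC (16 * (N + 1) * C.+1 + 4 * R + 16)%N.
(* [delta] is a fraction of [n] that depends on [C] only; the lower bound on [n] gives
   [delta > N], [h >= R] and [q > 0] *)
pose q := (n %/ 16)%N; pose h := (n %/ 4)%N; pose delta := (q %/ C.+1)%N.
have q0 : (0 < q)%N by rewrite /q; lia.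
have hq : (4 * q <= h)%N by rewrite /q /h; lia.
have nh : (4 * h <= n)%N by rewrite /h; lia.
have dq : (C.+1 * delta <= q)%N by rewrite mulnC; exact: leq_divM.
have Rh : (R <= h)%N by rewrite /h; lia.
have n32 : (n <= 32 * q)%N by rewrite /q; lia.
have Nd : (N.+1 <= delta)%N.
  by rewrite /delta leq_divRL// /q leq_divRL//; lia.
have qd : (q <= 2 * C.+1 * delta)%N.
  by have := ltn_ceil q (ltn0Sn C); rewrite -/delta; nia.
have KP : ((C * ((complexity X n + 4 * n) %/ q).+1).+1 <= K)%N.
  rewrite /K ltnS leq_mul2l; apply/orP; right; rewrite ltnS.
  apply: (@leq_trans (((C + 4) * 32 * q) %/ q)); last by rewrite mulnK.
  apply: leq_div2r; apply: (@leq_trans ((C + 4) * n)%N).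
    by rewrite mulnDl leq_add2r.
  by rewrite -mulnA leq_mul2l n32 orbT.
have [B apP] := aperiodicity_le mX iX q.
have gapP x i : X x -> exists2 j : int, i <= j <= i + (complexity X n)%:Z &
    right_special X (window x (j - n%:Z) n).
  by move=> Xx; apply: right_special_gap => //; lia.
exists delta, (complexity X n + 3 * n)%N, (cut_radius n q h B).
exists (block_type A C K), (cut X n q h delta), (typed X n q h delta rs (C := C) (K := K)).
have Dd : (complexity X n + 3 * n <= (C + 3) * 64 * C.+1 * delta)%N.
  apply: (@leq_trans ((C + 3) * n)%N); first by rewrite mulnDl leq_add2r.
  rewrite -!mulnA leq_mul2l; apply/orP; right; lia.
split; [lia| |by rewrite leq_addr|split].
  by apply: leq_trans Dd _; rewrite leq_mul2r leq_addl orbT.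
- exact: (cut_local q0 hq nh dq rsC apP Rh KP).
- exact: (cut_separated q0 hq nh dq rsC Rh KP).
- by move=> x i Xx; exact: (cut_dense q0 hq nh dq rsC rsP gapP apP Rh KP Xx).
- by move=> tau r x c c' [].
- exact: (typed_total q0 hq nh dq rsC rsP gapP apP Rh KP).
- exact: (typed_context q0 hq nh dq rsC Rh KP).
- exact: (typed_root X q0 hq nh dq rsC Rh KP).
- exact: (typed_count q0 hq nh dq rsC Rh KP).
Qed.

End CutRules.

(** * Local codings *)

Section Codings.
Variable (A : finType) (X : set (biseq A)).
Implicit Types (x y z : biseq A) (c d i j : int).

(** A local rule that cuts the points of [X] into labelled blocks: [code x i] is the
    label of the block of [x] that starts at [i], if there is one. *)
Record coding (B : finType) (code : biseq A -> int -> option B)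
    (word : B -> seq A) (radius width : nat) : Prop := Coding {
  coding_local : forall x y i j, X x -> X y -> agree x y i j radius ->
    code x i = code y j;
  coding_word : forall x i b, X x -> code x i = Some b ->
    window x i (size (word b)) = word b;
  coding_next : forall x i b, X x -> code x i = Some b ->
    code x (i + (size (word b))%:Z) : bool;
  coding_gap : forall x i b (k : int), X x -> code x i = Some b ->
    i < k -> k < i + (size (word b))%:Z -> code x k = None;
  coding_nonempty : forall b, word b != [::];
  coding_width : forall b, (size (word b) <= width)%N;
  coding_dense : forall x i, X x ->
    exists2 j, i <= j < i + width%:Z & (code x j : bool) }.

Definition labels (B : finType) (code : biseq A -> int -> option B) x i (n : nat) :
    seq B := pmap (fun k : nat => code x (i + k%:Z)) (iota 0 n).

Section Labels.
Variables (B : finType) (code : biseq A -> int -> option B) (word : B -> seq A).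
Variables (radius width : nat).
Hypothesis cod : coding code word radius width.

Lemma labelsD x i m n :
  labels code x i (m + n) = labels code x i m ++ labels code x (i + m%:Z) n.
Proof.
rewrite /labels iotaD pmap_cat add0n -{2}[m]addn0 iotaDl; congr (_ ++ _).
elim: (iota 0 n) => //= a l ->; rewrite PoszD addrA.
by case: (code _ _).
Qed.

Lemma eq_labels x y i j n :
  (forall k : nat, (k < n)%N -> code x (i + k%:Z) = code y (j + k%:Z)) ->
  labels code x i n = labels code y j n.
Proof.
move=> e; rewrite /labels.
have : forall k, k \in iota 0 n -> code x (i + k%:Z) = code y (j + k%:Z).
  by move=> k; rewrite mem_iota; apply: e.
elim: (iota 0 n) => //= a l IH h; rewrite h ?mem_head// IH// => k kl.
by apply: h; rewrite in_cons kl orbT.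
Qed.

Lemma labels1 x i b : X x -> code x i = Some b ->
  labels code x i (size (word b)) = [:: b].
Proof.
move=> Xx e; have := coding_nonempty cod b; rewrite -size_eq0.
case eW : (size (word b)) => [//|m] _; rewrite /labels /= addr0 e /=; congr cons.
have h k : k \in iota 1 m -> code x (i + k%:Z) = None.
  by rewrite mem_iota => km; apply: (coding_gap cod Xx e); rewrite ?eW; lia.
elim: (iota 1 m) h => //= a l IH h; rewrite h ?mem_head//= IH// => k kl.
by apply: h; rewrite in_cons kl orbT.
Qed.

(** Anything additive along the line can be computed block by block. *)
Lemma labels_flatten (T : Type) (f : B -> seq T) (g : int -> nat -> seq T) x :
  X x -> (forall i, g i 0%N = [::]) ->
  (forall i m n, g i (m + n)%N = g i m ++ g (i + m%:Z) n) ->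
  (forall i b, code x i = Some b -> g i (size (word b)) = f b) ->
  forall i n, code x i -> code x (i + n%:Z) ->
  subst_word f (labels code x i n) = g i n.
Proof.
move=> Xx g0 gD gb i n; elim/ltn_ind: n i => -[|n] IH i ci cn; first by rewrite g0.
case ei : (code x i) ci => [b|//] _; have b0 : (0 < size (word b))%N.
  by rewrite lt0n size_eq0; exact: (coding_nonempty cod b).
have bn : (size (word b) <= n.+1)%N.
  rewrite leqNgt; apply/negP => lt.
  by move: cn; rewrite (coding_gap cod Xx ei) //; lia.
rewrite -(subnKC bn) labelsD gD (gb _ _ ei) labels1// /subst_word /= -IH //; try lia.
  exact: (coding_next cod Xx ei).
by move: cn; rewrite -addrA (_ : (size (word b))%:Z + _ = n.+1%:Z)//; lia.
Qed.

Lemma labels_word x i n : X x -> code x i -> code x (i + n%:Z) ->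
  subst_word word (labels code x i n) = window x i n.
Proof.
move=> Xx; apply: (labels_flatten (g := fun i n => window x i n)) => //.
- by move=> j l m; exact: window_cat.
- by move=> j b e; exact: (coding_word cod Xx e).
Qed.

Definition shift_to_code x i : nat :=
  find id [seq (code x (i + k%:Z) : bool) | k : nat <- iota 0 width].

Lemma shift_to_codeP x i : X x ->
  (shift_to_code x i < width)%N /\ (code x (i + (shift_to_code x i)%:Z) : bool).
Proof.
move=> Xx; have [j ij cj] := coding_dense cod i Xx.
have has_code : has id [seq (code x (i + k%:Z) : bool) | k : nat <- iota 0 width].
  apply/hasP; exists true => //; apply/mapP; exists (absz (j - i)%R).
    by rewrite mem_iota; lia.
  by rewrite (_ : i + _ = j)//; lia.
have lt : (shift_to_code x i < width)%N.
  by move: has_code; rewrite has_find size_map size_iota.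
split=> //; have := nth_find false has_code; rewrite -/(shift_to_code x i) /=.
by rewrite (nth_map 0%N) ?size_iota// nth_iota.
Qed.

Lemma eq_shift_to_code x y i j : X x -> X y ->
  agree x y i j (radius + width) -> shift_to_code x i = shift_to_code y j.
Proof.
move=> Xx Xy xy; rewrite /shift_to_code; congr (find id _).
apply/eq_in_map => k; rewrite mem_iota => kw; congr isSome.
apply: (coding_local cod) => // l lr; rewrite -!addrA; apply: xy; lia.
Qed.

End Labels.

Lemma trivial_coding : coding (fun x i => Some (x i : A)) (fun a => [:: a]) 0 1.
Proof.
split=> //.
- move=> x y i j _ _ xy; congr Some; have := xy 0 (ltac:(lia)).
  by rewrite !addr0.
- by move=> x i b _ [<-]; rewrite /window /= addr0.
- by move=> x i b k _ _ /=; lia.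
- by move=> x i _; exists i => //; lia.
Qed.

Lemma next_cut R L D radius (T : finType) cut
    (typed : T -> nat -> biseq A -> int -> int -> Prop) x c :
  cut_rule X R L D radius cut typed -> X x -> cut x c ->
  exists2 c', c' <= c + D%:Z & consecutive cut x c c'.
Proof.
move=> CR Xx xc; pose P (k : nat) := `[< cut x (c + k.+1%:Z) >].
have [e ce xe] := rule_dense CR c Xx.
have exP : exists k, P k.
  by exists (absz (e - c - 1)%R); apply/asboolP; rewrite (_ : c + _ = e)//; lia.
case: (ex_minnP exP) => k /asboolP xk mk; exists (c + k.+1%:Z).
  have : P (absz (e - c - 1)%R) by apply/asboolP; rewrite (_ : c + _ = e)//; lia.
  by move/mk; lia.
split=> //; first by lia.
move=> i ci xi; have : P (absz (i - c - 1)%R).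
  by apply/asboolP; rewrite (_ : c + _ = i)//; lia.
by move/mk; lia.
Qed.

End Codings.

(** * Roots of words *)

Section Roots.
Variable A : finType.
Implicit Types (u v w : seq A).

Lemma nth_wpow a0 v k i : (i < k * size v)%N ->
  nth a0 (wpow v k) i = nth a0 v (i %% size v).
Proof.
elim: k i => [|k IH] i ik; first by [].
rewrite wpowS nth_cat; case: ltnP => iv; first by rewrite modn_small.
by rewrite IH; [rewrite -{2}(subnKC iv) modnDl | rewrite mulSn in ik; lia].
Qed.

Lemma wpow_mul v k l : wpow (wpow v k) l = wpow v (l * k).
Proof.
by elim: l => // l IH; rewrite wpowS IH mulSn /wpow nseqD flatten_cat.
Qed.

Lemma proot_wpow u v r : (0 < r)%N -> is_proot u v -> is_proot (wpow u r) v.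
Proof.
move=> r0 [_ [k k0 ->]]; rewrite wpow_mul; split; last by exists (r * k)%N; rewrite ?muln_gt0 ?r0.
by case: (r * k)%N (muln_gt0 r k) => [|m _]; [rewrite r0 k0|rewrite wpowS prefix_prefix].
Qed.

Lemma is_root_unique u v v' : is_root u v -> is_root u v' -> v = v'.
Proof.
move=> [pv mv] [pv' mv']; have s : size v = size v'.
  by apply/eqP; rewrite eqn_leq mv// mv'.
case: pv => /prefixP[w e] _; case: pv' => /prefixP[w']; rewrite e => /eqP.
by rewrite eqseq_cat// => /andP[/eqP].
Qed.

(** The periodic extension of [u] is also that of [v]; so it has both lengths as
    periods, hence also their gcd. By minimality the length of [v] is this gcd. *)
Lemma root_wpow_proot u v r : (0 < r)%N -> is_root (wpow u r) v -> is_proot u v.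
Proof.
move=> r0 [[pv [k k0 e]] mv]; case: u e pv mv => [|a0 u'] e pv mv.
  have v0 : v = [::].
    apply/eqP; move: pv; rewrite (_ : wpow [::] r = [::]) ?prefixs0//.
    by elim: (r) => //= m ->.
  by rewrite v0; split=> //; exists 1%N.
move eu : (a0 :: u') e pv mv => u e pv mv.
have u0 : (0 < size u)%N by rewrite -eu.
have eN : (r * size u = k * size v)%N by rewrite -!size_wpow e.
have v0 : (0 < size v)%N by rewrite lt0n; apply/eqP => v0; rewrite v0 muln0 in eN; nia.
have N0 : (0 < r * size u)%N by rewrite muln_gt0 r0.
have uv i : nth a0 u (i %% size u) = nth a0 v (i %% size v).
  have iN : (i %% (r * size u) < r * size u)%N by rewrite ltn_mod.
  have := nth_wpow a0 iN; rewrite modn_dvdm ?dvdn_mull// => <-.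
  by rewrite e nth_wpow; [rewrite modn_dvdm// eN dvdn_mull | rewrite -eN].
have per_u i m : nth a0 u ((i + m * size u) %% size u) = nth a0 u (i %% size u).
  by rewrite addnC modnMDl.
have per_v i m : nth a0 u ((i + m * size v) %% size u) = nth a0 u (i %% size u).
  by rewrite !uv addnC modnMDl.
(* the prefix of length [g] is a candidate for the root *)
pose g := gcdn (size u) (size v).
have g0 : (0 < g)%N by rewrite gcdn_gt0 u0.
have gu : (g <= size u)%N by apply: dvdn_leq => //; exact: dvdn_gcdl.
have per_g i m : nth a0 u ((i + m * g) %% size u) = nth a0 u (i %% size u).
  elim: m i => [|m IH] i; first by rewrite mul0n addn0.
  rewrite mulSn addnA IH; case: (egcdnP (size v) u0) => km kn eg _.
  by rewrite -(per_v _ kn) -/g -addnA [(g + _)%N]addnC -eg per_u.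
have pg : is_proot (wpow u r) (take g u).
  split.
    apply: (@prefix_trans _ u); first exact: prefix_take.
    by case: (r) r0 => // m _; rewrite wpowS prefix_prefix.
  exists (r * size u %/ g)%N.
    by rewrite divn_gt0// dvdn_leq// dvdn_mull// dvdn_gcdl.
  have sg : size (take g u) = g by rewrite size_takel.
  have gN : (g %| r * size u)%N by rewrite dvdn_mull ?dvdn_gcdl.
  apply: (@eq_from_nth _ a0); first by rewrite !size_wpow sg divnK.
  move=> i; rewrite size_wpow => iN; rewrite !nth_wpow ?sg ?divnK//.
  rewrite nth_take ?ltn_mod// {1}(divn_eq i g) addnC per_g modn_small//.
  by apply: leq_trans gu; rewrite ltn_mod.
have gv : (g %| size v)%N by exact: dvdn_gcdr.
have vg : size v = g.
  apply/eqP; rewrite eqn_leq (dvdn_leq v0 gv) andbT.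
  by have := mv _ pg; rewrite size_takel.
have vu : (size v %| size u)%N by rewrite vg dvdn_gcdl.
have eu2 : u = wpow v (size u %/ size v).
  apply: (@eq_from_nth _ a0) => [|i iu]; first by rewrite size_wpow divnK.
  by rewrite nth_wpow ?divnK// -uv modn_small.
have q0 : (0 < size u %/ size v)%N by rewrite divn_gt0// dvdn_leq.
split; last by exists (size u %/ size v)%N.
by rewrite {1}eu2; case: (size u %/ size v)%N q0 => // m _; rewrite wpowS prefix_prefix.
Qed.

Lemma root_wpow u v v' r r' : (0 < r)%N -> (0 < r')%N ->
  is_root (wpow u r) v -> is_root (wpow u r') v' -> v = v'.
Proof.
move=> r0 r0' rv rv'.
have pv := root_wpow_proot r0 rv; have pv' := root_wpow_proot r0' rv'.
have s : size v = size v'.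
  apply/eqP; rewrite eqn_leq; case: rv => _ mv; case: rv' => _ mv'.
  by rewrite mv ?mv' //; exact: proot_wpow.
case: pv => /prefixP[w e] _; case: pv' => /prefixP[w']; rewrite e => /eqP.
by rewrite eqseq_cat// => /andP[/eqP].
Qed.

End Roots.

(** Each element of [T] is assigned to at most one element of [S]. *)
Lemma card_le_functional (V : Type) (T : finType) (S : set V) (rel : T -> V -> Prop) :
  (forall v, S v -> exists t, rel t v) ->
  (forall t v v', S v -> S v' -> rel t v -> rel t v' -> v = v') ->
  S #<= `I_#|T|.
Proof.
move=> tot fun_.
have [f hf] : exists f : T -> option V, forall t v, S v -> rel t v -> f t = Some v.
  have /choice[f hf] : forall t, exists o : option V, forall v, S v -> rel t v -> o = Some v.
    move=> t; have [[v [Sv rv]]|no] := pselect (exists v, S v /\ rel t v).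
      by exists (Some v) => v' Sv' rv'; rewrite (fun_ t v v').
    by exists None => v Sv rv; case: no; exists v.
  by exists f.
have : some @` S `<=` (f \o enum_val) @` [set: 'I_#|T|].
  move=> _ [v Sv <-]; have [t rt] := tot v Sv; exists (enum_rank t) => //=.
  by rewrite enum_rankK; exact: hf.
move=> /subset_card_le h1.
rewrite -(card_le_eql (@card_some _ S)) (card_le_eqr card_II).
exact: card_le_trans h1 (card_image_le _ _).
Qed.

(** * Refinement of a coding by a cut rule *)

Section Refinement.
Variables (A : finType) (X : set (biseq A)).
Variables (B : finType) (code : biseq A -> int -> option B) (word : B -> seq A).
Variables (rad width : nat).
Variables (R L D radius : nat) (T : finType) (cut : biseq A -> int -> Prop).
Variable typed : T -> nat -> biseq A -> int -> int -> Prop.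
Implicit Types (x y z : biseq A) (c d i j : int).
Hypothesis X0 : X !=set0.
Hypothesis cod : coding X code word rad width.
Hypothesis rule : cut_rule X R L D radius cut typed.
Hypothesis RP : (rad + width < R)%N.
Hypothesis LP : (2 * width <= L)%N.

(** Cuts are moved forward to the blocks of the given coding, so that each new block
    is a concatenation of given ones. *)
Definition start x c : int := c + (shift_to_code code width x c)%:Z.

Definition block_size x c c' : nat := absz (start x c' - start x c)%R.

Definition block_word x c c' : seq A := window x (start x c) (block_size x c c').

Definition block_labels x c c' : seq B :=
  labels code x (start x c) (block_size x c c').

Lemma start_bounds x c : X x -> c <= start x c < c + width%:Z.
Proof. by move=> Xx; have [? _] := shift_to_codeP cod c Xx; rewrite /start; lia. Qed.

Lemma consecutive_unique x c c1 c2 :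
  consecutive cut x c c1 -> consecutive cut x c c2 -> c1 = c2.
Proof.
move=> [_ x1 lt1 n1] [_ x2 lt2 n2]; have [lt|lt|//] := ltgtP c1 c2.
  by case: (n2 c1) => //; lia.
by case: (n1 c2) => //; lia.
Qed.

Lemma consecutive_bounds x c c' : X x -> consecutive cut x c c' ->
  L%:Z < c' - c <= D%:Z.
Proof.
move=> Xx cc; have [xc xc' lt _] := cc; rewrite (rule_separated rule xc xc' lt) /=.
by have [c1 c1D /(consecutive_unique cc) ->] := next_cut rule Xx xc; lia.
Qed.

Lemma block_size_bounds x c c' : X x -> consecutive cut x c c' ->
  [/\ (L - width < block_size x c c')%N, (block_size x c c' <= D + width)%N &
      start x c' = start x c + (block_size x c c')%:Z].
Proof.
move=> Xx cc; have := consecutive_bounds Xx cc.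
have := start_bounds c Xx; have := start_bounds c' Xx; rewrite /block_size.
by move=> ? ? ?; split; lia.
Qed.

Lemma context_agree x y c c' d d' : X x -> X y ->
  c < c' -> d < d' -> context R x c c' = context R y d d' ->
  c' - c = d' - d /\ forall k : int, - R%:Z <= k < c' - c + R%:Z -> x (c + k) = y (d + k).
Proof.
move=> Xx Xy cc dd e; have := congr1 size e; rewrite !size_window => es.
have cd : c' - c = d' - d by lia.
split=> // k kR; move: e; rewrite /context -cd => /windowP/(_ (R%:Z + k) (ltac:(lia))).
by rewrite !addrA !subrK.
Qed.

Lemma agree_start x y c d e : X x -> X y ->
  (forall k : int, - R%:Z <= k < R%:Z -> x (c + e + k) = y (d + e + k)) ->
  start x (c + e) - c = start y (d + e) - d.
Proof.
move=> Xx Xy xy; rewrite /start (eq_shift_to_code (x := x) (y := y)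
  (j := d + e) cod) //; first by lia.
by move=> k kw; apply: xy; lia.
Qed.

(** Contexts are wide enough for the labels around both ends of a block, so that
    they determine how far the ends move and the labels in between. *)
Lemma context_block x y c c' d d' : X x -> X y ->
  consecutive cut x c c' -> consecutive cut y d d' ->
  context R x c c' = context R y d d' ->
  [/\ start x c - c = start y d - d, block_size x c c' = block_size y d d',
      block_word x c c' = block_word y d d' & block_labels x c c' = block_labels y d d'].
Proof.
move=> Xx Xy cc dd e; have [_ _ lt _] := cc; have [_ _ lt' _] := dd.
have [cd xy] := context_agree Xx Xy lt lt' e.
have s1 : start x c - c = start y d - d.
  rewrite -[in start x c](addr0 c) -[in start y d](addr0 d).
  by apply: agree_start => // k kR; rewrite !addr0; apply: xy; lia.
have s2 : start x c' - c = start y d' - d.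
  have -> : c' = c + (c' - c) by lia.
  have -> : d' = d + (c' - c) by lia.
  by apply: agree_start => // k kR; rewrite -!addrA; apply: xy; lia.
have bs : block_size x c c' = block_size y d d' by rewrite /block_size; lia.
have [_ _ e1] := block_size_bounds Xx cc.
have b1 := start_bounds c Xx; have b2 := start_bounds c' Xx.
split=> //.
  rewrite /block_word bs; apply/windowP => k kb.
  have := xy (start x c - c + k) (ltac:(lia)).
  rewrite (_ : c + (start x c - c + k) = start x c + k); last by lia.
  by rewrite (_ : d + (start x c - c + k) = start y d + k); last by lia.
rewrite /block_labels bs; apply: eq_labels => k kb.
apply: (coding_local cod) => // l lr.
have := xy (start x c - c + k%:Z + l) (ltac:(lia)).
rewrite (_ : c + (start x c - c + k%:Z + l) = start x c + k%:Z + l); last by lia.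
by rewrite (_ : d + (start x c - c + k%:Z + l) = start y d + k%:Z + l); last by lia.
Qed.

Definition coded x i (e : seq A) : Prop := exists c c',
  [/\ consecutive cut x c c', i = start x c & e = context R x c c'].

Lemma start_inj x c c' : X x -> cut x c -> cut x c' -> c <= c' ->
  start x c' <= start x c -> c = c'.
Proof.
move=> Xx xc xc'; rewrite le_eqVlt => /orP[/eqP //|lt].
have := rule_separated rule xc xc' lt.
by have := start_bounds c Xx; have := start_bounds c' Xx; lia.
Qed.

Lemma start_inj2 x c c' : X x -> cut x c -> cut x c' ->
  start x c = start x c' -> c = c'.
Proof.
move=> Xx xc xc' e; have [cc|/ltW cc] := leP c c'.
  by apply: (start_inj Xx xc xc' cc); rewrite e.
by apply/esym; apply: (start_inj Xx xc' xc cc); rewrite e.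
Qed.

Lemma coded_unique x i e e' : X x -> coded x i e -> coded x i e' -> e = e'.
Proof.
move=> Xx [c [c' [cc ic ->]]] [d [d' [dd id ->]]].
have [xc _ _ _] := cc; have [xd _ _ _] := dd.
have cd : c = d by apply: (start_inj2 Xx xc xd); rewrite -ic.
by subst d; rewrite (consecutive_unique cc dd).
Qed.

Definition new_radius : nat := D + R + radius + rad + width.

Lemma consecutive_local x y c c' e : X x -> X y ->
  (forall k : int, - radius%:Z <= k - c <= D%:Z + radius%:Z -> x k = y (k + e)) ->
  consecutive cut x c c' -> consecutive cut y (c + e) (c' + e).
Proof.
move=> Xx Xy xy cc; have [xc xc' lt nc] := cc.
have := consecutive_bounds Xx cc; move=> cD; split.
- apply: (rule_local rule Xx Xy) xc => k kr.
  by rewrite xy; [congr (y _)|]; lia.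
- apply: (rule_local rule Xx Xy) xc' => k kr.
  by rewrite xy; [congr (y _)|]; lia.
- by lia.
move=> i ie yi; apply: (nc (i - e)); first by lia.
apply: (rule_local rule Xy Xx) yi => k kr.
by rewrite xy; [congr (y _)|]; lia.
Qed.

Lemma coded_local x y i j e : X x -> X y -> agree x y i j new_radius ->
  coded x i e -> coded y j e.
Proof.
move=> Xx Xy xy [c [c' [cc ic ->]]]; rewrite /new_radius in xy.
have {}xy (k : int) : `|k - i| <= (D + R + radius + rad + width)%N%:Z ->
    x k = y (k + (j - i)).
  by move=> ki; have := xy (k - i) ki; rewrite subrKC => ->; congr (y _); lia.
have ej : j = i + (j - i) by lia.
have cD := consecutive_bounds Xx cc; have cb := start_bounds c Xx.
exists (c + (j - i)), (c' + (j - i)); split.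
- by apply: (consecutive_local Xx Xy) cc => k kc; apply: xy; lia.
- have := @agree_start x y c (c + (j - i)) 0 Xx Xy; rewrite !addr0 => h.
  suff : start x c - c = start y (c + (j - i)) - (c + (j - i)) by lia.
  by apply: h => k kR; rewrite xy; [congr (y _)|]; lia.
- rewrite /context (_ : c' + (j - i) - (c + (j - i)) = c' - c); last by lia.
  apply/windowP => k kR; rewrite xy; last by lia.
  by congr (y _); lia.
Qed.

Definition block_pred (e : (D + R.*2).-bseq A) : bool :=
  `[< exists x c c', [/\ X x, consecutive cut x c c' & e = context R x c c' :> seq A] >].

(** The new letters are the blocks with their contexts, not just their words: the
    labels of the given coding are a function of the context. *)
Definition blocks : finType := {e : (D + R.*2).-bseq A | block_pred e}.

Definition block_seq (b : blocks) : seq A := val (val b).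

Lemma block_seq_inj : injective block_seq.
Proof. by move=> b b' /val_inj/val_inj. Qed.

Lemma block_witness (b : blocks) : exists w : biseq A * int * int,
  [/\ X w.1.1, consecutive cut w.1.1 w.1.2 w.2 &
      block_seq b = context R w.1.1 w.1.2 w.2].
Proof.
by have /asboolP[x [c [c' [? ? ?]]]] := valP b; exists (x, c, c').
Qed.

Lemma block_exists x c c' : X x -> consecutive cut x c c' ->
  exists b, block_seq b = context R x c c'.
Proof.
move=> Xx cc; have cD := consecutive_bounds Xx cc.
have sz : (size (context R x c c') <= D + R.*2)%N by rewrite size_window; lia.
have bP : block_pred (Bseq sz) by apply/asboolP; exists x, c, c'.
by exists (exist _ (Bseq sz) bP).
Qed.

Definition witness (b : blocks) : biseq A * int * int := projT1 (cid (block_witness b)).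

Definition new_word (b : blocks) : seq A :=
  block_word (witness b).1.1 (witness b).1.2 (witness b).2.

Definition new_labels (b : blocks) : seq B :=
  block_labels (witness b).1.1 (witness b).1.2 (witness b).2.

Definition new_code x i : option blocks :=
  if pselect (exists b, coded x i (block_seq b)) is left h then Some (projT1 (cid h))
  else None.

Lemma witnessP b : [/\ X (witness b).1.1,
  consecutive cut (witness b).1.1 (witness b).1.2 (witness b).2 &
  block_seq b = context R (witness b).1.1 (witness b).1.2 (witness b).2].
Proof. by rewrite /witness; case: cid. Qed.

Lemma new_codeP x i b : X x -> new_code x i = Some b <-> coded x i (block_seq b).
Proof.
move=> Xx; rewrite /new_code; case: pselect => [h|nh]; last first.
  by split=> // cb; case: nh; exists b.
case: cid => /= b' cb'; split=> [[<-]//|cb]; congr Some; apply: block_seq_inj.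
exact: coded_unique Xx cb' cb.
Qed.

Lemma new_code_cut x i b : X x -> new_code x i = Some b -> exists c c',
  [/\ consecutive cut x c c', i = start x c, new_word b = block_word x c c',
      new_labels b = block_labels x c c' &
      size (new_word b) = block_size x c c'].
Proof.
move=> Xx /(new_codeP _ _ Xx)[c [c' [cc ic e]]]; exists c, c'.
have [Xw ccw ew] := witnessP b.
have [_ bs bw bl] := context_block Xw Xx ccw cc (etrans (esym ew) e).
by split=> //; rewrite /new_word size_window.
Qed.

Lemma new_code_start x c c' : X x -> consecutive cut x c c' ->
  exists2 b, new_code x (start x c) = Some b & block_seq b = context R x c c'.
Proof.
move=> Xx cc; have [b eb] := block_exists Xx cc; exists b => //.
by apply/(new_codeP _ _ Xx); exists c, c'.
Qed.

Lemma new_coding : coding X new_code new_word new_radius (D + width).+1.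
Proof.
split.
- move=> x y i j Xx Xy xy.
  have yx : agree y x j i new_radius by move=> k kr; rewrite xy.
  case ex : (new_code x i) => [b|].
    by apply/esym/(new_codeP _ _ Xy); apply: coded_local xy _ => //; exact/new_codeP.
  case ey : (new_code y j) => [b|//]; rewrite -ex; apply/(new_codeP _ _ Xx).
  by apply: coded_local yx _ => //; exact/new_codeP.
- move=> x i b Xx /(new_code_cut Xx)[c [c' [cc -> -> _ _]]].
  by rewrite /block_word size_window.
- move=> x i b Xx /(new_code_cut Xx)[c [c' [cc -> _ _ ->]]].
  have [_ _ <-] := block_size_bounds Xx cc; have [_ xc' _ _] := cc.
  have [c2 _ cc2] := next_cut rule Xx xc'.
  by have [b' -> _] := new_code_start Xx cc2.
- move=> x i b k Xx /(new_code_cut Xx)[c [c' [cc -> _ _ ->]]] ik ki.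
  have [_ _ e] := block_size_bounds Xx cc; rewrite -e in ki.
  case ek : (new_code x k) => [b'|//].
  have [d [d' [dd kd _ _ _]]] := new_code_cut Xx ek; subst k.
  have [xc xc' _ nc] := cc; have [xd _ _ _] := dd.
  case: (nc d) => //; apply/andP; split; rewrite ltNge; apply/negP => le.
    by have := start_inj Xx xd xc le (ltW ik) => de; move: ik; rewrite de ltxx.
  by have := start_inj Xx xc' xd le (ltW ki) => de; move: ki; rewrite de ltxx.
- move=> b; have [Xw cc _] := witnessP b; rewrite -size_eq0 size_window.
  by have [? _ _] := block_size_bounds Xw cc; lia.
- move=> b; have [Xw cc _] := witnessP b; rewrite size_window.
  by have [_ ? _] := block_size_bounds Xw cc; lia.
- move=> x i Xx; have [c ic xc] := rule_dense rule i Xx.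
  have [c' _ cc] := next_cut rule Xx xc.
  exists (start x c); first by have := start_bounds c Xx; lia.
  by have [b -> _] := new_code_start Xx cc.
Qed.

Lemma new_used b : exists x i, X x /\ new_code x i = Some b.
Proof.
have [Xw cc e] := witnessP b.
exists (witness b).1.1, (start (witness b).1.1 (witness b).1.2); split=> //.
by apply/(new_codeP _ _ Xw); do 2 eexists; split; [exact: cc|by []|].
Qed.

Lemma new_label x i b : X x -> new_code x i = Some b ->
  [/\ new_labels b = labels code x i (size (new_word b)), code x i : bool &
      code x (i + (size (new_word b))%:Z) : bool].
Proof.
move=> Xx /(new_code_cut Xx)[c [c' [cc -> _ -> ->]]]; split=> //.
  by have [_ ->] := shift_to_codeP cod c Xx.
have [_ _ <-] := block_size_bounds Xx cc.
by have [_ ->] := shift_to_codeP cod c' Xx.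
Qed.

Lemma new_word_size b : (L - width < size (new_word b) <= D + width)%N.
Proof.
have [Xw cc _] := witnessP b; rewrite size_window.
by have [? ? _] := block_size_bounds Xw cc; apply/andP.
Qed.

(** Blocks of one type have one root. Either they are all equal, or the two ends of
    each block have the same surroundings and move by the same amount, so that the
    moved block is still a power of the word of length [p] that it starts with. *)
Lemma new_roots : root_set (range new_word) #<= `I_#|T|.
Proof.
pose rel (t : T) (v : seq A) := exists r x c c',
  [/\ X x, typed t r x c c' & is_root (block_word x c c') v].
apply: (card_le_functional (rel := rel)) => [v [_ [b _ <-] rv]|t v v' _ _].
  have [Xw cc _] := witnessP b; have [t [r tr]] := rule_total rule Xw cc.
  by exists t, r; do 3 eexists; split; eassumption.
move=> [r [x [c [c' [Xx tx rv]]]]] [r' [y [d [d' [Xy ty rv']]]]].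
have cc := rule_consecutive rule tx; have dd := rule_consecutive rule ty.
have [h|[p p0 h]] := rule_root rule t.
  have rr := h _ _ _ _ _ _ _ _ tx ty; subst r'.
  have [_ e] := rule_context rule Xx Xy tx ty.
  have [_ _ bw _] := context_block Xx Xy cc dd e.
  by apply: is_root_unique rv _; rewrite bw.
have pw z r1 e e' : X z -> typed t r1 z e e' ->
    block_word z e e' = wpow (window z (start z e) p) r1 /\ (0 < r1)%N.
  move=> Xz tz; have [er r10 pz _] := h _ _ _ _ tz; split=> //.
  have ee := rule_consecutive rule tz.
  have eb := start_bounds e Xz.
  have se : start z e' - (e' - e) = start z e.
    have -> : e' = e + (e' - e) by lia.
    have := @agree_start z z (e + (e' - e)) e 0 Xz Xz; rewrite !addr0 => hh.
    have -> : e + (e' - e) - e = e' - e by lia.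
    suff : start z (e + (e' - e)) - (e + (e' - e)) = start z e - e by lia.
    apply: hh => k kR; apply/esym; rewrite er.
    have -> : e + r1%:Z * p%:Z + k = e + k + r1%:Z * p%:Z by lia.
    by apply: (per_mul (s := e - R%:Z) (t := e' + R%:Z)) => //; lia.
  have sz : block_size z e e' = (r1 * p)%N by rewrite /block_size; lia.
  have := @wpow_window A z (e - R%:Z) (e' + R%:Z) p r1 p0 pz.
  rewrite /block_word sz.
  have pz' : per z (e - R%:Z) (start z e + (r1 * p)%N%:Z) p%:Z.
    by apply: per_sub pz; lia.
  have := @wpow_window A z (e - R%:Z) (start z e + (r1 * p)%N%:Z) p r1 p0 pz'.
  rewrite addrK => <-; last by lia.
  move=> _; congr wpow; apply: esym.
  case: r1 tz er r10 sz pz' => [//|r1] tz er _ sz pz'.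
  apply: (window_per (s := e - R%:Z) (t := e' + R%:Z) (p := p%:Z) (k := r1)) => //; lia.
have [bx r0] := pw _ _ _ _ Xx tx; have [byw r0'] := pw _ _ _ _ Xy ty.
have [_ _ _ /(_ _ _ _ _ ty) xy] := h _ _ _ _ tx.
suff e : window x (start x c) p = window y (start y d) p.
  by rewrite bx e in rv; rewrite byw in rv'; exact: root_wpow r0 r0' rv rv'.
have {}xy (k : int) : - R%:Z <= k < R%:Z + p%:Z -> x (c + k) = y (d + k).
  move=> kR; move/windowP: xy => /(_ (R%:Z + k) (ltac:(lia))).
  by rewrite !addrA !subrK.
have := @agree_start x y c d 0 Xx Xy; rewrite !addr0 => s1.
have {}s1 : start x c - c = start y d - d by apply: s1 => k kR; apply: xy; lia.
have cb := start_bounds c Xx.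
apply/windowP => k kp; have := xy (start x c - c + k) (ltac:(lia)).
rewrite (_ : c + (start x c - c + k) = start x c + k); last by lia.
by rewrite (_ : d + (start x c - c + k) = start y d + k); last by lia.
Qed.

Lemma new_card (N : nat) :
  few_powers X N ->
  (#|blocks| <= #|T| * N.*2.+1)%N.
Proof.
move=> /(rule_count rule) hN.
have /choice[l hl] : forall t : T, exists l : seq nat, (size l <= N.*2.+1)%N /\
    forall r x c c', X x -> typed t r x c c' -> r \in l.
  by move=> t; have [l ? ?] := hN t; exists l.
have /choice[f hf] : forall b : blocks, exists t : T * 'I_N.*2.+1,
    exists x c c', [/\ X x, typed t.1 (nth 0%N (l t.1) t.2) x c c' &
      block_seq b = context R x c c'].
  move=> b; have [Xw cc e] := witnessP b; have [t [r tr]] := rule_total rule Xw cc.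
  have [sl rl] := hl t; have rin := rl _ _ _ _ Xw tr.
  have lt : (index r (l t) < N.*2.+1)%N by apply: leq_trans sl; rewrite index_mem.
  exists (t, Ordinal lt) => /=; do 3 eexists; split; [exact: Xw| |exact: e].
  by rewrite nth_index.
have finj : injective f.
  move=> b b' e; have [x [c [c' [Xx tx eb]]]] := hf b.
  have [y [d [d' [Xy ty eb']]]] := hf b'; rewrite -e in ty.
  by apply: block_seq_inj; rewrite eb eb'; have [_ ->] := rule_context rule Xx Xy tx ty.
by have := leq_card f finj; rewrite card_prod card_ord.
Qed.

Lemma new_nonempty : (0 < #|blocks|)%N.
Proof.
have [x Xx] := X0; have [c _ xc] := rule_dense rule 0 Xx.
have [c' _ cc] := next_cut rule Xx xc; have [b _] := block_exists Xx cc.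
by apply/card_gt0P; exists b.
Qed.

End Refinement.

(** * Images of biinfinite sequences under substitutions *)

Section Substitution.
Implicit Types (A B : finType).

Lemma subst_word_cat (A B : Type) (t : A -> seq B) u v :
  subst_word t (u ++ v) = subst_word t u ++ subst_word t v.
Proof. by rewrite /subst_word map_cat flatten_cat. Qed.

Lemma subst_word_seq1 (A B : Type) (t : A -> seq B) a : subst_word t [:: a] = t a.
Proof. by rewrite /subst_word /= cats0. Qed.

Lemma subst_word_comp (A B C : Type) (t : A -> seq B) (t' : B -> seq C) w :
  subst_word t' (subst_word t w) = subst_word (fun a => subst_word t' (t a)) w.
Proof.
elim: w => // a w IH.
change (subst_word t' (t a ++ subst_word t w) = subst_word t' (t a) ++
  subst_word (fun a => subst_word t' (t a)) w).
by rewrite subst_word_cat IH.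
Qed.

Lemma size_subst_word A B (t : A -> seq B) w : (forall a, t a != [::]) ->
  (size w <= size (subst_word t w))%N.
Proof.
move=> t0; elim: w => //= a w IH; rewrite /subst_word /= size_cat.
by rewrite -add1n leq_add// lt0n size_eq0.
Qed.

(** Negative coordinates are counted back from the start of the image of [y 0]. *)
Definition image_start A B (t : A -> seq B) (y : biseq A) (i : int) : int :=
  match i with
  | Posz j => (size (subst_word t (window y 0 j)))%:Z
  | Negz j => - (size (subst_word t (window y (Negz j) j.+1)))%:Z
  end.

Lemma image_startS A B (t : A -> seq B) (y : biseq A) i :
  image_start t y (i + 1) = image_start t y i + (size (t (y i)))%:Z.
Proof.
case: i => [j|[|j]].
- rewrite (_ : Posz j + 1 = Posz j.+1); last by lia.
  by rewrite /= window_rcons -cats1 subst_word_cat subst_word_seq1 size_cat add0r PoszD.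
- by rewrite /= /window /= subst_word_seq1 addr0; lia.
- rewrite (_ : Negz j.+1 + 1 = Negz j); last by lia.
  rewrite /= [in RHS]windowS (_ : Negz j.+1 + 1 = Negz j); last by lia.
  by rewrite -cat1s subst_word_cat subst_word_seq1 size_cat; lia.
Qed.

Lemma image_startD A B (t : A -> seq B) (y : biseq A) i n :
  image_start t y (i + n%:Z) =
  image_start t y i + (size (subst_word t (window y i n)))%:Z.
Proof.
elim: n => [|n IH]; first by rewrite !addr0.
rewrite intS addrCA addrC image_startS IH window_rcons -cats1 subst_word_cat.
by rewrite subst_word_seq1 size_cat PoszD addrA.
Qed.

Lemma subst_biseq_block A B (b0 : B) (t : A -> seq B) (y : biseq A) i :
  (forall a, t a != [::]) ->
  window (subst_biseq b0 t y) (image_start t y i) (size (t (y i))) = t (y i).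
Proof.
move=> t0; apply: (@eq_from_nth _ b0); rewrite size_window// => k kt.
rewrite nth_window//; case: i kt => [j|j] kt.
  rewrite /image_start -PoszD /subst_biseq.
  set u := subst_word t (window y 0 j); set m := (size u + k)%N.
  have jm : (j <= m)%N.
    by apply: leq_trans (leq_addr _ _); rewrite -{1}(size_window y 0 j); exact: size_subst_word.
  have -> : m.+1 = (j + (1 + (m - j)))%N by lia.
  rewrite !window_cat !subst_word_cat add0r {2}/window /= addr0 subst_word_seq1.
  by rewrite nth_cat -/u ltnNge leq_addr /= addKn nth_cat kt.
rewrite /image_start.
have -> : window y (Negz j) j.+1 = (y (Negz j) : A) :: window y (Negz j + 1) j by rewrite windowS.
rewrite -cat1s subst_word_cat subst_word_seq1 size_cat.
set u := subst_word t (window y (Negz j + 1) j).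
have ju : (j <= size u)%N by rewrite -{1}(size_window y (Negz j + 1) j); exact: size_subst_word.
pose m := (size (t (y (Negz j))) + size u - k).-1.
have -> : - (size (t (y (Negz j))) + size u)%N%:Z + k%:Z = Negz m by rewrite /m; lia.
rewrite /subst_biseq; have -> : m.+1 = (m - j + (1 + j))%N by rewrite /m; lia.
rewrite !window_cat !subst_word_cat.
rewrite (_ : Negz m + (m - j)%N%:Z = Negz j); last by rewrite /m; lia.
rewrite -/u {2}/window /= addr0 subst_word_seq1 rev_cat nth_cat size_rev size_cat.
have -> : (m < size (t (y (Negz j))) + size u)%N by rewrite /m; lia.
rewrite nth_rev size_cat; last by rewrite /m; lia.
rewrite nth_cat (_ : (_ - m.+1 = k)%N) ?kt//; rewrite /m; lia.
Qed.

Lemma subst_biseq_window A B (b0 : B) (t : A -> seq B) (y : biseq A) i n :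
  (forall a, t a != [::]) ->
  window (subst_biseq b0 t y) (image_start t y i) (size (subst_word t (window y i n))) =
  subst_word t (window y i n).
Proof.
move=> t0; elim: n => [|n IH]; first by [].
rewrite window_rcons -cats1 subst_word_cat subst_word_seq1 size_cat window_cat IH.
by rewrite -image_startD subst_biseq_block.
Qed.

Lemma comp_subst_nn (B : nat -> finType) (s : forall k, B k.+1 -> seq (B k)) n a :
  @comp_subst B s n n a = [:: a].
Proof. by elim: n B s a => [|n IH] B s a //=; rewrite IH. Qed.

Lemma comp_substS (B : nat -> finType) (s : forall k, B k.+1 -> seq (B k)) n m a :
  (n <= m)%N ->
  @comp_subst B s n m.+1 a = subst_word (@comp_subst B s n m) (s m a).
Proof.
elim: n m B s a => [|n IH] m B s a //; case: m a => [|m] a // nm.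
exact: (IH m (fun k => B k.+1) (fun k => s k.+1) a nm).
Qed.

Lemma comp_substD (B : nat -> finType) (s : forall k, B k.+1 -> seq (B k)) l n m a :
  (l <= n)%N -> (n <= m)%N ->
  @comp_subst B s l m a = subst_word (@comp_subst B s l n) (@comp_subst B s n m a).
Proof.
move=> ln; elim: m a => [|m IH] a nm.
  have n0 : n = 0%N by lia.
  by subst n; rewrite comp_subst_nn subst_word_seq1.
move: nm; rewrite leq_eqVlt => /orP[/eqP e|nm].
  by subst n; rewrite comp_subst_nn subst_word_seq1.
have lm : (l <= m)%N by lia.
rewrite comp_substS// comp_substS// subst_word_comp /subst_word.
by congr flatten; apply: eq_map => b; rewrite IH.
Qed.

End Substitution.

(** * Directive sequences obtained from codings *)

Section SadicCodings.
Variables (A : finType) (X : set (biseq A)) (s : sadic A).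
Variable lcode : forall n, biseq A -> int -> option (alphabet s n).
Variable lword : forall n, alphabet s n -> seq A.
Variables lrad lwidth : nat -> nat.
Implicit Types (x y z : biseq A) (i j : int).
Hypothesis mX : minimal_subshift X.
Hypothesis lcod : forall n, coding X (@lcode n) (@lword n) (lrad n) (lwidth n).
Hypothesis code0 : forall x i, lcode 0 x i = Some (x i : A).
Hypothesis word0 : forall a, lword (n := 0) a = [:: a].
Hypothesis used : forall n (b : alphabet s n.+1),
  exists x i, X x /\ lcode n.+1 x i = Some b.
Hypothesis morphP : forall n x i (b : alphabet s n.+1), X x ->
  lcode n.+1 x i = Some b ->
  [/\ morph b = labels (@lcode n) x i (size (lword b)), lcode n x i : bool &
      lcode n x (i + (size (lword b))%:Z) : bool].
Hypothesis wide : forall n (b : alphabet s n), (n <= size (lword b))%N.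

Lemma sigma_labels n m x i (a : alphabet s m) : (n <= m)%N -> X x ->
  lcode m x i = Some a ->
  [/\ sigma s n m a = labels (@lcode n) x i (size (lword a)), lcode n x i : bool &
      lcode n x (i + (size (lword a))%:Z) : bool].
Proof.
move=> nm Xx; elim: m i a nm => [|m IH] i a.
  rewrite leqn0 => /eqP n0; subst n => e.
  rewrite (labels1 (lcod 0) Xx e); split=> //; first by rewrite e.
  exact: (coding_next (lcod 0) Xx e).
rewrite leq_eqVlt => /orP[/eqP e|nm] ea.
  subst n; rewrite (labels1 (lcod m.+1) Xx ea) /sigma comp_subst_nn; split=> //.
    by rewrite ea.
  exact: (coding_next (lcod m.+1) Xx ea).
have [em ci cs] := morphP Xx ea.
have cn j : lcode m x j -> lcode n x j.
  by case ej : (lcode m x j) => [b|//] _; have [] := IH j b nm ej.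
split; [|exact: cn|exact: cn].
rewrite /sigma comp_substS// -/(morph a) [s in subst_word _ s]em.
apply: (labels_flatten (lcod m) (g := labels (@lcode n) x)) => // [k l l'|j b ej].
  exact: labelsD.
by have [<-] := IH j b nm ej.
Qed.

Lemma labels_code0 x i n : labels (lcode 0) x i n = window x i n.
Proof.
rewrite /labels /window; elim: (iota 0 n) => //= k l ->; rewrite code0; congr cons.
Qed.

Lemma sigma0 n (a : alphabet s n) : sigma s 0 n a = lword a.
Proof.
case: n a => [|n] a; first by rewrite word0.
have [x [i [Xx ea]]] := used a; have [-> _ _] := sigma_labels (leq0n _) Xx ea.
by rewrite labels_code0 (coding_word (lcod n.+1) Xx ea).
Qed.

(** A word of [X] occurs in every sufficiently long word of [X] by uniform
    recurrence, in particular in the words of the letters of a high level. *)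
Lemma codings_generate : generates s X.
Proof.
have [cX sX] := minimal_sub mX; apply/seteqP; split=> [y Yy|x Xx l].
  apply: (subshift_mem (minimal_sub mX)) => l.
  have [m [m0 [a]]] := Yy l; rewrite sigma0.
  case: m m0 a => [//|m] _ a; have [x [i [Xx ea]]] := used a.
  rewrite -(coding_word (lcod m.+1) Xx ea) => /infix_window[k [_ e]].
  by exists x, (i + k%:Z); split=> //; rewrite size_window in e.
pose w := window x (- l%:Z) l.*2.+1.
have [N hN] := uniform_recurrence mX (language_window (- l%:Z) Xx (ltn0Sn l.*2)).
pose m := (N + l.*2.+1)%N; exists m.+1; split=> //.
have /card_gt0P[a _] := alphabet_nonempty s m.+1; exists a; rewrite sigma0.
have [y [i [Xy ea]]] := used a; have [j ij <-] := hN y i Xy.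
rewrite -(coding_word (lcod m.+1) Xy ea) size_window.
have := wide a; rewrite /m => wa; apply: window_infix; lia.
Qed.

(** The start of a block is found from the words of the labels that precede it. *)
Lemma labels_nth n x i (S : nat) v b v' : X x -> lcode n x i ->
  lcode n x (i + S%:Z) -> labels (@lcode n) x i S = v ++ b :: v' ->
  lcode n x (i + (size (subst_word (@lword n) v))%:Z) = Some b.
Proof.
move=> Xx; elim: v i S => [|c v IH] i S ci cS e.
  rewrite addr0; case: S cS e => [|S] //= cS; rewrite /labels /= addr0.
  by case: (lcode n x i) ci => //= c _ [->].
case ei : (lcode n x i) ci => [c'|//] _.
have S0 : (0 < S)%N by case: S {cS} e.
have bn : (size (lword c') <= S)%N.
  rewrite leqNgt; apply/negP => lt.
  by move: cS; rewrite (coding_gap (lcod n) Xx ei) //; lia.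
move: e; rewrite -(subnKC bn) labelsD (labels1 (lcod n) Xx ei) => -[<- e].
rewrite /subst_word /= size_cat PoszD addrA; apply: IH e.
  exact: (coding_next (lcod n) Xx ei).
by move: cS; rewrite -addrA (_ : (size (lword c'))%:Z + _ = S%:Z)//; lia.
Qed.

(** Windows of [y] occur in the label sequences of points of [X]. Hence the image of
    [y] agrees with points of [X] on long windows, with matching blocks, and the
    local rule gives the same labels. *)
Lemma level_code n (y : biseq (alphabet s n)) (b0 : A) : sadic_level s n y ->
  let z := subst_biseq b0 (sigma s 0 n) y in
  X z /\ forall j, lcode n z (image_start (sigma s 0 n) y j) = Some (y j : alphabet s n).
Proof.
move=> Yy z; set t := sigma s 0 n; have t0 a : t a != [::].
  by rewrite /t sigma0; exact: (coding_nonempty (lcod n)).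
have tE w : subst_word t w = subst_word (@lword n) w.
  by rewrite /subst_word (eq_map (g := @lword n))// => a; exact: sigma0.
(* a point of [X] whose labels, moved by [e], are those of [y] in the central window *)
have key l : exists x e, [/\ X x,
    (forall u : int, image_start t y (- l%:Z) <= u < image_start t y (l%:Z + 1) ->
       z u = x (u + e)) &
    forall j, `|j| <= l%:Z -> lcode n x (image_start t y j + e) = Some (y j : alphabet s n)].
  have [m [nm [a /infixP[v [v' ev]]]]] := Yy l.
  case: m nm a ev => [//|m] nm a ev; have [x [i [Xx ea]]] := used a.
  have [es ci cS] := sigma_labels (ltnW nm) Xx ea.
  rewrite es in ev; set S := size _ in ev cS.
  pose i1 := i + (size (subst_word t v))%:Z.
  exists x, (i1 - image_start t y (- l%:Z)); split=> // [u ul|j jl].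
    have xw : window x i1 (size (subst_word t (window y (- l%:Z) l.*2.+1))) =
        subst_word t (window y (- l%:Z) l.*2.+1).
      have := labels_word (lcod n) Xx ci cS; rewrite ev -tE !subst_word_cat => e.
      have : window x i (size (subst_word t v ++
            subst_word t (window y (- l%:Z) l.*2.+1) ++ subst_word t v')) =
          subst_word t v ++ subst_word t (window y (- l%:Z) l.*2.+1) ++ subst_word t v'.
        by rewrite e size_window.
      by move=> /window_cat_inv[_ /window_cat_inv[]].
    have := image_startD t y (- l%:Z) l.*2.+1.
    rewrite (_ : - l%:Z + _ = l%:Z + 1); last by lia.
    move=> eS; have zw := subst_biseq_window b0 y (- l%:Z) l.*2.+1 t0.
    have /windowP/(_ (u - image_start t y (- l%:Z)) (ltac:(lia))) := etrans xw (esym zw).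
    by rewrite subrKC => e1; apply: etrans (esym e1) _; congr (x _); lia.
  have := image_startD t y (- l%:Z) (absz (l%:Z + j)%R).
  rewrite (_ : - l%:Z + _ = j); last by lia.
  move=> ->; rewrite (_ : _ + _ + _ =
    i1 + (size (subst_word t (window y (- l%:Z) (absz (l%:Z + j)%R))))%:Z); last by lia.
  rewrite /i1 -addrA -PoszD -size_cat -subst_word_cat tE.
  apply: (labels_nth (S := S) (v' := window y (j + 1) (absz (l%:Z - j)%R) ++ v') Xx ci cS).
  rewrite ev -catA; congr (v ++ _); rewrite -cat_cons catA; congr (_ ++ v').
  rewrite -windowS (_ : l.*2.+1 = absz (l%:Z + j)%R + (absz (l%:Z - j)%R).+1)%N; last by lia.
  by rewrite window_cat (_ : - l%:Z + _ = j); last by lia.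
have startL i (k : nat) : image_start t y i + k%:Z <= image_start t y (i + k%:Z).
  rewrite image_startD lerD2l lez_nat -{1}(size_window y i k).
  exact: size_subst_word.
have s0 : image_start t y 0 = 0 by [].
have Xz : X z.
  apply: (subshift_mem (minimal_sub mX)) => l.
  have [x [e [Xx zx _]]] := key l; exists x, (- l%:Z + e); split=> //.
  apply/windowP => k kl; rewrite zx; first by congr (x _); lia.
  have := startL (- l%:Z) l; have := startL 0 l.+1.
  by rewrite addNr add0r s0 (_ : l.+1%:Z = l%:Z + 1); lia.
split=> // j; have [x [e [Xx zx <-]]] := key (absz j + lrad n)%N; last by lia.
apply: (coding_local (lcod n) Xz Xx) => k kr; rewrite zx.
  by congr (x _); lia.
set l := (absz j + lrad n)%N; have h1 := startL (- l%:Z) (absz (j + l%:Z)%R).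
have h2 := startL j (absz (l%:Z + 1 - j)%R).
rewrite (_ : - l%:Z + _ = j) in h1; last by rewrite /l; lia.
rewrite (_ : j + _ = l%:Z + 1) in h2; last by rewrite /l; lia.
by move: h1 h2; rewrite /l; lia.
Qed.

(** The rule reads a factorization off the point: [- k] is the last start of a block
    at or before 0, and the other blocks are found one after the other in both
    directions. *)
Lemma codings_recognizable : recognizable s.
Proof.
move=> n n1 x k k' y y' [Yy ex kb] [Yy' ex' kb'].
set t := sigma s 0 n in ex kb ex' kb'.
have [Xz cz] := level_code (x 0 : A) Yy.
have [Xz' cz'] := level_code (x 0 : A) Yy'.
set z := subst_biseq _ _ y in Xz cz ex; set z' := subst_biseq _ _ y' in Xz' cz' ex'.
have tE a : size (t a) = size (lword a) by rewrite /t sigma0.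
have shift_code u l i : X u -> lcode n (bishift l u) i = lcode n u (i + l).
  move=> Xu; apply: (coding_local (lcod n)) => //.
    by apply: shift_mem => //; case: (minimal_sub mX).
  by move=> j _; rewrite bishiftE; congr (u _); lia.
have xk : lcode n x (- k) = Some (y 0 : alphabet s n).
  by rewrite ex shift_code// addNr; exact: (cz 0).
have xk' : lcode n x (- k') = Some (y' 0 : alphabet s n).
  by rewrite ex' shift_code// addNr; exact: (cz' 0).
have Xx : X x by rewrite ex; apply: shift_mem => //; case: (minimal_sub mX).
rewrite !tE in kb kb'.
have kk : k = k'.
  have [lt|lt|//] := ltgtP k k'.
    by move: xk; rewrite (coding_gap (lcod n) Xx xk')//; lia.
  by move: xk'; rewrite (coding_gap (lcod n) Xx xk)//; lia.
subst k'; split=> //.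
have zz : z = z'.
  by rewrite -[z]bishift0 -[z']bishift0 -(addNr k) -!bishiftD -ex -ex'.
rewrite -zz in cz'; have cE i : lcode n z (image_start t y i) = Some (y i : alphabet s n) := cz i.
have cE' i : lcode n z (image_start t y' i) = Some (y' i : alphabet s n) := cz' i.
suff st i : image_start t y i = image_start t y' i.
  by apply: funext => i; have := cE i; rewrite st cE' => -[].
have pos (j : nat) : image_start t y j%:Z = image_start t y' j%:Z.
  elim: j => [|j IH] //; rewrite intS addrC !image_startS IH.
  by have := cE j%:Z; rewrite IH cE' => -[->].
case: i => [j|j]; first exact: pos.
(* the start of a block is the last one before the start of the next block *)
have neg (i : int) : image_start t y (i + 1) = image_start t y' (i + 1) ->
    image_start t y i = image_start t y' i.
  rewrite !image_startS !tE => e.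
  have wpos (a : alphabet s n) : (0 < size (lword a))%N.
    by rewrite lt0n size_eq0; exact: (coding_nonempty (lcod n)).
  have w1 := wpos (y i); have w2 := wpos (y' i).
  have [lt|lt|//] := ltgtP (image_start t y i) (image_start t y' i).
    have := cE' i; rewrite (coding_gap (lcod n) Xz (cE i))//; lia.
  have := cE i; rewrite (coding_gap (lcod n) Xz (cE' i))//; lia.
elim: j => [|j IH]; first by apply: neg.
by apply: neg; rewrite (_ : Negz j.+1 + 1 = Negz j)//; lia.
Qed.

End SadicCodings.

(** * The tower of refinements *)

Section Stages.
Variable (A : finType) (X : set (biseq A)).
Implicit Types (x y z : biseq A) (i j : int).

Record stage := Stage {
  stage_alphabet : finType;
  stage_code : biseq A -> int -> option stage_alphabet;
  stage_word : stage_alphabet -> seq A;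
  stage_radius : nat;
  stage_width : nat;
  stage_coding : coding X stage_code stage_word stage_radius stage_width }.

Definition stage0 : stage := Stage (trivial_coding X).

Record refines (d : nat) (s s' : stage)
    (sub : stage_alphabet s' -> seq (stage_alphabet s)) : Prop := Refines {
  refines_nonempty : (0 < #|stage_alphabet s'|)%N;
  refines_used : forall b, exists x i, X x /\ stage_code s' x i = Some b;
  refines_labels : forall x i b, X x -> stage_code s' x i = Some b ->
    [/\ sub b = labels (@stage_code s) x i (size (stage_word b)),
      stage_code s x i : bool &
      stage_code s x (i + (size (stage_word b))%:Z) : bool];
  refines_wide : forall b, (stage_width s < size (@stage_word s' b))%N;
  refines_width : (stage_width s < stage_width s')%N;
  refines_balanced : forall a b,
    (size (@stage_word s' a) <= d * size (@stage_word s' b))%N;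
  refines_roots : root_set (range (@stage_word s')) #<= `I_d;
  refines_card : forall N, few_powers X N ->
    (#|stage_alphabet s'| <= d * N.*2.+1)%N }.

Hypotheses (mX : minimal_subshift X) (iX : infinite_set X).
Hypothesis lowX : exists K : nat, forall B : nat, exists2 n : nat, (B <= n)%N &
  (complexity X n <= K * n)%N.

Let X0 : X !=set0. Proof. by case: mX. Qed.

(** The scale is taken so large that new blocks are longer than twice the width of
    the given stage. Moving their ends by at most that width changes their lengths
    by a bounded factor. *)
Lemma refinements : exists d : nat, forall s, exists s' sub, refines d (s := s) (s' := s') sub.
Proof.
have [d hd] := cut_rules mX iX lowX.
exists (2 * d.+1)%N => s; have cod := stage_coding s.
pose R := (stage_radius s + stage_width s).+1.
have [L [D [radius [T [cut [typed [NL DL Td rule]]]]]]] := hd R (2 * stage_width s + 1)%N.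
have RP : (stage_radius s + stage_width s < R)%N by [].
have LP : (2 * stage_width s <= L)%N by lia.
exists (Stage (new_coding cod rule RP LP)).
exists (@new_labels _ X _ (@stage_code s) (stage_width s) R D cut).
have wb b := new_word_size cod rule RP LP b.
have Td2 : (#|T| <= 2 * d.+1)%N by lia.
split=> //=.
- exact: (new_nonempty X0 rule RP LP).
- exact: (new_used cod rule RP LP).
- move=> x i b; exact: (new_label cod rule RP LP).
- by move=> b; have := wb b; lia.
- by lia.
- move=> a b; have /andP[_ wa] := wb a; have /andP[wb' _] := wb b.
  apply: leq_trans wa _; apply: (@leq_trans (d.+1 * L)%N); first by rewrite mulSn; lia.
  by rewrite (mulnC 2%N) -mulnA leq_mul2l; apply/orP; right; lia.
- apply: card_le_trans (new_roots cod rule RP LP) _.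
  by rewrite card_le_II.
- move=> N hN; apply: leq_trans (new_card rule hN) _.
  by rewrite leq_mul2r Td2 orbT.
Qed.

Section Tower.
Variable d : nat.
Variable next : stage -> stage.
Variable sub : forall s, stage_alphabet (next s) -> seq (stage_alphabet s).
Hypothesis nextP : forall s, refines d (s' := next s) (@sub s).

Definition tower n : stage := iter n next stage0.

Definition tower_upper n : finType := stage_alphabet (tower n.+1).

(** The case distinction on [n] makes the types agree: the alphabet of index 0 is [A]
    by definition of [level], and the others are those of the stages. *)
Definition tower_morph n : level A tower_upper n.+1 -> seq (level A tower_upper n) :=
  match n with 0%N => @sub (tower 0) | k.+1 => @sub (tower k.+1) end.

Lemma tower_nonempty n : (0 < #|level A tower_upper n|)%N.
Proof.
case: n => [|n]; last exact: refines_nonempty (nextP _).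
by have [x _] := X0; apply/card_gt0P; exists (x 0).
Qed.

Definition tower_code n : biseq A -> int -> option (level A tower_upper n) :=
  match n with 0%N => @stage_code (tower 0) | k.+1 => @stage_code (tower k.+1) end.

Definition tower_word n : level A tower_upper n -> seq A :=
  match n with 0%N => @stage_word (tower 0) | k.+1 => @stage_word (tower k.+1) end.

Lemma tower_coding n : coding X (@tower_code n) (@tower_word n)
  (stage_radius (tower n)) (stage_width (tower n)).
Proof.
by case: n => [|n]; [exact: (stage_coding (tower 0))|exact: (stage_coding (tower n.+1))].
Qed.

Lemma tower_used n (b : level A tower_upper n.+1) :
  exists x i, X x /\ tower_code n.+1 x i = Some b.
Proof. exact: refines_used (nextP _) b. Qed.

Lemma tower_labels n x i (b : level A tower_upper n.+1) : X x ->
  tower_code n.+1 x i = Some b ->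
  [/\ tower_morph b = labels (@tower_code n) x i (size (tower_word b)),
     tower_code n x i : bool & tower_code n x (i + (size (tower_word b))%:Z) : bool].
Proof. by case: n b => [|n] b; exact: (refines_labels (nextP _)). Qed.

Lemma tower_morph_nonempty n (a : level A tower_upper n.+1) : tower_morph a != [::].
Proof.
have [x [i [Xx ea]]] := tower_used a; have [e ci cs] := tower_labels Xx ea.
apply/eqP => m0; have := labels_word (tower_coding n) Xx ci cs.
rewrite -e m0 (coding_word (tower_coding n.+1) Xx ea) => /esym/eqP.
by rewrite (negbTE (coding_nonempty (tower_coding n.+1) a)).
Qed.

Definition tower_sadic : sadic A :=
  SAdic tower_nonempty tower_morph_nonempty.

Lemma tower_width n : (n < stage_width (tower n))%N.
Proof.
elim: n => [//|n IH]; exact: leq_ltn_trans IH (refines_width (nextP _)).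
Qed.

Lemma tower_wide n (b : level A tower_upper n) : (n <= size (tower_word b))%N.
Proof.
case: n b => [//|n] b.
exact: leq_trans (tower_width n) (ltnW (refines_wide (nextP _) b)).
Qed.

Lemma tower_sigma n (a : alphabet tower_sadic n) :
  sigma tower_sadic 0 n a = tower_word a.
Proof.
exact: (@sigma0 _ X tower_sadic tower_code tower_word _ _ tower_coding _ _
  tower_used tower_labels).
Qed.

Lemma tower_range n : range (sigma tower_sadic 0 n) = range (@tower_word n).
Proof. by apply/seteqP; split=> _ [a _ <-]; exists a => //; rewrite tower_sigma. Qed.

Lemma tower_generates : generates tower_sadic X.
Proof.
exact: (@codings_generate _ X tower_sadic tower_code tower_word _ _ mX
  tower_coding (fun _ _ => erefl) (fun _ => erefl) tower_used tower_labels tower_wide).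
Qed.

Lemma tower_recognizable : recognizable tower_sadic.
Proof.
exact: (@codings_recognizable _ X tower_sadic tower_code tower_word _ _ mX
  tower_coding (fun _ _ => erefl) (fun _ => erefl) tower_used tower_labels).
Qed.

End Tower.

Lemma infinite_sadic : exists (d : nat) (s : sadic A),
  [/\ (1 <= d)%N, generates s X,
     forall n, bounded_roots s d n /\ balanced_lengths s d n,
     recognizable s &
     forall n N, few_powers X N -> (#|alphabet s n| <= d * N.*2.+1)%N].
Proof.
have [d hd] := refinements.
have /choice[next hnext] : forall s, exists s', exists sub, refines d (s := s) (s' := s') sub by [].
pose sub s := projT1 (cid (hnext s)).
have nextP s : refines d (s' := next s) (sub s) by rewrite /sub; case: cid.
pose D := (d + #|A| + 1)%N; exists D, (tower_sadic nextP); split; first by rewrite /D; lia.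
- exact: tower_generates.
- move=> n; split.
    rewrite /bounded_roots tower_range; case: n => [|n]; last first.
      by apply: card_le_trans (refines_roots (nextP _)) _; rewrite card_le_II /D; lia.
    apply: (@card_le_trans _ _ _ `I_#|A|); last by rewrite card_le_II /D addnAC leq_addl.
    apply: (card_le_functional (rel := fun a v => is_root [:: a] v)).
      by move=> v [_ [a _ <-] av]; exists a.
    by move=> a v v' _ _; exact: is_root_unique.
  move=> a b; rewrite !tower_sigma; case: n a b => [|n] a b.
    by rewrite /tower_word /= muln1 /D; lia.
  apply: leq_trans (refines_balanced (nextP _) a b) _.
  by rewrite leq_mul2r /D; apply/orP; right; lia.
- exact: tower_recognizable.
- move=> n N hN; case: n => [|n].
    apply: (@leq_trans D); last by rewrite leq_pmulr.
    by rewrite /D addnAC leq_addl.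
  apply: leq_trans (refines_card (nextP _) hN) _.
  by rewrite leq_mul2r /D; apply/orP; right; lia.
Qed.

End Stages.

(** * Finite minimal subshifts *)

Lemma range_roots (A T : finType) (f : T -> seq A) :
  root_set (range f) #<= `I_#|T|.
Proof.
apply: (card_le_functional (rel := fun a v => is_root (f a) v)).
  by move=> v [_ [a _ <-] av]; exists a.
by move=> a v v' _ _; exact: is_root_unique.
Qed.

Section FiniteSubshift.
Variables (A : finType) (X : set (biseq A)).
Hypotheses (mX : minimal_subshift X) (fX : finite_set X).
Implicit Types (x y : biseq A).

(** Two of the shifts of [x] coincide. *)
Lemma finite_periodic x : X x -> exists2 p : nat, (0 < p)%N &
  forall i, x i = x (i + p%:Z).
Proof.
move=> Xx; have [_ sX] := minimal_sub mX; have /finite_seqP[e Xe] := fX.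
pose l := [seq bishift (k : nat)%:Z x | k <- iota 0 (size e).+1].
have : ~~ uniq l.
  apply/negP => ul; suff : (size l <= size e)%N by rewrite size_map size_iota ltnn.
  apply: uniq_leq_size => // y /mapP[k _ ->].
  by have : X (bishift k%:Z x) by [exact: shift_mem]; rewrite Xe.
move=> /(uniqPn x)[i [j []]]; rewrite size_map size_iota => ij jl.
rewrite !(nth_map 0%N) ?size_iota ?(ltn_trans ij)// !nth_iota ?(ltn_trans ij)// => eij.
exists (j - i)%N; first by rewrite subn_gt0.
move=> k; have := congr1 (fun z : biseq A => z (k - i%:Z)) eij.
by rewrite !bishiftE subrK => ->; congr (x _); lia.
Qed.

Variables (x : biseq A) (p : nat).
Hypothesis A0 : (0 < #|A|)%N.
Hypotheses (Xx : X x) (p0 : (0 < p)%N) (xp : forall i, x i = x (i + p%:Z)).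

Definition loop_upper (n : nat) : finType := unit.

Definition loop_morph n : level A loop_upper n.+1 -> seq (level A loop_upper n) :=
  match n with 0%N => fun=> window x 0 p | _.+1 => fun=> [:: tt; tt] end.

Lemma loop_nonempty n : (0 < #|level A loop_upper n|)%N.
Proof. by case: n => [|n]; rewrite ?A0// card_unit. Qed.

Lemma loop_morph_nonempty n (a : level A loop_upper n.+1) : loop_morph a != [::].
Proof. by case: n a => [|n] a //=; rewrite -size_eq0 size_window -lt0n. Qed.

(** The periodic point is the limit of the powers of its period, with exponents
    powers of two. *)
Definition loop : sadic A := SAdic loop_nonempty loop_morph_nonempty.

Lemma loop_sigma n a : sigma loop 0 n.+1 a = window x 0 (2 ^ n * p).
Proof.
elim: n a => [|n IH] a.
  rewrite mul1n /sigma /= /subst_word.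
  by elim: (window x 0 p) => //= b w {2}<-.
rewrite /sigma comp_substS//.
change (subst_word (sigma loop 0 n.+1)
  ([:: tt] ++ [:: tt] : seq (alphabet loop n.+1)) = window x 0 (2 ^ n.+1 * p)).
rewrite subst_word_cat !subst_word_seq1 !IH expnS -mulnA mul2n -addnn window_cat.
congr (_ ++ _); apply/windowP => k _; rewrite add0r.
have xm (m : nat) i : x i = x (i + (m * p)%N%:Z).
  elim: m => [|m IHm]; first by rewrite addr0.
  by rewrite IHm xp; congr (x _); lia.
by rewrite (xm (2 ^ n)%N); congr (x _); lia.
Qed.

Lemma loop_generates : generates loop X.
Proof.
apply/seteqP; split=> [y Yy|y Xy l].
  apply: (subshift_mem (minimal_sub mX)) => l.
  have [m [m0 [a]]] := Yy l; case: m m0 a => [//|m] _ a.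
  rewrite loop_sigma => /infix_window[k [_ e]].
  by exists x, (0 + k%:Z); split=> //; rewrite size_window in e.
have [N hN] := uniform_recurrence mX (language_window (- l%:Z) Xy (ltn0Sn l.*2)).
have [j ij <-] := hN x 0 Xx; rewrite size_window.
pose m := (N + l.*2.+1)%N; exists m.+1; split=> //; exists tt.
rewrite loop_sigma; apply: window_infix; first by lia.
have := ltn_expl m (isT : 1 < 2)%N; move: (2 ^ m)%N => q mq.
have : (q <= q * p)%N by rewrite leq_pmulr.
by move: (q * p)%N => r qr; rewrite /m in mq; lia.
Qed.

End FiniteSubshift.

Lemma finite_sadic (A : finType) (X : set (biseq A)) : minimal_subshift X ->
  finite_set X -> exists (d : nat) (s : sadic A),
  [/\ (1 <= d)%N, generates s X &
     forall n : nat, bounded_roots s d n /\ balanced_lengths s d n].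
Proof.
move=> mX fX; have [x Xx] : X !=set0 by case: mX.
have [p p0 xp] := finite_periodic mX fX Xx.
have A0 : (0 < #|A|)%N by apply/card_gt0P; exists (x 0).
exists (#|A|), (loop x A0 p0); split=> //; first exact: loop_generates.
move=> n; split.
  apply: card_le_trans (range_roots _) _; rewrite card_le_II.
  by case: n => [|n] //; rewrite /alphabet /= card_unit.
move=> a b; case: n a b => [|n] a b; first by rewrite /sigma /= muln1.
by rewrite !loop_sigma// leq_pmull.
Qed.

(** * Complexity of subshifts generated by balanced sequences with few roots *)

Section LowComplexity.
Variables (A : finType) (X : set (biseq A)).
Implicit Types (x y : biseq A) (r v w : seq A).

Definition cyclic_word (a0 : A) r (i len : nat) : seq A :=
  mkseq (fun j => nth a0 r ((i + j) %% size r)) len.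

Lemma take_drop_wpow a0 r k i len : (i + len <= k * size r)%N ->
  take len (drop i (wpow r k)) = cyclic_word a0 r i len.
Proof.
move=> ik; have sz : size (take len (drop i (wpow r k))) = len.
  by rewrite size_takel// size_drop size_wpow; lia.
apply: (@eq_from_nth _ a0); rewrite sz ?size_mkseq// => j jl.
by rewrite nth_take// nth_drop nth_mkseq// nth_wpow//; lia.
Qed.

Lemma cyclic_word_mod a0 r i i' len : i = i' %[mod size r] ->
  cyclic_word a0 r i len = cyclic_word a0 r i' len.
Proof. by move=> e; apply: eq_mkseq => j; rewrite -modnDml e modnDml. Qed.

Lemma root_exists w : w != [::] -> exists v, is_root w v.
Proof.
move=> w0; pose P (k : nat) := `[< exists2 v, is_proot w v & size v = k >].
have exP : exists k, P k.
  exists (size w); apply/asboolP; exists w => //; split; first exact: prefix_refl.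
  by exists 1%N => //; rewrite /wpow /= cats0.
case: (ex_minnP exP) => k /asboolP[v pv vk] mk; exists v; split=> // v' pv'.
by rewrite vk; apply: mk; apply/asboolP; exists v'.
Qed.

(** A word of length [m] cannot strictly contain an image, so it meets at most two
    of them. *)
Lemma word_in_image (B : finType) (t : B -> seq A) m (u : seq B) k :
  (0 < m)%N -> (forall b, (m <= size (t b))%N) ->
  (k + m <= size (subst_word t u))%N ->
  exists b i, (i < size (t b))%N /\
   ((i + m <= size (t b))%N /\ take m (drop k (subst_word t u)) = take m (drop i (t b)) \/
    (size (t b) < i + m)%N /\ exists c, take m (drop k (subst_word t u)) =
      drop i (t b) ++ take (m - (size (t b) - i)) (t c)).
Proof.
move=> m0 tm; elim: u k => [|b u IH] k; first by rewrite /subst_word /=; lia.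
have -> : subst_word t (b :: u) = t b ++ subst_word t u by [].
rewrite size_cat => ks; have [kb|kb] := ltnP k (size (t b)); last first.
  rewrite drop_cat ltnNge kb /=.
  have [|b' [i [ib h]]] := IH (k - size (t b))%N; first by lia.
  by exists b', i.
exists b, k; split=> //; rewrite drop_cat kb.
have [kmb|kmb] := leqP (k + m) (size (t b)).
  by left; split=> //; rewrite takel_cat// size_drop; lia.
right; split=> //; case: u ks {IH} => [|c u] ks; first by move: ks; rewrite /subst_word /=; lia.
exists c; rewrite take_cat size_drop ltnNge; case: leqP => [_|]; last by lia.
congr (_ ++ _); rewrite [subst_word t _]/(t c ++ subst_word t u) takel_cat//.
by have := tm c; lia.
Qed.

Lemma card_le_list (T : choiceType) (S : set T) (d : nat) : S #<= `I_d ->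
  exists2 l : seq T, (size l <= d)%N & forall e, S e -> e \in l.
Proof.
move=> Sd; have fS : finite_set S by apply: card_le_finite Sd _; exact: finite_II.
exists (finmap.enum_fset (fset_set S)); first exact: geq_card_fset_set.
by move=> v Sv; have := in_fset_set fS v; rewrite (mem_set Sv) => h; exact: h.
Qed.

Variable s : sadic A.
Variable d : nat.
Hypotheses (X0 : X !=set0) (gX : generates s X).
Hypothesis rootP : forall n, bounded_roots s d n.
Hypothesis balP : forall n, balanced_lengths s d n.

Lemma level_factor n w : language X w -> exists u, infix w (subst_word (sigma s 0 n) u).
Proof.
move=> /languageE[x [i [Xx <-]]]; move: (size w) => m.
pose Bd := (\max_(M < n) \max_(a : alphabet s M) size (sigma s 0 M a))%N.
pose l := (absz i + m + Bd)%N.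
have /(_ l)[M [_ [a]]] : sadic_level s 0 x by rewrite gX.
have [Mn|nM] := ltnP M n.
  move=> /size_infix; rewrite size_window => le.
  have : (size (sigma s 0 M a) <= Bd)%N.
    apply: (leq_trans _ (leq_bigmax (Ordinal Mn))).
    exact: (leq_bigmax a).
  by move=> /(leq_trans le); rewrite /l; lia.
rewrite /sigma (comp_substD _ a (leq0n n) nM) => wi.
exists (sigma s n M a); apply: infix_trans wi.
by apply: window_infix; rewrite /l; lia.
Qed.

(** With [m] the least length of the image of a letter, words of length [m] lie in
    the product of two images. These are powers of at most [d] roots and have
    length at most [d m], so that a word is given by a root and a phase, or by two
    roots and the place where their powers meet. *)
Lemma sadic_complexity : exists K : nat, forall B : nat,
  exists2 n : nat, (B <= n)%N & (complexity X n <= K * n)%N.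
Proof.
exists (3 * d * d)%N => B; have [x Xx] := X0; pose a0 := x 0 : A.
have /(_ (d * B.+1)%N)[n [_ [a wa]]] : sadic_level s 0 x by rewrite gX.
pose t := sigma s 0 n; have ta : (d * B.+1 < size (t a))%N.
  by apply: leq_trans (size_infix wa); rewrite size_window; lia.
pose b0 := [arg min_(b < a) size (t b)]; pose m := size (t b0).
have tm b : (m <= size (t b))%N by rewrite /m /b0; case: arg_minnP => // c _; exact.
have dm b : (size (t b) <= d * m)%N by exact: balP.
have Bm : (B < m)%N.
  by have := dm a; move=> /(leq_trans ta); case: (d) => [|e]; nia.
have m0 : (0 < m)%N by lia.
have t0 b : t b != [::] by rewrite -size_eq0 -lt0n; exact: leq_trans m0 (tm b).
have [rl rls rlP] := card_le_list (rootP n).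
exists m; first exact: ltnW.
(* words within one image: a root and a phase *)
pose L1 := [seq cyclic_word a0 r i m | r <- rl, i <- iota 0 (d * m)].
(* words across two images: [e] letters come before the border, so that the phase is
   [- e] modulo the length of the first root *)
pose L2 := [seq cyclic_word a0 rr.1 ((size rr.1).-1 * e) e ++
  cyclic_word a0 rr.2 0 (m - e) | rr <- [seq (r, r') | r <- rl, r' <- rl], e <- iota 0 m.+1].
have rootE b : exists r k, [/\ r \in rl, (0 < size r)%N, t b = wpow r k & (size r <= d * m)%N].
  have [r rr] := root_exists (t0 b); have [[pr [k k0 e]] _] := rr.
  exists r, k; split=> //; first by apply: rlP; exists (t b) => //; exists b.
    rewrite lt0n size_eq0; apply/eqP => r0; have := t0 b; rewrite e r0.
    by rewrite /wpow; elim: (k) => //.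
  apply: leq_trans (dm b); rewrite e size_wpow leq_pmull//.
suff : (complexity X m <= size (L1 ++ L2))%N.
  rewrite size_cat !size_allpairs !size_iota.
  have : (size rl * (d * m) <= d * (d * m))%N by rewrite leq_mul2r rls orbT.
  have : (size rl * size rl * m.+1 <= d * d * (2 * m))%N.
    by apply: leq_mul; [exact: leq_mul|lia].
  move=> h1 h2 h3; apply: leq_trans h3 _; apply: leq_trans (leq_add h2 h1) _.
  by rewrite -!mulnA -mulnDr; nia.
rewrite -size_words; apply: uniq_leq_size; first exact: words_uniq.
move=> w /mem_words[wm Lw]; have [u /infixP[v1 [v2 e]]] := level_factor n Lw.
have we : w = take m (drop (size v1) (subst_word t u)).
  by rewrite [subst_word t u]e drop_size_cat// take_size_cat.
have [|b [i [ib H]]] := @word_in_image _ t m u (size v1) m0 tm.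
  by rewrite [subst_word t u]e !size_cat wm addnA leq_addr.
have [r [k [rrl r0 tb rd]]] := rootE b; rewrite -we in H.
have sb : size (t b) = (k * size r)%N by rewrite tb size_wpow.
rewrite mem_cat; case: H => [[im ->]|[mi [c ->]]].
  apply/orP; left; rewrite tb (take_drop_wpow a0) -?sb//.
  rewrite (@cyclic_word_mod _ _ _ (i %% size r)); last by rewrite modn_mod.
  apply: allpairs_f => //; rewrite mem_iota /=.
  by apply: leq_trans rd; rewrite ltn_mod.
apply/orP; right; have [r' [k' [rrl' r0' tc rd']]] := rootE c.
pose e' := (size (t b) - i)%N.
have e1 : drop i (t b) = cyclic_word a0 r ((size r).-1 * e') e'.
  rewrite -[drop i _](@take_oversize _ e') ?size_drop// tb (take_drop_wpow a0); last first.
    by rewrite -sb /e' subnKC// ltnW.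
  apply: cyclic_word_mod; apply/eqP; rewrite -(eqn_modDr e').
  have -> : (i + e' = k * size r)%N by rewrite /e' -sb subnKC// ltnW.
  have -> : ((size r).-1 * e' + e' = e' * size r)%N.
    by rewrite -{2}[e']mul1n -mulnDl addn1 prednK// mulnC.
  by rewrite !modnMl.
have sc : size (t c) = (k' * size r')%N by rewrite tc size_wpow.
have e2 : take (m - e') (t c) = cyclic_word a0 r' 0 (m - e').
  rewrite -[t c]drop0 tc (take_drop_wpow a0)// -sc.
  by rewrite add0n; exact: leq_trans (leq_subr _ _) (tm c).
rewrite -/e' e1 e2.
apply/allpairsP; exists ((r, r'), e'); split=> //=; first exact: allpairs_f.
by rewrite -[0%N :: _]/(iota 0 m.+1) mem_iota /= add0n ltnS leq_subLR ltnW.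
Qed.

End LowComplexity.

(** * Power complexity and conclusion *)

Section PowerComplexity.
Variables (R : realType) (A : finType) (X : set (biseq A)).
Implicit Types (x : biseq A) (v : seq A).

Lemma counting_powcom v : v != [::] -> (counting (Pow X v) <= powcom R X)%E.
Proof. by move=> v0; apply: ereal_sup_ubound; exists v. Qed.

Lemma powcom_few_powers (r : R) : 0 <= r -> (powcom R X <= r%:E)%E ->
  few_powers X (Num.truncn r).
Proof.
move=> r0 Xr v v0; have := le_trans (counting_powcom v0) Xr.
rewrite /counting; case: asboolP => // fS; rewrite lee_fin -truncn_ge_nat// => le.
exists (finmap.enum_fset (fset_set (Pow X v))); first exact: le.
by move=> u Pu; have := in_fset_set fS u; rewrite (mem_set Pu) => h; exact: h.
Qed.

(** A maximal run of one letter belongs to [Pow X v], where [v] is that letter. *)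
Lemma powcom_ge1 : minimal_subshift X -> infinite_set X -> (1 <= powcom R X)%E.
Proof.
move=> mX iX; have [x Xx] : X !=set0 by case: mX.
have [B hB] := aperiodicity mX iX (ltn0Sn 0).
have [j _ xj] := hB x 0 Xx.
pose P (k : nat) := `[< x (j + 1 + k%:Z) <> x (j + 1 + k%:Z + 1) >].
have exP : exists k, P k.
  have [i ij xi] := hB x (j + 1) Xx; exists (absz (i - (j + 1))%R); apply/asboolP.
  by rewrite (_ : j + 1 + _ = i)//; lia.
case: (ex_minnP exP) => k /asboolP xk mk.
have run : per x (j + 1) (j + 1 + k%:Z + 1) 1%N%:Z.
  move=> i ji ik; apply: contrapT => xi.
  have : P (absz (i - (j + 1))%R).
    by apply/asboolP; rewrite (_ : j + 1 + _ = i)//; lia.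
  by move/mk; lia.
have ls : x (j + 1 - 1) <> x (j + 1 - 1 + 1%N%:Z) by rewrite addrK.
have lt : x (j + 1 + k%:Z + 1 - 1%N%:Z) <> x (j + 1 + k%:Z + 1).
  by have -> : j + 1 + k%:Z + 1 - 1%N%:Z = j + 1 + k%:Z by lia.
have L1 : 1%N%:Z <= j + 1 + k%:Z + 1 - (j + 1) by lia.
have [l [_ Pl]] := maximal_period_Pow Xx (ltn0Sn 0) L1 run ls lt.
have := counting_powcom (v := window x (j + 1 + k%:Z + 1 - 1%N%:Z) 1) isT.
apply: le_trans; rewrite /counting; case: asboolP => [fS|_]; last exact: leey.
rewrite lee_fin ler1n finmap.cardfs_gt0; apply/finmap.fset0Pn.
by eexists; rewrite in_fset_set// inE; exact: Pl.
Qed.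

(** If the power complexity is finite, then its integer part [N] satisfies
    [few_powers X N], and it is at least 1. *)
Lemma powcom_bound (d a : nat) : (1 <= d)%N -> minimal_subshift X -> infinite_set X ->
  (forall N, few_powers X N -> (a <= d * N.*2.+1)%N) ->
  ((a%:R : R)%:E <= ((3 * d)%N%:R : R)%:E * powcom R X ^+ 4)%E.
Proof.
move=> d1 mX iX bound; have p1 := powcom_ge1 mX iX.
have few := powcom_few_powers.
move: few p1; case: (powcom R X) => [r| |] few p1 //; last first.
  rewrite (_ : +oo ^+ 4 = +oo)%E // gt0_muley ?leey// lte_fin ltr0n; lia.
have r1 : 1 <= r by move: p1; rewrite lee_fin.
have r0 : 0 <= r by apply: le_trans r1.
have Nr := truncn_le r; rewrite r0 in Nr.
have N1 : (1 <= Num.truncn r)%N by rewrite truncn_ge_nat.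
have aN := bound _ (few r r0 (lexx _)).
rewrite -EFin_expe -EFinM lee_fin.
apply: (@le_trans _ _ ((3 * d)%N%:R * r)); last first.
  by rewrite ler_wpM2l// ler_eXnr.
apply: (@le_trans _ _ ((3 * d)%N%:R * (Num.truncn r)%:R)); last by rewrite ler_wpM2l.
rewrite -natrM ler_nat; apply: leq_trans aN _.
by rewrite mulnAC mulnC leq_mul2r; apply/orP; right; lia.
Qed.

End PowerComplexity.

Theorem theorem7 (R : realType) (A : finType) (hA : (0 < #|A|)%N)
    (X : set (biseq A)) (hX : minimal_subshift X) :
  (nonsuperlinear R X <->
   exists (d : nat) (s : sadic A),
     [/\ (1 <= d)%N, generates s X &
         forall n : nat, bounded_roots s d n /\ balanced_lengths s d n])
  /\
  (infinite_set X -> nonsuperlinear R X ->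
   exists (d : nat) (s : sadic A),
     [/\ (1 <= d)%N, generates s X,
         forall n : nat, bounded_roots s d n /\ balanced_lengths s d n,
         recognizable s &
         forall n : nat,
           ((#|alphabet s n|%:R : R)%:E <= (d%:R : R)%:E * powcom R X ^+ 4)%E]).
Proof.
have X0 : X !=set0 by case: hX.
split=> [|iX /nonsuperlinearP lowX].
  split=> [/nonsuperlinearP lowX|[d [s [d1 gX dX]]]]; last first.
    apply/nonsuperlinearP; apply: (sadic_complexity (d := d) X0 gX) => n.
      by have [] := dX n.
    by have [] := dX n.
  have [fX|iX] := pselect (finite_set X); first exact: finite_sadic.
  have [d [s [d1 gX dX _ _]]] := infinite_sadic hX iX lowX.
  by exists d, s.
have [d [s [d1 gX dX rX cX]]] := infinite_sadic hX iX lowX.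
exists (3 * d)%N, s; split=> // [|n|n]; first by lia.
  have [bR bL] := dX n; split.
    by apply: card_le_trans bR _; rewrite card_le_II; lia.
  by move=> a b; apply: leq_trans (bL a b) _; rewrite leq_mul2r; apply/orP; right; lia.
by apply: powcom_bound => // N; exact: cX.
Qed.
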